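(* Let $c\ge 0$ be a constant and let $G=G(n,p)$ be the Erdős–Rényi random graph with $p=c/n$. The following hold asymptotically almost surely as $n\to\infty$: (i) If $c>1$, then the rank-width, the clique-width and the tree-width of $G$ are all at least $c'n$ for some constant $c'>0$ depending only on $c$. (ii) If $c<1$, then the rank-width and the tree-width of $G$ are at most $2$ and the clique-width of $G$ is at most $5$.
   Context: Graphs are finite and have neither loops nor parallel edges. $G(n,p)$ is the random graph on vertex set $\{1,\dots,n\}$ in which each unordered pair of distinct vertices is adjacent with probability $p$, independently of all other pairs (only $n$ large enough that $c/n\le1$ is considered). A property holds asymptotically almost surely if the probability that $G(n,p)$ has it tends to $1$ as $n\to\infty$. Rank-width: for disjoint $V_1,V_2\subseteq V(G)$, let $N_{V_1,V_2}$ be the $|V_1|\times|V_2|$ matrix over $\mathbb F_2=\{0,1\}$ with rows labeled by $V_1$ and columns by $V_2$, whose $(v_1,v_2)$ entry is $1$ iff $v_1$ and $v_2$ are adjacent in $G$. The cutrank is $\rho_G(V_1,V_2)=\mathbf{rank}(N_{V_1,V_2})$ (rank over $\mathbb F_2$). A tree is subcubic if every vertex has degree $1$ or $3$. A rank-decomposition of $G$ is a pair $(T,L)$ of a subcubic tree $T$ and a bijection $L$ from $V(G)$ to the set of leaves of $T$. Deleting an edge $uv$ of $T$ leaves two components $C_u\ni u$ and $C_v\ni v$; let $A_{uv}$ and $B_{uv}$ be the sets of vertices of $G$ mapped by $L$ to leaves of $T$ in $C_u$ and in $C_v$, respectively. The rank-width is $\min_{(T,L)}\max_{uv\in E(T)}\rho_G(A_{uv},B_{uv})$,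 the minimum being over all rank-decompositions of $G$; it is $0$ if $|V(G)|\le1$. Tree-width (Robertson–Seymour) is the usual one: the minimum over all tree-decompositions of (maximum bag size) $-1$. Clique-width (Courcelle–Olariu): the minimum number of labels needed to construct $G$ (up to isomorphism, ignoring labels) as a vertex-labeled graph by the operations: create a single vertex with label $i$; take the disjoint union of two labeled graphs; for labels $i\ne j$, add all edges between vertices labeled $i$ and vertices labeled $j$; change all labels $i$ to $j$. *)

(* Defs.v *)
From HB Require Import structures.
From mathcomp Require Import all_boot all_order all_algebra.
From mathcomp Require Import boolp classical_sets reals topology normedtype.
From mathcomp Require Import sequences.
Set Implicit Arguments.
Unset Strict Implicit.
Unset Printing Implicit Defensive.
Import Order.TTheory GRing.Theory Num.Theory.
Import numFieldNormedType.Exports.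

Local Open Scope ring_scope.

(* A simple graph on [V] is its set of edges, each edge being a 2-element set
   of vertices; so [adj G] is symmetric and irreflexive, and [sgraph V] is a
   finType. *)
Definition sgraph (V : finType) : finType :=
  {E : {set {set V}} | [forall e in E, #|e| == 2%N]}.

Definition edges (V : finType) (G : sgraph V) : {set {set V}} := val G.

Definition adj (V : finType) (G : sgraph V) : rel V :=
  fun x y => [set x; y]%SET \in edges G.

Definition degree (V : finType) (G : sgraph V) (x : V) : nat :=
  #|[pred y | adj G x y]|.

(* Since [adj T] is symmetric, both end-vertices of an edge form a [ucycle] of
   size 2, which is not a cycle of the graph. *)
Definition is_tree (V : finType) (T : sgraph V) : Prop :=
  [/\ (0 < #|V|)%N,
      forall x y : V, connect (adj T) x y &
      forall s : seq V, ucycle (adj T) s -> (size s <= 2)%N].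

(* The minimum of a nonempty set of natural numbers (0 for the empty set). *)
Definition minimum (S : set nat) : nat :=
  xget 0%N [set k | S k /\ forall j, S j -> (k <= j)%N]%classic.

Definition cutrank (V : finType) (G : sgraph V) (A B : {set V}) : nat :=
  \rank (\matrix_(i < #|A|, j < #|B|)
           (adj G (enum_val i) (enum_val j))%:R : 'M['F_2]_(#|A|, #|B|)).

Record rank_decomposition (V : finType) := RankDecomposition {
  rd_node : finType;
  rd_tree : sgraph rd_node;
  rd_leaf : V -> rd_node;
  rd_treeP : is_tree rd_tree;
  rd_subcubic : forall t, degree rd_tree t = 1%N \/ degree rd_tree t = 3%N;
  rd_leaf_inj : injective rd_leaf;
  rd_leaf_codom : forall t, degree rd_tree t = 1%N <-> exists x, rd_leaf x = t
}.

Definition delete_edge (V : finType) (G : sgraph V) (u v : V) : rel V :=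
  fun x y => adj G x y && ([set x; y] != [set u; v])%SET.

(* This is A_uv; B_uv is [rd_side D v u]. *)
Definition rd_side (V : finType) (D : rank_decomposition V)
    (u v : rd_node D) : {set V} :=
  [set x | connect (delete_edge (rd_tree D) u v) u (rd_leaf D x)]%SET.

Definition rd_width (V : finType) (G : sgraph V) (D : rank_decomposition V) :=
  \max_(uv : rd_node D * rd_node D | adj (rd_tree D) uv.1 uv.2)
    cutrank G (rd_side uv.1 uv.2) (rd_side uv.2 uv.1).

Definition rank_width (V : finType) (G : sgraph V) : nat :=
  if (#|V| <= 1)%N then 0%N else
  minimum [set k | exists D : rank_decomposition V, rd_width G D = k]%classic.

Record tree_decomposition (V : finType) (G : sgraph V) := TreeDecomposition {
  td_node : finType;
  td_tree : sgraph td_node;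
  td_bag : td_node -> {set V};
  td_treeP : is_tree td_tree;
  td_vertex : forall x, exists t, x \in td_bag t;
  td_edge : forall x y, adj G x y ->
    exists t, (x \in td_bag t) && (y \in td_bag t);
  td_connected : forall x s t, x \in td_bag s -> x \in td_bag t ->
    connect [rel a b | [&& adj td_tree a b, x \in td_bag a & x \in td_bag b]]
      s t
}.

(* The predecessor is truncated, which matters only for the graph without
   vertices: its tree-width is 0 here instead of -1. *)
Definition td_width (V : finType) (G : sgraph V) (D : tree_decomposition G) :=
  (\max_(t : td_node D) #|td_bag t|).-1.

Definition tree_width (V : finType) (G : sgraph V) : nat :=
  minimum [set k | exists D : tree_decomposition G, td_width D = k]%classic.

Record labeled_graph (k : nat) := LabeledGraph {
  lg_vertex : finType;
  lg_adj : rel lg_vertex;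
  lg_label : lg_vertex -> 'I_k
}.

Definition lg_single (k : nat) (i : 'I_k) : labeled_graph k :=
  @LabeledGraph k unit (fun _ _ => false) (fun _ => i).

Definition lg_union (k : nat) (G H : labeled_graph k) : labeled_graph k :=
  @LabeledGraph k (lg_vertex G + lg_vertex H)%type
    (fun x y => match x, y with
                | inl a, inl b => lg_adj a b
                | inr a, inr b => lg_adj a b
                | _, _ => false
                end)
    (fun x => match x with inl a => lg_label a | inr a => lg_label a end).

Definition lg_join (k : nat) (i j : 'I_k) (G : labeled_graph k) :=
  @LabeledGraph k (lg_vertex G)
    (fun x y => [|| lg_adj x y,
                    (lg_label x == i) && (lg_label y == j) |
                    (lg_label x == j) && (lg_label y == i)])
    (@lg_label k G).

Definition lg_relabel (k : nat) (i j : 'I_k) (G : labeled_graph k) :=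
  @LabeledGraph k (lg_vertex G) (@lg_adj k G)
    (fun x => if lg_label x == i then j else lg_label x).

Inductive cw_expression (k : nat) : Type :=
| CWSingle of 'I_k
| CWUnion of cw_expression k & cw_expression k
| CWJoin (i j : 'I_k) of i != j & cw_expression k
| CWRelabel of 'I_k & 'I_k & cw_expression k.

Fixpoint cw_eval (k : nat) (e : cw_expression k) : labeled_graph k :=
  match e with
  | CWSingle i => lg_single i
  | CWUnion e1 e2 => lg_union (cw_eval e1) (cw_eval e2)
  | CWJoin i j _ e1 => lg_join i j (cw_eval e1)
  | CWRelabel i j e1 => lg_relabel i j (cw_eval e1)
  end.

Definition cw_constructs (k : nat) (e : cw_expression k)
    (V : finType) (G : sgraph V) : Prop :=
  exists f : V -> lg_vertex (cw_eval e),
    bijective f /\ forall x y, adj G x y = lg_adj (f x) (f y).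

Definition clique_width (V : finType) (G : sgraph V) : nat :=
  minimum [set k | exists e : cw_expression k, cw_constructs e G]%classic.

Definition gnp_mass (R : realType) (n : nat) (p : R) (G : sgraph 'I_n) : R :=
  \prod_(e : {set 'I_n} | #|e| == 2%N) (if e \in edges G then p else 1 - p).

Definition gnp_prob (R : realType) (n : nat) (p : R)
    (P : sgraph 'I_n -> Prop) : R :=
  \sum_(G : sgraph 'I_n | `[< P G >]) gnp_mass p G.

(* The finitely many [n] with [c / n%:R > 1], for which [gnp_mass] is not a
   probability, and [n = 0], where [c / 0 = 0], do not affect the limit. *)
Definition gnp_aas (R : realType) (c : R)
    (P : forall n : nat, sgraph 'I_n -> Prop) : Prop :=
  ((fun n : nat => gnp_prob (c / n%:R) (@P n)) @ \oo --> (1 : R))%classic.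

(* Main.v *)
Require Import Defs.
From HB Require Import structures.
From mathcomp Require Import boolp classical_sets reals topology normedtype.
From mathcomp Require Import sequences exp.
From mathcomp Require Import all_boot all_order all_algebra zify ring lra.
Set Implicit Arguments.
Unset Strict Implicit.
Unset Printing Implicit Defensive.
Import Order.TTheory GRing.Theory Num.Theory.
Import numFieldNormedType.Exports.

(** Below the threshold, the expected number of subgraphs with [k + 1] edges on [k]
    vertices formed by a path and two chords at its ends is [O(1/n)]; without them each
    component has at most one cycle. Contracting pendant trees and going around the
    cycles, the vertex set is built from singletons by disjoint unions [A :|: B] in which
    at most 3 vertices of [A] or [B] have a neighbour outside their part, and at most 2
    vertices of the union one outside the union. Such a construction is at the same time
    a rank-decomposition, a tree-decomposition and a clique-width expression.

    Above the threshold, choose [1 < c1 < c]. With high probability every small vertex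
    set has few neighbours, so that a small width of any of the three kinds gives a small
    set [Z] whose removal splits any prescribed large set [W] in a balanced way. Let [W]
    be the set of the vertices reachable in [G(n,c1/n)] from a few given roots; it has at
    least [sigma * n] elements and is spanned by a forest on these roots. Few trees
    remain after deleting [Z], so that there are few splittings of [W] compatible with
    the forest, and the edges added to obtain [G(n,c/n)] destroy all of them. *)

(** * Graphs and trees *)

(** Small rank-width or clique-width does not by itself give a small separator: a complete bipartite
    cut has rank 1. It gives a few vertices that dominate all neighbours across a balanced cut, and
    the bound on neighbourhoods turns these into a separator. The obstacle above the threshold is
    the union bound over the splittings of [W]. There are 2^|W| unrestricted ones, while the added
    edges miss a balanced one with a probability of order exp(- eps * |W|^2 / (16 * n)), where eps =
    c - c1; this is too weak unless c is large. Along the forest a splitting is determined by the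
    colours of the roots and of the neighbours of [Z], which leaves exp(small * n) choices. Hence a
    chain of linear sizes: widths below [k], separators of size [z], neighbourhoods of size [b],
    each chosen small in terms of the next. The roots are linearly many too. The vertices reached
    from a single root are few with a probability bounded away from 0, but those reached from [r]
    roots are few only with a probability exponentially small in [r]; a first moment bound then
    replaces the study of the giant component. *)

Section Graphs.
Variable (V : finType).
Implicit Types (G : sgraph V) (S A B : {set V}).

Lemma adj_sym G : symmetric (adj G).
Proof. by move=> x y; rewrite /adj setUC. Qed.

Lemma adj_neq G x y : adj G x y -> x != y.
Proof.
rewrite /adj /edges; case: G => E /= /forallP hE hxy.
have /implyP/(_ hxy) := hE [set x; y].
by rewrite cards2; case: (x != y).
Qed.

Fact rel_graph_subproof (e : rel V) :
  [forall f in [set [set p.1; p.2] | p : V * V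
                 & (p.1 != p.2) && (e p.1 p.2 || e p.2 p.1)], #|f : {set V}| == 2].
Proof.
apply/forallP => f; apply/implyP => /imsetP [[x y]].
by rewrite inE /= => /andP [hxy _] ->; rewrite cards2 hxy.
Qed.

Definition rel_graph (e : rel V) : sgraph V :=
  exist (fun E : {set {set V}} => is_true [forall f in E, #|f| == 2]) _
    (rel_graph_subproof e).

Lemma set2_inj (x y z t : V) :
  [set x; y] = [set z; t] -> (x = z /\ y = t) \/ (x = t /\ y = z).
Proof.
move=> h.
have: x \in [set z; t] by rewrite -h !inE eqxx.
have: y \in [set z; t] by rewrite -h !inE eqxx orbT.
have: z \in [set x; y] by rewrite h !inE eqxx.
have: t \in [set x; y] by rewrite h !inE eqxx orbT.
rewrite !inE => /orP[]/eqP-> /orP[]/eqP-> /orP[]/eqP ? /orP[]/eqP ?; subst; by auto.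
Qed.

Lemma adj_rel_graph (e : rel V) x y :
  adj (rel_graph e) x y = (x != y) && (e x y || e y x).
Proof.
rewrite /adj /edges /=; apply/imsetP/idP => [[[a b]]|h].
  rewrite inE /= => hab /set2_inj [] [-> ->] //.
  by rewrite eq_sym orbC.
by exists (x, y) => //; rewrite inE.
Qed.

Definition boundary G S := [set x in S | [exists y, (y \notin S) && adj G x y]].

Lemma boundaryP G S x : reflect (x \in S /\ exists2 y, y \notin S & adj G x y)
  (x \in boundary G S).
Proof.
rewrite inE; apply: (iffP andP) => [[hx /existsP [y /andP [h1 h2]]]|[hx [y h1 h2]]].
  by split => //; exists y.
by split => //; apply/existsP; exists y; rewrite h1.
Qed.

Lemma boundary_sub G S : boundary G S \subset S.
Proof. by apply/subsetP => x /boundaryP []. Qed.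

Lemma boundary_mono G A B x : A \subset B -> x \in A -> x \in boundary G B ->
  x \in boundary G A.
Proof.
move=> /subsetP h hA /boundaryP [_ [y hy hxy]]; apply/boundaryP; split => //.
by exists y => //; apply: contra hy => /h.
Qed.

Lemma boundaryU G A B : boundary G (A :|: B) \subset boundary G A :|: boundary G B.
Proof.
apply/subsetP => x hx; have := subsetP (boundary_sub _ _) _ hx.
rewrite !inE -/(boundary G A) => /orP [] h; apply/orP; [left|right].
  by have := boundary_mono (subsetUl A B) h hx; rewrite inE.
by have := boundary_mono (subsetUr A B) h hx; rewrite inE.
Qed.

Lemma cutrankC G A B : cutrank G A B = cutrank G B A.
Proof.
rewrite /cutrank -mxrank_tr; congr (\rank _).
by apply/matrixP => i j; rewrite !mxE adj_sym.
Qed.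

(** A vertex of [A] outside [boundary G S] has no neighbour in [B], so its row vanishes. Hence the
    matrix is the product of a selection matrix [P] and the rows [N] of the boundary vertices. *)
Lemma cutrank_boundary G S A B : A \subset S -> [disjoint B & S] ->
  (cutrank G A B <= #|boundary G S|)%N.
Proof.
move=> hA hB; rewrite /cutrank; set M := (X in \rank X).
pose P : 'M['F_2]_(#|A|, #|boundary G S|) :=
  (\matrix_(i, j) (enum_val i == enum_val j)%:R)%R.
pose N : 'M['F_2]_(#|boundary G S|, #|B|) :=
  (\matrix_(i, j) (adj G (enum_val i) (enum_val j))%:R)%R.
have -> : M = (P *m N)%R.
  apply/matrixP => i k; rewrite !mxE.
  have [hi|hi] := boolP (enum_val i \in boundary G S); last first.
    rewrite big1 => [|j _].
      case: (boolP (adj _ _ _)) => // hik; case/negP: hi.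
      apply/boundaryP; split; first by rewrite (subsetP hA) ?enum_valP.
      by exists (enum_val k) => //; rewrite (disjointFr hB) ?enum_valP.
    rewrite !mxE; case: eqP => [h|]; last by rewrite mul0r.
    by case/negP: hi; rewrite h enum_valP.
  rewrite (bigD1 (enum_rank_in hi (enum_val i))) //= big1 => [|j hj].
    by rewrite !mxE enum_rankK_in // eqxx addr0 mul1r.
  rewrite !mxE; case: eqP => [h|]; last by rewrite mul0r.
  by case/eqP: hj; apply: enum_val_inj; rewrite enum_rankK_in.
exact: leq_trans (mxrankM_maxl _ _) (rank_leq_col _).
Qed.

Lemma degree_seq G x s : uniq s -> (forall y, adj G x y = (y \in s)) ->
  degree G x = size s.
Proof.
move=> hs h; rewrite -(card_uniqP hs) /degree; apply: eq_card => y.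
by rewrite inE h.
Qed.

(* A vertex of a cycle that is farthest from the root has its parent as its only
   neighbour in the cycle. *)
Lemma parent_tree (par : V -> V) (root : V) (d : V -> nat) :
  par root = root -> (forall x, x != root -> (d (par x) < d x)%N) ->
  is_tree (rel_graph (fun x y => par x == y)).
Proof.
move=> hroot hd; set T := rel_graph _; split.
- by apply/card_gt0P; exists root.
- have h x : connect (adj T) x root.
    have [n] := ubnP (d x); elim: n x => // n IH x hx.
    have [->|hxr] := eqVneq x root; first exact: connect0.
    apply: connect_trans (IH (par x) _); last by apply: leq_trans (hd _ hxr) _.
    apply: connect1; rewrite adj_rel_graph eqxx andbT.
    by apply: contraTneq (hd _ hxr) => <-; rewrite ltnn.
  move=> x y; apply: connect_trans (h x) _.
  by rewrite (sym_connect_sym (@adj_sym T)).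
- move=> s /andP [hc hu]; rewrite leqNgt; apply/negP => hs.
  have [x0 hx0] : exists x, x \in s.
    by case: s hs {hc hu} => // x s _; exists x; rewrite inE eqxx.
  have [x hx hmax] := @arg_maxnP _ x0 (mem s) d hx0.
  have key y : y \in s -> adj T x y -> y = par x.
    move=> hy; rewrite adj_rel_graph => /andP [hxy /orP [/eqP //|/eqP h]].
    have [hyr|hyr] := eqVneq y root.
      by rewrite -h hyr hroot eqxx in hxy.
    by have := hd _ hyr; rewrite h ltnNge; have /= -> := hmax _ hy.
  have h1 := key _ (etrans (mem_next s x) hx) (next_cycle hc hx).
  have h2 : prev s x = par x.
    by apply: key; rewrite ?mem_prev // adj_sym; apply: prev_cycle.
  have h3 : next s (next s x) = x by rewrite h1 -h2 next_prev.
  have [i s' hrot] := rot_to hx.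
  have hs' : size (x :: s') = size s by rewrite -hrot size_rot.
  move: h3; rewrite -!(next_rot i hu) hrot.
  have : uniq (x :: s') by rewrite -hrot rot_uniq.
  case: s' hs' {hrot} => [|y [|z s']] /= E; try by rewrite -E in hs.
  rewrite !inE !negb_or !eqxx /= => /andP [/and3P [h h' _] _].
  by rewrite eq_sym (negbTE h) => zx; rewrite zx eqxx in h'.
Qed.

End Graphs.

Lemma delete_edge_closed (V : finType) (G : sgraph V) (u v w x : V) (P : pred V) :
  P w -> (forall y z, P y -> adj G y z -> [set y; z] != [set u; v] -> P z) ->
  connect (delete_edge G u v) w x -> P x.
Proof.
move=> h0 hP /connectP [p hp ->]; elim: p w h0 hp => //= y p IH w h0.
by move=> /andP [/andP [h1 h2] hp]; apply: IH hp; apply: hP h1 h2.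
Qed.

(** * Decompositions from vertex boundaries *)

Section Laminar.
Variables (V : finType) (G : sgraph V).
Implicit Types (S A B : {set V}).

(* The bound [r] controls the cutranks, and [w] the bags and the labels. *)
Inductive dec (r w : nat) : {set V} -> Prop :=
| DecSingle x : dec r w [set x]
| DecUnion A B of dec r w A & dec r w B & [disjoint A & B]
    & #|boundary G A :|: boundary G B| <= w
    & #|boundary G (A :|: B)| <= r : dec r w (A :|: B).

Lemma dec_n0 r w S : dec r w S -> S != set0.
Proof.
elim=> [x|A B _ hA _ _ _ _ _]; first by apply/set0Pn; exists x; rewrite inE.
by case/set0Pn: hA => x hx; apply/set0Pn; exists x; rewrite inE hx.
Qed.

Definition nested A B := [|| A \subset B, B \subset A | [disjoint A & B]].

(** The sets occurring in a derivation of [dec]. Such a derivation is only a proof and cannot serve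
    as the tree of a decomposition; this family can, with its members as nodes, ordered by
    inclusion. *)
Record laminar (r w : nat) (S : {set V}) (F : {set {set V}}) : Prop := Laminar {
  lam_top : S \in F;
  lam_sub : forall A, A \in F -> A \subset S;
  lam_n0 : forall A, A \in F -> A != set0;
  lam_single : forall x, x \in S -> [set x] \in F;
  lam_nested : forall A B, A \in F -> B \in F -> nested A B;
  lam_bound : forall A, A \in F -> #|boundary G A| <= r;
  lam_split : forall A, A \in F -> 1 < #|A| -> exists A1 A2,
    [/\ A1 \in F /\ A2 \in F, A = A1 :|: A2, [disjoint A1 & A2],
        #|boundary G A1 :|: boundary G A2| <= w &
        forall B, B \in F -> B \proper A -> (B \subset A1) || (B \subset A2)] }.

Lemma dec_laminar r w S : 0 < r -> dec r w S -> exists F, laminar r w S F.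
Proof.
move=> hr; elim=> [x|A B dA [F hF] dB [H hH] hAB hw hb].
  exists [set [set x]]; split.
  - by rewrite inE.
  - by move=> A; rewrite inE => /eqP ->.
  - by move=> A; rewrite inE => /eqP ->; apply/set0Pn; exists x; rewrite inE.
  - by move=> y; rewrite !inE => /eqP ->.
  - by move=> A B; rewrite !inE => /eqP -> /eqP ->; rewrite /nested subxx.
  - move=> A; rewrite inE => /eqP ->.
    by apply: leq_trans (subset_leq_card (boundary_sub _ _)) _; rewrite cards1.
  - by move=> A; rewrite inE => /eqP ->; rewrite cards1.
have dFH X Y : X \in F -> Y \in H -> [disjoint X & Y].
  move=> /(lam_sub hF) h1 /(lam_sub hH) h2.
  exact: disjointWl h1 (disjointWr h2 hAB).
have top X : (X \in F) || (X \in H) -> X \subset A :|: B.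
  case/orP => [/(lam_sub hF)|/(lam_sub hH)] h.
    exact: subset_trans h (subsetUl _ _).
  exact: subset_trans h (subsetUr _ _).
have inFH X : (X \in (A :|: B) |: (F :|: H)) =
    [|| X == A :|: B, X \in F | X \in H] by rewrite !inE.
exists ((A :|: B) |: (F :|: H)); split.
- by rewrite inFH eqxx.
- by move=> X; rewrite inFH => /orP [/eqP -> //|/top].
- move=> X; rewrite inFH => /or3P [/eqP ->|/(lam_n0 hF) //|/(lam_n0 hH) //].
  by apply: dec_n0 (DecUnion dA dB hAB hw hb).
- move=> x; rewrite inFH !inE => /orP [/(lam_single hF) ->|/(lam_single hH) ->];
  by rewrite ?orbT.
- move=> X Y; rewrite !inFH /nested => /orP [/eqP ->|hX].
    by move=> /orP [/eqP ->|/top ->]; rewrite ?subxx ?orbT.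
  move=> /orP [/eqP ->|hY]; first by rewrite top.
  case/orP: hX => hX; case/orP: hY => hY; last exact: (lam_nested hH).
  - exact: (lam_nested hF).
  - by rewrite dFH ?orbT.
  - by rewrite disjoint_sym dFH ?orbT.
- move=> X; rewrite inFH => /or3P [/eqP -> //|/(lam_bound hF) //|/(lam_bound hH) //].
- move=> X; rewrite inFH => hX hX1.
  have [E|E] := eqVneq X (A :|: B).
    rewrite E; exists A, B; split => //.
      by rewrite !inFH (lam_top hF) (lam_top hH) !orbT.
    move=> Y; rewrite inFH => /or3P [/eqP ->|/(lam_sub hF) ->|/(lam_sub hH) ->];
    by rewrite ?properxx ?orbT.
  rewrite (negbTE E) /= in hX; case/orP: hX => hX.
    have [A1 [A2 [[h1 h2] h3 h4 h5 h6]]] := lam_split hF hX hX1.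
    exists A1, A2; split => //; first by rewrite !inFH h1 h2 !orbT.
    move=> Y; rewrite inFH => /or3P [/eqP ->|/h6 //|hY] /properP [hs _].
      move: (dec_n0 dB); rewrite -subset0 => /negP []; apply/subsetP => y hy.
      have := subsetP (lam_sub hF hX) y (subsetP hs y _).
      by rewrite inE hy orbT => /(_ isT) hA; rewrite (disjointFr hAB hA) in hy.
    have := dFH _ _ hX hY; rewrite disjoint_sym => /(disjointWr hs).
    rewrite -setI_eq0 setIid => /eqP Y0.
    by have := lam_n0 hH hY; rewrite Y0 eqxx.
  have [A1 [A2 [[h1 h2] h3 h4 h5 h6]]] := lam_split hH hX hX1.
  exists A1, A2; split => //; first by rewrite !inFH h1 h2 !orbT.
  move=> Y; rewrite inFH => /or3P [/eqP ->|hY|/h6 //] /properP [hs _].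
    move: (dec_n0 dA); rewrite -subset0 => /negP []; apply/subsetP => y hy.
    have := subsetP (lam_sub hH hX) y (subsetP hs y _).
    by rewrite inE hy => /(_ isT) hB; rewrite (disjointFl hAB hB) in hy.
  have := dFH _ _ hY hX => /(disjointWr hs).
  rewrite -setI_eq0 setIid => /eqP Y0.
  by have := lam_n0 hF hY; rewrite Y0 eqxx.
Qed.

(** * The tree of a laminar family *)

Section Parent.
Variables (r w : nat) (F : {set {set V}}).
Hypothesis hF : laminar r w setT F.
Let P A B := (B \in F) && (A \proper B).

Definition lam_parent A := [arg min_(B < setT | P A B) #|B|].

Lemma lam_proper A : A \in F -> A != setT -> A \proper setT.
Proof. by move=> hA hAT; rewrite properEneq hAT subsetT. Qed.

(** Two members containing the nonempty set [A] are not disjoint, hence comparable, so that a proper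
    superset of least size lies in all the others. *)
Lemma lam_parentP A : A \in F -> A != setT ->
  [/\ lam_parent A \in F, A \proper lam_parent A &
      forall B, B \in F -> A \proper B -> lam_parent A \subset B].
Proof.
move=> hA hAT; rewrite /lam_parent; case: arg_minnP => [|B /andP [h1 h2] h3].
  by rewrite /P (lam_top hF) lam_proper.
split=> // C hC hAC; have /or3P [//|h|h] := lam_nested hF h1 hC.
  have := h3 C; rewrite /P hC hAC => /(_ isT) hcard.
  by have /eqP -> : C == B by rewrite eqEcard h.
have := lam_n0 hF hA; rewrite -subset0 => /negP [].
have := disjointWl (proper_sub h2) (disjointWr (proper_sub hAC) h).
by rewrite -setI_eq0 setIid subset0.
Qed.

(** Links the parent map, which defines the trees, to the two children given by [lam_split], from
    which bags and degrees are read off. *)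
Lemma lam_parent_child A A1 A2 B : A \in F -> A1 \in F -> A2 \in F ->
  A = A1 :|: A2 -> [disjoint A1 & A2] ->
  (forall B, B \in F -> B \proper A -> (B \subset A1) || (B \subset A2)) ->
  B \in F -> B != setT -> (lam_parent B == A) = (B == A1) || (B == A2).
Proof.
move=> hA h1 h2 E hd hc hB hBT; have [k1 k2 k3] := lam_parentP hB hBT.
have aux A3 A4 : A3 \in F -> A4 \in F -> A = A3 :|: A4 -> [disjoint A3 & A4] ->
    (forall B, B \in F -> B \proper A -> (B \subset A3) || (B \subset A4)) ->
    B = A3 -> lam_parent B == A.
  move=> {}h1 {}h2 {}E {}hd {}hc EB.
  have pA : B \proper A.
    rewrite EB E properE subsetUl; apply/negP => /subUsetP [_ h].
    have := lam_n0 hF h2; rewrite -subset0 => /negP []; move: hd.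
    by rewrite -setI_eq0 (setIidPr h) => /eqP ->.
  have := k3 _ hA pA => h; rewrite eqEsubset h /=.
  have [//|hn] := boolP (A \subset lam_parent B).
  have /hc : lam_parent B \proper A by rewrite properE h hn.
  move=> /(_ k1) /orP [h'|h'].
    by rewrite EB in k2 h'; have := proper_sub_trans k2 h'; rewrite properxx.
  have := subset_trans (proper_sub k2) h'; rewrite EB => h3.
  have := lam_n0 hF h1; rewrite -subset0 => /negP []; move: hd.
  by rewrite -setI_eq0 (setIidPl h3) => /eqP ->.
apply/idP/orP => [/eqP EA|[/eqP EB|/eqP EB]].
- have hp : B \proper A by rewrite -EA.
  case/orP: (hc _ hB hp) => h; [left|right];
  apply: contraTT hp => hn; rewrite properE negb_and negbK orbC.
    have := k3 _ h1; rewrite properEneq hn h EA => /(_ isT).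
    rewrite E => /subUsetP [_ h']; have := lam_n0 hF h2.
    by rewrite -subset0; move: hd; rewrite -setI_eq0 (setIidPr h') subset0 => ->.
  have := k3 _ h2; rewrite properEneq hn h EA => /(_ isT).
  rewrite E => /subUsetP [h' _]; have := lam_n0 hF h1.
  by rewrite -subset0; move: hd; rewrite -setI_eq0 (setIidPl h') subset0 => ->.
- exact: (aux A1 A2).
- rewrite setUC in E; rewrite disjoint_sym in hd.
  by apply: (aux A2 A1) => // C hC hCA; rewrite orbC; apply: hc.
Qed.

Let node := {A : {set V} | A \in F}.

Definition lam_node_parent (u : node) : node :=
  if val u == setT then u else insubd u (lam_parent (val u)).

Lemma val_lam_node_parent u : val (lam_node_parent u) =
  if val u == setT then val u else lam_parent (val u).
Proof.
rewrite /lam_node_parent; case: ifP => // /negbT h; rewrite val_insubd.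
by have [-> _ _] := lam_parentP (valP u) h.
Qed.

Lemma lam_node_tree : is_tree (rel_graph (fun u v => lam_node_parent u == v)).
Proof.
pose root : node := Sub setT (lam_top hF).
apply: (@parent_tree _ _ root (fun u => #|V| - #|val u|)).
  by apply: val_inj; rewrite val_lam_node_parent /= eqxx.
move=> u; rewrite -val_eqE /= => hu; rewrite val_lam_node_parent (negbTE hu).
have [_ h _] := lam_parentP (valP u) hu.
apply: ltn_sub2l (proper_card h); exact: leq_trans (proper_card h) (max_card _).
Qed.

(** For a node with children [A1] and [A2] this is the union of their boundaries ([lam_bag_split]).
    Ranging over all sets with parent [val u] avoids choosing the two children, which are only known
    to exist. *)
Definition lam_bag (u : node) : {set V} :=
  if #|val u| <= 1 then val u else
  \bigcup_(B in F | (B != setT) && (lam_parent B == val u)) boundary G B.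

Lemma lam_bag_split (u : node) A1 A2 : 1 < #|val u| -> A1 \in F -> A2 \in F ->
  val u = A1 :|: A2 -> [disjoint A1 & A2] ->
  (forall B, B \in F -> B \proper val u -> (B \subset A1) || (B \subset A2)) ->
  lam_bag u = boundary G A1 :|: boundary G A2.
Proof.
move=> hu h1 h2 E hd hc; rewrite /lam_bag leqNgt hu /=.
have hch B := lam_parent_child (valP u) h1 h2 E hd hc (B := B).
have nT A3 A4 : A3 \in F -> A4 \in F -> [disjoint A3 & A4] -> A3 != setT.
  move=> _ h4 {}hd; apply: contraTneq hd => ->; rewrite -setI_eq0 setTI.
  exact: lam_n0 hF _ h4.
have n1 := nT _ _ h1 h2 hd; have n2 : A2 != setT.
  by apply: nT h2 h1 _; rewrite disjoint_sym.
apply/eqP; rewrite eqEsubset; apply/andP; split.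
  apply/bigcupsP => B /and3P [hB hBT]; rewrite hch // => /orP [] /eqP ->.
    exact: subsetUl.
  exact: subsetUr.
apply/subUsetP; split.
  by apply: (bigcup_sup A1); rewrite h1 n1 hch ?eqxx.
by apply: (bigcup_sup A2); rewrite h2 n2 hch ?eqxx ?orbT.
Qed.

(** An edge is covered at the smallest member containing both its ends: its children separate them,
    so each end is in the boundary of its child. The nodes whose bag contains [x] are connected
    because each of them is joined to the leaf of [x]: if [x] is in the boundary of a child, it is
    also in the bag of that child. *)
Lemma lam_tree_decomposition : 0 < w ->
  exists D : tree_decomposition G, td_width D <= w.-1.
Proof.
move=> hw; set T := rel_graph (fun u v : node => lam_node_parent u == v).
pose leaf x : node := Sub [set x] (lam_single hF (in_setT x)).
have leaf_bag x : x \in lam_bag (leaf x).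
  by rewrite /lam_bag /= cards1 /= inE.
have hvertex x : exists t, x \in lam_bag t by exists (leaf x).
have hedge x y : adj G x y -> exists t, (x \in lam_bag t) && (y \in lam_bag t).
  move=> hxy.
  pose Q A := [&& A \in F, x \in A & y \in A].
  have QT : Q setT by rewrite /Q (lam_top hF) !in_setT.
  have [A /and3P [hA hx hy] hmin] := arg_minnP (fun A => #|A|) QT.
  have hA1 : 1 < #|A|.
    apply: leq_trans (subset_leq_card (A := [set x; y]) _).
      by rewrite cards2 (adj_neq hxy).
    by apply/subsetP => z; rewrite !inE => /orP [] /eqP ->.
  have [A1 [A2 [[h1 h2] E hd _ hc]]] := lam_split hF hA hA1.
  pose u : node := Sub A hA; exists u.
  rewrite (lam_bag_split (u := u) (A1 := A1) (A2 := A2)) //.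
  have nQ A3 : A3 \in F -> A3 \proper A -> (x \in A3) && (y \in A3) = false.
    move=> h3 hp; apply/negP => /andP [hx3 hy3].
    by have := hmin A3; rewrite /Q h3 hx3 hy3 leqNgt proper_card // => /(_ isT).
  have p1 : A1 \proper A.
    rewrite E properE subsetUl; apply/negP => /subUsetP [_ h].
    have := lam_n0 hF h2; rewrite -subset0 => /negP []; move: hd.
    by rewrite -setI_eq0 (setIidPr h) => /eqP ->.
  have p2 : A2 \proper A.
    rewrite E properE subsetUr; apply/negP => /subUsetP [h _].
    have := lam_n0 hF h1; rewrite -subset0 => /negP []; move: hd.
    by rewrite -setI_eq0 (setIidPl h) => /eqP ->.
  have := nQ _ h1 p1; have := nQ _ h2 p2.
  move: hx hy; rewrite E !in_setU => /orP [] hx /orP [] hy; rewrite ?hx ?hy ?andbT //= => n1 n2.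
    apply/andP; split; apply/orP; [left|right]; apply/boundaryP; split => //.
      by exists y => //; rewrite n2.
    by exists x; rewrite ?n1 // adj_sym.
  apply/andP; split; apply/orP; [right|left]; apply/boundaryP; split => //.
    by exists y => //; rewrite n1.
  by exists x; rewrite ?n2 // adj_sym.
have hconn x s t : x \in lam_bag s -> x \in lam_bag t ->
    connect [rel a b | [&& adj T a b, x \in lam_bag a & x \in lam_bag b]] s t.
  set e := (X in connect X).
  have e_sym : symmetric e by move=> a b; rewrite /e /= adj_sym; case: adj => //=; rewrite andbC.
  have up u : x \in lam_bag u -> connect e u (leaf x).
    have [n] := ubnP #|val u|; elim: n u => // n IH u hn hxu.
    have [hu|hu] := leqP #|val u| 1.
      have hx : x \in val u by move: hxu; rewrite /lam_bag hu.
      suff -> : u = leaf x by exact: connect0.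
      by apply/val_inj/eqP; rewrite eq_sym eqEcard cards1 hu andbT sub1set.
    move: (hxu); rewrite {1}/lam_bag leqNgt hu /=.
    move=> /bigcupP [B /and3P [hB hBT /eqP hBu] hxB].
    pose v : node := Sub B hB.
    have [_ hp _] := lam_parentP hB hBT; rewrite hBu in hp.
    have hxB' := subsetP (boundary_sub _ _) _ hxB.
    have hxv : x \in lam_bag v.
      have [h1|h1] := leqP #|val v| 1; first by rewrite /lam_bag h1.
      have [A1 [A2 [[h3 h2] E hd _ hc]]] := lam_split hF hB h1.
      rewrite (lam_bag_split (u := v) (A1 := A1) (A2 := A2)) //.
      by apply: (subsetP (boundaryU G A1 A2)); rewrite -E.
    apply: connect_trans (IH v _ hxv); last exact: leq_trans (proper_card hp) _.
    apply: connect1; rewrite /e /= hxu hxv !andbT adj_rel_graph.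
    have -> : lam_node_parent v = u.
      by apply: val_inj; rewrite val_lam_node_parent /= (negbTE hBT).
    by rewrite eqxx orbT andbT -val_eqE /= eq_sym (proper_neq hp).
  move=> /up hs /up ht; apply: connect_trans hs _.
  by rewrite (sym_connect_sym e_sym).
exists (TreeDecomposition lam_node_tree hvertex hedge hconn).
rewrite /td_width -!subn1; apply: leq_sub2r; apply/bigmax_leqP => /= u _.
have [hu|hu] := leqP #|val u| 1; first by rewrite /lam_bag hu (leq_trans hu).
have [A1 [A2 [[h1 h2] E hd hb hc]]] := lam_split hF (valP u) hu.
by rewrite (lam_bag_split (u := u) (A1 := A1) (A2 := A2)).
Qed.

(** * The subcubic tree of a laminar family *)

Section RankDecomposition.
Variables (T1 T2 : {set V}).
Hypotheses (hT1 : T1 \in F) (hT2 : T2 \in F) (hT : setT = T1 :|: T2).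
Hypothesis hTd : [disjoint T1 & T2].
Hypothesis hTc :
  forall B, B \in F -> B \proper setT -> (B \subset T1) || (B \subset T2).

Lemma lam_children_neq A1 A2 : A1 \in F -> [disjoint A1 & A2] -> A1 != A2.
Proof.
move=> h1 hd; apply: contraTneq hd => <-; rewrite -setI_eq0 setIid.
exact: lam_n0 hF _ h1.
Qed.

Lemma lam_child_neqT A1 A2 : A2 \in F -> [disjoint A1 & A2] -> A1 != setT.
Proof.
move=> h2 hd; apply: contraTneq hd => ->; rewrite -setI_eq0 setTI.
exact: lam_n0 hF _ h2.
Qed.

Let nT1 : T1 != setT. Proof. exact: lam_child_neqT hT2 hTd. Qed.
Let nT2 : T2 != setT.
Proof. by apply: lam_child_neqT hT1 _; rewrite disjoint_sym. Qed.
Let nT12 : T1 != T2. Proof. exact: lam_children_neq hT1 hTd. Qed.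

Lemma lam_parent_top A : A \in F -> A != setT ->
  (lam_parent A == setT) = (A == T1) || (A == T2).
Proof. exact: lam_parent_child (lam_top hF) hT1 hT2 hT hTd hTc. Qed.

Let node' := {A : {set V} | (A \in F) && (A != setT)}.

Let nodeF (u : node') : val u \in F. Proof. by case/andP: (valP u). Qed.
Let nodeT (u : node') : val u != setT. Proof. by case/andP: (valP u). Qed.

(* The root of the laminar tree would have degree 2: its two children are joined
   directly, [T2] becoming the root. *)
Definition cubic_parent A := if lam_parent A == setT then T2 else lam_parent A.

Definition cubic_node_parent (u : node') : node' := insubd u (cubic_parent (val u)).

Lemma val_cubic_node_parent u : val (cubic_node_parent u) = cubic_parent (val u).
Proof.
rewrite /cubic_node_parent val_insubd /cubic_parent.
have [h _ _] := lam_parentP (nodeF u) (nodeT u).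
by case: (eqVneq (lam_parent (val u)) setT) => [_|hn]; rewrite ?hT2 ?nT2 ?h ?hn.
Qed.

Let cubic := rel_graph (fun u v : node' => cubic_node_parent u == v).

Lemma adj_cubic u v : adj cubic u v = (val u != val v) &&
  ((cubic_parent (val u) == val v) || (cubic_parent (val v) == val u)).
Proof. by rewrite adj_rel_graph -!val_eqE !val_cubic_node_parent. Qed.

Lemma cubic_tree : is_tree cubic.
Proof.
have hr : (T2 \in F) && (T2 != setT) by rewrite hT2.
pose root : node' := Sub T2 hr.
(* Sizes grow towards the parent except on the edge from [T1] to its new parent [T2]; so [T2] gets
   depth 0 and all other nodes a positive depth. *)
pose d (u : node') := if val u == T2 then 0 else (#|V| - #|val u|).+1.
apply: (@parent_tree _ _ root d).
  apply: val_inj; rewrite val_cubic_node_parent /cubic_parent /=.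
  by rewrite (eqP (_ : lam_parent T2 == setT)) ?eqxx // lam_parent_top ?eqxx ?orbT.
move=> u; rewrite -val_eqE => hu; rewrite /d (negbTE hu) val_cubic_node_parent.
have [_ h _] := lam_parentP (nodeF u) (nodeT u); case: ifP => // hp; rewrite ltnS.
move: hp; rewrite /cubic_parent; case: ifP => [_|_ _]; first by rewrite eqxx.
apply: ltn_sub2l (proper_card h); exact: leq_trans (proper_card h) (max_card _).
Qed.

Lemma cubic_parent_sub A B : A \in F -> B \in F -> B != setT -> A \proper B ->
  (cubic_parent A \subset B) && (A \proper cubic_parent A) &&
  (lam_parent A == cubic_parent A).
Proof.
move=> hA hB hBT hAB; have hAT : A != setT.
  by apply: contraTneq (proper_sub_trans hAB (subsetT B)) => ->; rewrite properxx.
have [h1 h2 h3] := lam_parentP hA hAT; have hs := h3 _ hB hAB.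
rewrite /cubic_parent; case: eqP => [E|_]; last by rewrite hs h2 eqxx.
by rewrite E subTset (negbTE hBT) in hs.
Qed.

(** The only tree edge between the members contained in [val u] and the other ones is the edge from
    [u] to its parent, which is deleted. *)
Lemma cubic_side (u v : node') : val v = cubic_parent (val u) -> val u != T2 ->
  forall x, (connect (delete_edge cubic u v) u x -> val x \subset val u) /\
    (connect (delete_edge cubic u v) v x -> ~~ (val x \subset val u)).
Proof.
move=> hv huT x.
have huT2 : ~~ (T2 \subset val u).
  have := hTc (nodeF u) (lam_proper (nodeF u) (nodeT u)).
  move=> /orP [] h; apply/negP => h'; last first.
    by case/eqP: huT; apply/eqP; rewrite eqEsubset h h'.
  have := subset_trans h' h; move: hTd; rewrite -setI_eq0 => hd /setIidPr h2.
  by rewrite h2 in hd; have := lam_n0 hF hT2; rewrite hd.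
have step (y z : node') : val y \subset val u -> adj cubic y z ->
    [set y; z] != [set u; v] -> val z \subset val u.
  move=> hyu; rewrite adj_cubic => /andP [hyz /orP [/eqP hz|/eqP hz]] hne.
    have [E|E] := eqVneq (val y) (val u).
      case/negP: hne; have -> : y = u by apply: val_inj.
      suff -> : z = v by [].
      by apply: val_inj; rewrite -hz hv E.
    have hp : val y \proper val u by rewrite properEneq E hyu.
    by have := cubic_parent_sub (nodeF y) (nodeF u) (nodeT u) hp; rewrite hz => /andP [/andP []].
  move: hz; rewrite /cubic_parent; case: ifP => [_ E|_ E].
    by rewrite -E (negbTE huT2) in hyu.
  have [_ h _] := lam_parentP (nodeF z) (nodeT z); rewrite E in h.
  exact: subset_trans (proper_sub h) hyu.
split.
  exact: (delete_edge_closed (P := fun y : node' => val y \subset val u) (subxx _) step).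
apply: (delete_edge_closed (P := fun y : node' => ~~ (val y \subset val u))) => /=.
  rewrite hv /cubic_parent; case: ifP => // _.
  have [_ h _] := lam_parentP (nodeF u) (nodeT u).
  by rewrite properE in h; case/andP: h.
move=> y z hy hyz hne; apply: contra hy => hz.
by apply: step hz _ _; rewrite 1?adj_sym 1?setUC.
Qed.

(** The neighbour of a node that is not one of its children. [T1] and [T2] are each other's [up],
    through the edge that replaces the old root; every other node has its parent there. All nodes
    then have the same description: [up] and the children. *)
Let up A := if A == T2 then T1 else cubic_parent A.

Lemma disjoint_subF A1 A2 : A1 \in F -> [disjoint A1 & A2] -> A1 \subset A2 = false.
Proof.
move=> h1 hd; apply/negP => /setIidPl h; move: hd; rewrite -setI_eq0 h.
by apply/negP; apply: lam_n0 hF _ h1.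
Qed.

Lemma cubic_upP A : A \in F -> A != setT ->
  [/\ up A \in F, up A != setT & ~~ (up A \subset A)].
Proof.
move=> hA hAT; rewrite /up; have [->|hA2] := eqVneq A T2.
  by rewrite hT1 nT1 disjoint_subF.
have [h1 h2 _] := lam_parentP hA hAT; rewrite /cubic_parent.
have [E|E] := eqVneq (lam_parent A) setT; last first.
  by split => //; rewrite properE in h2; case/andP: h2.
rewrite hT2 nT2; split => //.
move/eqP: E; rewrite lam_parent_top // (negbTE hA2) orbF => /eqP ->.
by rewrite disjoint_subF // disjoint_sym.
Qed.

Lemma adj_cubic_up u v :
  adj cubic u v = (val v == up (val u)) || (lam_parent (val v) == val u).
Proof.
rewrite adj_cubic; have hu := nodeF u; have huT := nodeT u.
have hv := nodeF v; have hvT := nodeT v.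
move: (val u) (val v) hu huT hv hvT => A B hA hAT hB hBT {u v}.
have [_ pB _] := lam_parentP hB hBT; have [_ pA _] := lam_parentP hA hAT.
have hAB : lam_parent B == A -> A != B.
  by move=> /eqP h; rewrite eq_sym; apply: proper_neq; rewrite -h.
rewrite /up; have [E|hA2] := eqVneq A T2.
  have -> : cubic_parent A = T2.
    by rewrite /cubic_parent E (eqP (_ : lam_parent T2 == setT)) ?eqxx //
      lam_parent_top ?eqxx ?orbT.
  rewrite -E; have [EB|EB] /= := eqVneq A B.
    have -> : (B == T1) = false by rewrite -EB E eq_sym (negbTE nT12).
    by apply/esym/negP => /hAB; rewrite EB eqxx.
  rewrite /cubic_parent -E; case: (eqVneq (lam_parent B) setT) => [h|/eqP h].
    rewrite eqxx h [setT == A]eq_sym (negbTE hAT) orbF.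
    by move/eqP: h; rewrite lam_parent_top // -E [B == A]eq_sym (negbTE EB) orbF => ->.
  case: (eqVneq B T1) => // h'.
  by case: h; apply/eqP; rewrite lam_parent_top // h' eqxx.
have -> : (cubic_parent B == A) = (lam_parent B == A).
  rewrite /cubic_parent; case: (eqVneq (lam_parent B) setT) => // ->.
  by rewrite ![_ == A]eq_sym (negbTE hA2) (negbTE hAT).
rewrite [B == _]eq_sym; case: (boolP (lam_parent B == A)) => [/hAB ->|_].
  by rewrite orbT.
rewrite !orbF; case: (eqVneq (cubic_parent A) B) => [<-|]; last by rewrite andbF.
rewrite andbT /cubic_parent; case: ifP => _ //.
by rewrite proper_neq.
Qed.

Let upnode (u : node') : node' := insubd u (up (val u)).
Lemma val_upnode u : val (upnode u) = up (val u).
Proof.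
rewrite /upnode val_insubd.
by have [-> -> _] := cubic_upP (nodeF u) (nodeT u).
Qed.

Let upE (u v : node') : (v == upnode u) = (val v == up (val u)).
Proof. by rewrite -val_upnode (inj_eq val_inj). Qed.

Lemma cubic_degree1 (u : node') : #|val u| = 1 -> degree cubic u = 1.
Proof.
move=> hu; apply: (degree_seq (s := [:: upnode u])) => // v.
rewrite adj_cubic_up mem_seq1 upE.
case: (boolP (lam_parent (val v) == val u)) => [/eqP h|]; last by rewrite orbF.
have [_ + _] := lam_parentP (nodeF v) (nodeT v); rewrite h => /proper_card.
rewrite hu ltnS leqn0 cards_eq0 => /eqP v0.
by have := lam_n0 hF (nodeF v); rewrite v0 eqxx.
Qed.

Lemma cubic_degree3 (u : node') : 1 < #|val u| -> degree cubic u = 3.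
Proof.
move=> hu; have [A1 [A2 [[h1 h2] E hd _ hc]]] := lam_split hF (nodeF u) hu.
have n1 := lam_child_neqT h2 hd; have n2 := lam_child_neqT h1 (etrans (disjoint_sym _ _) hd).
have p1 : (A1 \in F) && (A1 != setT) by rewrite h1.
have p2 : (A2 \in F) && (A2 != setT) by rewrite h2.
pose c1 : node' := Sub A1 p1; pose c2 : node' := Sub A2 p2.
have [_ _ hup] := cubic_upP (nodeF u) (nodeT u).
have hun : uniq [:: upnode u; c1; c2].
  have e1 : upnode u != c1.
    rewrite -val_eqE val_upnode SubK; apply: contraNneq hup => ->.
    by rewrite E subsetUl.
  have e2 : upnode u != c2.
    rewrite -val_eqE val_upnode SubK; apply: contraNneq hup => ->.
    by rewrite E subsetUr.
  have e3 : c1 != c2 by rewrite -val_eqE !SubK (lam_children_neq h1 hd).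
  by rewrite /= !inE negb_or e1 e2 e3.
apply: (degree_seq (s := [:: upnode u; c1; c2])) => // v.
rewrite adj_cubic_up (lam_parent_child (nodeF u) h1 h2 E hd hc (nodeF v) (nodeT v)).
rewrite in_cons in_cons mem_seq1.
have -> : (v == c1) = (val v == A1) by rewrite -(inj_eq val_inj) SubK.
have -> : (v == c2) = (val v == A2) by rewrite -(inj_eq val_inj) SubK.
by rewrite upE.
Qed.

Lemma cubic_rank_decomposition :
  exists D : rank_decomposition V, rd_width G D <= r.
Proof.
have hleaf x : ([set x] \in F) && ([set x] != setT).
  rewrite (lam_single hF) ?in_setT //=; apply/eqP => h.
  have := lam_n0 hF hT1; have := lam_n0 hF hT2.
  have : #|T1| + #|T2| = 1 by rewrite -cardsUI -hT -h cards1 (disjoint_setI0 hTd) cards0.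
  by rewrite -!cards_eq0; case: #|T1| => // n; case: #|T2| => // m; rewrite addnS.
pose leaf x : node' := Sub [set x] (hleaf x).
have leaf_inj : injective leaf by move=> x y /(congr1 val) /= /set1_inj.
have leafP (u : node') : #|val u| = 1 <-> exists x, leaf x = u.
  split => [/eqP /cards1P [x hx]|[x <-]]; last by rewrite cards1.
  by exists x; apply: val_inj.
have gt0 (u : node') : 0 < #|val u| by rewrite card_gt0 (lam_n0 hF (nodeF u)).
have hdeg u : degree cubic u = 1 \/ degree cubic u = 3.
  have := gt0 u; rewrite leq_eqVlt => /orP [/eqP h|h].
    by left; apply: cubic_degree1.
  by right; apply: cubic_degree3.
have hcodom u : degree cubic u = 1 <-> exists x, leaf x = u.
  rewrite -leafP; split => h; last exact: cubic_degree1.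
  have := gt0 u; rewrite leq_eqVlt => /orP [/eqP //|/cubic_degree3 h3].
  by rewrite h3 in h.
exists (RankDecomposition cubic_tree hdeg leaf_inj hcodom).
apply/bigmax_leqP => -[u v] /=.
(* The vertices on the side of the lower node [a] are those of [val a], whose boundary has at most
   [r] elements; the other orientation follows by the symmetry of the cutrank. *)
have key (a b : node') : val b = cubic_parent (val a) -> val a != T2 ->
    cutrank G [set x | connect (delete_edge cubic a b) a (leaf x)]
      [set x | connect (delete_edge cubic a b) b (leaf x)] <= r.
  move=> hb ha; apply: leq_trans (lam_bound hF (nodeF a)).
  apply: cutrank_boundary.
    apply/subsetP => x; rewrite inE => h.
    by have [/(_ h) + _] := cubic_side hb ha (leaf x); rewrite sub1set.
  rewrite -setI_eq0; apply/eqP/setP => x; rewrite !inE; apply/andP => -[h h'].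
  by have [_ /(_ h)] := cubic_side hb ha (leaf x); rewrite sub1set h'.
have hTT : cubic_parent T2 = T2.
  by rewrite /cubic_parent (eqP (_ : lam_parent T2 == setT)) ?eqxx //
    lam_parent_top ?eqxx ?orbT.
have delC (a b y : node') : [set x | connect (delete_edge cubic a b) y (leaf x)] =
    [set x | connect (delete_edge cubic b a) y (leaf x)].
  apply/setP => x; rewrite !inE; apply: eq_connect => p q.
  by rewrite /delete_edge (setUC [set a]).
rewrite /rd_side /= adj_cubic => /andP [huv /orP [] /eqP h].
  have huT : val u != T2 by apply: contraNneq huv => E; rewrite -h E hTT.
  by rewrite (delC v u v); apply: key.
have hvT : val v != T2 by apply: contraNneq huv => E; rewrite -h E hTT.
by rewrite cutrankC (delC u v u); apply: key.
Qed.

End RankDecomposition.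
End Parent.

Lemma minimumP (S : set nat) k : S k ->
  S (minimum S) /\ forall j, S j -> minimum S <= j.
Proof.
move=> Sk; pose M : set nat := fun k => S k /\ forall j, S j -> k <= j.
have ex : exists n, (fun n => `[< S n >]) n by exists k; apply/asboolP.
have hM : M (ex_minn ex).
  case: ex_minnP => m /asboolP hm hmin; split => // j Sj; apply: hmin.
  exact/asboolP.
exact: (xgetPex 0 (ex_intro M _ hM)).
Qed.

Lemma dec_rank_width r w : 0 < r -> dec r w setT -> rank_width G <= r.
Proof.
move=> hr hd; rewrite /rank_width; case: (leqP #|V| 1) => // hV.
have [F hF] := dec_laminar hr hd.
have hT1 : 1 < #|[set: V]| by rewrite cardsT.
have [T1 [T2 [[h1 h2] h3 h4 _ h6]]] := lam_split hF (lam_top hF) hT1.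
have [D hD] := cubic_rank_decomposition hF h1 h2 h3 h4 h6.
apply: leq_trans hD; apply: (proj2 (minimumP (k := rd_width G D) _)).
  by exists D.
by exists D.
Qed.

Lemma dec_tree_width r w : 0 < r -> 0 < w -> dec r w setT -> tree_width G <= w.-1.
Proof.
move=> hr hw hd; have [F hF] := dec_laminar hr hd.
have [D hD] := lam_tree_decomposition hF hw.
apply: leq_trans hD; apply: (proj2 (minimumP (k := td_width D) _)).
  by exists D.
by exists D.
Qed.

End Laminar.

(** * Clique-width expressions *)

Section CliqueWidth.
Variable (V : finType).
Implicit Types (S A B : {set V}) (e : rel V).

(** Adjacency and labels are functions on the ambient [V], compared on [S] only, which hides the
    nested sum types produced by [cw_eval]. *)
Definition constructible k S e (l : V -> 'I_k) : Prop :=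
  exists (t : cw_expression k) (f : lg_vertex (cw_eval t) -> V),
    [/\ injective f, forall x, x \in S <-> exists a, f a = x,
        forall a b, lg_adj a b = e (f a) (f b) &
        forall a, lg_label a = l (f a)].

Lemma constructible_ext k S e e' (l l' : V -> 'I_k) :
  {in S &, e =2 e'} -> {in S, l =1 l'} ->
  constructible S e l -> constructible S e' l'.
Proof.
move=> he hl [t [f [h1 h2 h3 h4]]]; exists t, f.
have fS a : f a \in S by apply/h2; exists a.
by split => // [a b|a]; rewrite ?h3 ?h4 ?he ?hl.
Qed.

Lemma constructible_single k x e (l : V -> 'I_k) :
  e x x = false -> constructible [set x] e l.
Proof.
move=> hx; exists (CWSingle (l x)), (fun _ => x); split => //.
- by move=> [] [].
- by move=> y; rewrite inE; split => [/eqP ->|[_ ->]]; [exists tt|].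
Qed.

Lemma constructible_union k A B e (l : V -> 'I_k) : [disjoint A & B] ->
  (forall x y, x \in A -> y \in B -> e x y = false /\ e y x = false) ->
  constructible A e l -> constructible B e l -> constructible (A :|: B) e l.
Proof.
move=> hd he [t [f [h1 h2 h3 h4]]] [t' [f' [h1' h2' h3' h4']]].
have fA a : f a \in A by apply/h2; exists a.
have fB a : f' a \in B by apply/h2'; exists a.
exists (CWUnion t t'), (fun x : lg_vertex (cw_eval (CWUnion t t')) =>
  match x with inl a => f a | inr a => f' a end); split => /=.
- move=> [a|a] [b|b].
  + by move/h1 ->.
  + by move=> E; have := disjointFr hd (fA a); rewrite E fB.
  + by move=> E; have := disjointFr hd (fA b); rewrite -E fB.
  + by move/h1' ->.
- move=> x; rewrite in_setU; split => [/orP|[[a|a] <-]]; rewrite ?fA ?fB ?orbT //.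
  by move=> [/h2|/h2'] [a <-]; [exists (inl a)|exists (inr a)].
- move=> [a|a] [b|b]; rewrite ?h3 ?h3' //.
    by have [-> _] := he _ _ (fA a) (fB b).
  by have [_ ->] := he _ _ (fA b) (fB a).
- by move=> [a|a]; rewrite ?h4 ?h4'.
Qed.

Lemma constructible_join k S e (l : V -> 'I_k) i j : i != j ->
  constructible S e l ->
  constructible S (fun x y => [|| e x y, (l x == i) && (l y == j) |
                                 (l x == j) && (l y == i)]) l.
Proof.
move=> hij [t [f [h1 h2 h3 h4]]]; exists (CWJoin hij t), f; split => //= a b.
by rewrite h3 !h4.
Qed.

Lemma constructible_relabel k S e (l : V -> 'I_k) i j : constructible S e l ->
  constructible S e (fun x => if l x == i then j else l x).
Proof.
move=> [t [f [h1 h2 h3 h4]]]; exists (CWRelabel i j t), f; split => //= a.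
by rewrite h4.
Qed.

Lemma constructible_setT k (G : sgraph V) (l : V -> 'I_k) :
  constructible setT (adj G) l -> exists t : cw_expression k, cw_constructs t G.
Proof.
move=> [t [f [h1 h2 h3 h4]]]; exists t.
have hf x : exists a, f a == x by have /h2 [a <-] := in_setT x; exists a.
pose g x := xchoose (hf x).
have fg x : f (g x) = x by apply/eqP; exact: (xchooseP (hf x)).
exists g; split; last by move=> x y; rewrite h3 !fg.
by exists f => // a; apply: h1; rewrite fg.
Qed.

Lemma constructible_joins k S e (l : V -> 'I_k) (p : seq ('I_k * 'I_k)) :
  (forall q, q \in p -> q.1 != q.2) -> constructible S e l ->
  constructible S (fun x y => e x y || has (fun q =>
    (l x == q.1) && (l y == q.2) || (l x == q.2) && (l y == q.1)) p) l.
Proof.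
elim: p => [_|q p IH hp he].
  by apply: constructible_ext => // x y _ _ /=; rewrite orbF.
have hq : q.1 != q.2 by apply: hp; rewrite inE eqxx.
have hp' q' : q' \in p -> q'.1 != q'.2 by move=> h; apply: hp; rewrite inE h orbT.
apply: constructible_ext (constructible_join hq (IH hp' he)) => // x y _ _ /=.
by rewrite -!orbA; case: (e x y) => //=; rewrite orbC -!orbA.
Qed.

Lemma constructible_relabels k S e (l : V -> 'I_k) (p : seq 'I_k) j : j \notin p ->
  constructible S e l ->
  constructible S e (fun x => if l x \in p then j else l x).
Proof.
elim: p => [//|i p IH]; rewrite inE negb_or => /andP [hji hjp] he.
apply: constructible_ext (constructible_relabel i j (IH hjp he)) => // x _ /=.
rewrite inE; have [->|hi] := eqVneq (l x) i; last first.
  by case: (l x \in p) => /=; rewrite ?if_same ?(negbTE hi).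
by case: (i \in p) => /=; rewrite ?eqxx ?if_same.
Qed.

(** Passes labels downwards: the labels prescribed on the boundary of a union are extended to the
    boundaries of both its parts. *)
Lemma extend_injection k (A B : {set V}) (l : V -> 'I_k) : A \subset B ->
  #|B| <= k -> {in A &, injective l} ->
  exists l' : V -> 'I_k, {in A, l =1 l'} /\ {in B &, injective l'}.
Proof.
have [n] := ubnP (#|B| - #|A|); elim: n A l => // n IH A l hn hAB hB hl.
have [E|hne] := eqVneq A B; first by exists l; rewrite -E.
have hp : A \proper B by rewrite properEneq hne.
have /properP [_ [x hxB hxA]] := hp.
have [i hi] : exists i, i \notin [set l y | y in A].
  apply/existsP; rewrite -negb_forall; apply/negP => /forallP h.
  have : #|'I_k| <= #|[set l y | y in A]|.
    by apply: subset_leq_card; apply/subsetP => i _; apply: h.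
  rewrite card_ord leqNgt => /negP; apply.
  apply: leq_ltn_trans (leq_imset_card _ _) _.
  exact: leq_trans (proper_card hp) hB.
pose l1 y := if y == x then i else l y.
have l1A : {in A, l =1 l1}.
  by move=> y hy; rewrite /l1; case: eqP => // E; rewrite E (negbTE hxA) in hy.
have xAB : x |: A \subset B by rewrite subUset sub1set hxB.
have [|y z|l' [h1 h2]] := IH (x |: A) l1 _ xAB hB.
- rewrite cardsU1 hxA; have := proper_card hp; lia.
- have aux u : u \in A -> l1 u != i.
    by move=> hu; rewrite -l1A //; apply: contraNneq hi => <-; apply: imset_f.
  have l1x : l1 x = i by rewrite /l1 eqxx.
  rewrite !in_setU1 => /orP [/eqP ->|hy] /orP [/eqP ->|hz] //.
  + by rewrite l1x => E; have := aux _ hz; rewrite -E eqxx.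
  + by rewrite l1x => E; have := aux _ hy; rewrite E eqxx.
  + by rewrite -!l1A //; apply: hl.
- exists l'; split => // y hy; rewrite l1A //; apply: h1.
  by rewrite in_setU1 hy orbT.
Qed.

(** The label [ord0] is that of the finished vertices, which will receive no further edge; the
    boundary vertices share the [w] other labels. *)
Definition boundary_label w (G : sgraph V) S (l : V -> 'I_w) x : 'I_w.+1 :=
  if x \in boundary G S then lift ord0 (l x) else ord0.

(** Since the boundary vertices of both parts have distinct labels, the join of two of these labels
    adds exactly one edge. So the edges between [A] and [B] are added one by one, and then the
    vertices leaving the boundary are relabelled [ord0]. The labelling [l] is arbitrary so that the
    two parts can be built with compatible labels. *)
Lemma dec_constructible (G : sgraph V) r w S (l : V -> 'I_w) :
  dec G r w S -> {in boundary G S &, injective l} ->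
  constructible S (adj G) (boundary_label G S l).
Proof.
move=> hd; elim: hd l => [x|A B _ IHA _ IHB hAB hw _] l hl.
  apply: constructible_single; apply/negP => /adj_neq.
  by rewrite eqxx.
pose D := boundary G A :|: boundary G B.
have [l' [hll' hl']] := extend_injection (boundaryU G A B) hw hl.
have {}IHA := IHA l' (sub_in2 (subsetP (subsetUl _ _)) hl').
have {}IHB := IHB l' (sub_in2 (subsetP (subsetUr _ _)) hl').
pose m x : 'I_w.+1 := if x \in D then lift ord0 (l' x) else ord0.
have mD x y : x \in D -> m y = m x -> y = x.
  rewrite /m => hx; rewrite hx; case: ifP => hy.
    by move=> /lift_inj; apply: hl'.
  by move=> h; have := neq_lift ord0 (l' x); rewrite -h eqxx.
have mA : {in A, boundary_label G A l' =1 m}.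
  move=> x hx; rewrite /boundary_label /m in_setU.
  have -> : x \in boundary G B = false; last by rewrite orbF.
  apply/negP => /(subsetP (boundary_sub _ _)) h.
  by rewrite (disjointFr hAB hx) in h.
have mB : {in B, boundary_label G B l' =1 m}.
  move=> x hx; rewrite /boundary_label /m in_setU.
  have -> : x \in boundary G A = false; last by [].
  apply/negP => /(subsetP (boundary_sub _ _)) h.
  by rewrite (disjointFl hAB hx) in h.
pose e0 x y := adj G x y && ((x \in A) == (y \in A)).
have cU : constructible (A :|: B) e0 m.
  apply: constructible_union => //.
  - by move=> x y hx hy; rewrite /e0 hx (disjointFl hAB hy) /= !andbF.
  - by apply: constructible_ext IHA => // x y hx hy; rewrite /e0 hx hy eqxx andbT.
  - apply: constructible_ext IHB => // x y hx hy; rewrite /e0.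
    by rewrite (disjointFl hAB hx) (disjointFl hAB hy) eqxx andbT.
pose p := [seq (m q.1, m q.2) | q <- enum {: V * V} &
  [&& q.1 \in boundary G A, q.2 \in boundary G B & adj G q.1 q.2]].
have pP q : q \in p -> exists a b, [/\ a \in boundary G A, b \in boundary G B,
    adj G a b & q = (m a, m b)].
  by move=> /mapP [[a b]]; rewrite mem_filter => /andP [/= /and3P [? ? ?] _] ->; exists a, b.
have hp q : q \in p -> q.1 != q.2.
  move=> /pP [a [b [ha hb hab ->]]] /=; apply/negP => /eqP h.
  have := mD b a _ h; rewrite in_setU hb orbT => /(_ isT) E.
  by have := adj_neq hab; rewrite E eqxx.
have cJ := constructible_joins hp cU.
have cG : constructible (A :|: B) (adj G) m.
  apply: constructible_ext cJ => // x y hx hy.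
  apply/idP/idP => [/orP [/andP [] //|/hasP [q /pP [a [b [ha hb hab ->]]]] /=]|hxy].
    have aD : a \in D by rewrite in_setU ha.
    have bD : b \in D by rewrite in_setU hb orbT.
    by move=> /orP [] /andP [/eqP /mD -> // /eqP /mD -> //]; rewrite adj_sym.
  rewrite /e0 hxy /=; case: eqP => //= hne; apply/hasP.
  have hA z : z \in A :|: B -> (z \in B) = (z \notin A).
    rewrite in_setU; case: (boolP (z \in A)) => [h _|_ /= ->] //.
    exact: disjointFr hAB h.
  case: (boolP (x \in A)) hne => hxA; case: (boolP (y \in A)) => // hyA _.
    exists (m x, m y); last by rewrite /= !eqxx.
    apply/mapP; exists (x, y) => //; rewrite mem_filter mem_enum /= hxy !andbT.
    apply/andP; split; apply/boundaryP; split; rewrite ?hA //; first by exists y.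
    by exists x; rewrite ?hA ?negbK // adj_sym.
  exists (m y, m x); last by rewrite /= !eqxx orbT.
  apply/mapP; exists (y, x) => //; rewrite mem_filter mem_enum /= adj_sym hxy !andbT.
  apply/andP; split; apply/boundaryP; split; rewrite ?hA //.
    by exists x; rewrite // adj_sym.
  by exists y; rewrite ?hA ?negbK.
(* The labels of the vertices all of whose neighbours are now inside the union. *)
pose dead := [seq m x | x in D :\: boundary G (A :|: B)].
have h0 : ord0 \notin dead.
  apply/negP => /mapP [x]; rewrite mem_enum in_setD => /andP [_ hx].
  by rewrite /m hx => h; have := neq_lift ord0 (l' x); rewrite -h eqxx.
apply: constructible_ext (constructible_relabels h0 cG) => // x hx.
rewrite /boundary_label; case: ifP => [|hxd].
  move=> /mapP [y]; rewrite mem_enum in_setD => /andP [hy1 hy2] /mD -> //.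
  by rewrite (negbTE hy1).
have [hxb|hxb] := boolP (x \in boundary G (A :|: B)).
  by rewrite /m (subsetP (boundaryU G A B)) // hll'.
rewrite /m; case: ifP => // hxD; case/negP: hxd; apply/mapP; exists x => //.
by rewrite mem_enum in_setD hxb.
Qed.

Lemma dec_clique_width (G : sgraph V) r w : 0 < w ->
  dec G r w setT -> clique_width G <= w.+1.
Proof.
case: w => // w _ hd; have hl : {in boundary G setT &, injective (fun _ : V => @ord0 w)}.
  by move=> x y /boundaryP [_ [z]]; rewrite in_setT.
have [t ht] := constructible_setT (dec_constructible hd hl).
by apply: (proj2 (minimumP (k := w.+2) _)); exists t.
Qed.

(** Provides decompositions of all three kinds for any nonempty graph, so that the widths are
    attained minima and not the default value of [minimum]. *)
Lemma dec_trivial (G : sgraph V) S : S != set0 -> dec G #|V| #|V| S.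
Proof.
have [n] := ubnP #|S|; elim: n S => // n IH S hn /set0Pn [x hx].
rewrite -(setD1K hx); have [->|h0] := eqVneq (S :\ x) set0.
  by rewrite setU0; apply: DecSingle.
apply: DecUnion; rewrite ?max_card //; first exact: DecSingle.
  by apply: IH h0; rewrite (cardsD1 x S) hx in hn.
by rewrite disjoints1 setD11.
Qed.

End CliqueWidth.

(** * Graphs with at most one cycle per component *)

Section OneCycle.
Variables (V : finType) (G : sgraph V).
Implicit Types (r : V -> V) (x y : V).

(* The path [u_0 ... u_(k-1)] with two chords at its ends, which makes [k+1] edges on
   [k] vertices. *)
Definition bad_path (u : seq V) : Prop := uniq u /\ exists x0 : V,
  let k := size u in
  (forall i, i.+1 < k -> adj G (nth x0 u i) (nth x0 u i.+1)) /\
  exists i j, [/\ 2 <= i < k, j.+2 < k, (i, j) != (k.-1, 0),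
    adj G (nth x0 u 0) (nth x0 u i) & adj G (nth x0 u j) (nth x0 u k.-1)].

(* A partition into blocks [r @^-1: x], each attached to the rest of the graph at its
   representative [x] only. *)
Definition blocks r : Prop :=
  [/\ forall x, r (r x) = r x,
      forall x y, adj G x y -> r x != r y -> r x = x /\ r y = y &
      forall x, dec G 2 3 (r @^-1: [set r x])].

Definition live r := [set x | r x == x].

Lemma mem_live r x : blocks r -> r x \in live r.
Proof. by case=> h _ _; rewrite inE h. Qed.

Lemma block_boundary r x : blocks r -> boundary G (r @^-1: [set r x]) \subset [set r x].
Proof.
case=> h1 h2 h3; apply/subsetP => y /boundaryP []; rewrite !inE => /eqP hy [z].
rewrite !inE => hz hyz.
have hne : r y != r z by rewrite hy eq_sym.
by have [E _] := h2 _ _ hyz hne; rewrite -hy E.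
Qed.

Definition merge r (L : {set V}) v x := if r x \in L then v else r x.

Lemma merge_blocks r (L : {set V}) v : blocks r -> L \subset live r -> v \in L ->
  (forall x y, x \in L -> y \in live r -> y \notin L -> adj G x y -> x = v) ->
  dec G 2 3 (r @^-1: L) -> blocks (merge r L v).
Proof.
move=> [h1 h2 h3] hL hv hadj hd; rewrite /merge.
have rv : r v = v by move: (subsetP hL _ hv); rewrite inE => /eqP.
split.
- move=> x; case: (boolP (r x \in L)) => hx; first by rewrite rv hv.
  by rewrite h1 (negbTE hx).
- have aux x y : adj G x y -> r x \in L -> r y \notin L -> v = x /\ r y = y.
    move=> hxy hx hy; have hne : r x != r y by apply: contraNneq hy => <-.
    have [ex ey] := h2 _ _ hxy hne; split => //; apply/esym.
    by apply: (hadj x y) => //; [rewrite -ex|rewrite inE ey|rewrite -ey].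
  move=> x y hxy; case: (boolP (r x \in L)) => hx; case: (boolP (r y \in L)) => hy.
  + by rewrite eqxx.
  + by have [-> ->] := aux _ _ hxy hx hy.
  + rewrite adj_sym in hxy; by have [-> ->] := aux _ _ hxy hy hx.
  + exact: h2.
- move=> x; case: (boolP (r x \in L)) => hx.
    suff -> : (fun x => if r x \in L then v else r x) @^-1: [set v] = r @^-1: L by [].
    apply/setP => y; rewrite !inE; case: ifP => hy; first by rewrite eqxx.
    by apply/negP => /eqP hyv; rewrite hyv hv in hy.
  have -> : (fun x => if r x \in L then v else r x) @^-1: [set r x] =
    r @^-1: [set r x].
    apply/setP => y; rewrite !inE; case: (boolP (r y \in L)) => // hy.
    have [E|_] := eqVneq v (r x); first by rewrite -E hv in hx.
    by have [E|//] := eqVneq (r y) (r x); rewrite -E hy in hx.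
  exact: h3.
Qed.

Lemma card_live_merge r (L : {set V}) v : blocks r -> L \subset live r -> v \in L ->
  1 < #|L| -> #|live (merge r L v)| < #|live r|.
Proof.
move=> [h1 _ _] hL hv hL1; apply: proper_card; apply/properP; split.
  apply/subsetP => x; rewrite !inE /merge; case: ifP => // _ /eqP <-.
  by have := subsetP hL _ hv; rewrite inE.
have [w hw hwv] : exists2 w, w \in L & w != v.
  move: hL1; rewrite (cardsD1 v) hv ltnS card_gt0 => /set0Pn [w].
  by rewrite in_setD1 => /andP [? ?]; exists w.
exists w; first exact: (subsetP hL).
have := subsetP hL _ hw; rewrite !inE /merge => /eqP ->; rewrite hw.
by rewrite eq_sym.
Qed.

(** Contracts a leaf [u] of the graph on the live vertices into its neighbour. An isolated [u] is
    allowed as well and may be merged with any [v]; this is how different components are put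
    together. *)
Lemma merge2_blocks r u v : blocks r -> u \in live r -> v \in live r -> u != v ->
  (forall y, y \in live r -> adj G u y -> y = v) ->
  blocks (merge r [set u; v] v).
Proof.
move=> hr hu hv huv hadj; apply: merge_blocks => //.
- by apply/subsetP => x /set2P [] ->.
- by rewrite set22.
- move=> x y /set2P [-> hy|-> //].
  by move=> hyn /(hadj _ hy) E; rewrite E set22 in hyn.
have ru : r u = u by move: hu; rewrite inE => /eqP.
have rv : r v = v by move: hv; rewrite inE => /eqP.
have -> : r @^-1: [set u; v] = r @^-1: [set r u] :|: r @^-1: [set r v].
  by apply/setP => x; rewrite !inE ru rv.
have [h1 h2 h3] := hr.
have hb : boundary G (r @^-1: [set r u] :|: r @^-1: [set r v]) \subset [set u; v].
  apply: subset_trans (boundaryU _ _ _) _; apply: setUSS.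
    by rewrite -{2}ru; apply: block_boundary.
  by rewrite -{2}rv; apply: block_boundary.
apply: DecUnion => //.
- rewrite -setI_eq0; apply/eqP/setP => x; rewrite !inE ru rv.
  by apply/negP => /andP [/eqP -> h]; rewrite (eqP h) eqxx in huv.
- apply: leq_trans (subset_leq_card (B := [set u; v]) _) _; last by rewrite cards2; case: (_ == _).
  by apply: setUSS; [rewrite -{2}ru|rewrite -{2}rv]; apply: block_boundary.
- apply: leq_trans (subset_leq_card hb) _.
  by rewrite cards2; case: (_ == _).
Qed.

(* The blocks are added in cyclic order: only the representatives at the two ends of
   the arc obtained so far can have neighbours outside it. *)
Lemma cycle_dec r (x0 : V) (u : seq V) : blocks r -> uniq u ->
  {subset u <= live r} -> 0 < size u ->
  (forall i y, i < size u -> y \in live r -> adj G (nth x0 u i) y ->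
     y = nth x0 u (i.+1 %% size u) \/ y = nth x0 u ((i + (size u).-1) %% size u)) ->
  dec G 2 3 (r @^-1: [set x in u]).
Proof.
move=> hr hu hl h0 hadj; have [h1 h2 h3] := hr.
pose T i := r @^-1: [set x in take i u].
have rl x : x \in u -> r x = x by move/hl; rewrite inE => /eqP.
have bT i : i < size u -> boundary G (T i.+1) \subset [set nth x0 u 0; nth x0 u i].
  move=> hi; apply/subsetP => x /boundaryP [hx [y hy hxy]].
  rewrite !inE in hx hy.
  have hne : r x != r y by apply: contraNneq hy => <-.
  have [ex ey] := h2 _ _ hxy hne; rewrite ex in hx; rewrite ey in hy.
  have hxu := mem_take hx.
  have hyl : y \in live r by rewrite inE ey.
  pose a := index x u; have ha : a < size u by rewrite index_mem.
  have hxa : nth x0 u a = x by rewrite nth_index.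
  have hai : a <= i by move: hx; rewrite in_take // -ltnS.
  rewrite !inE; have := hadj a y ha hyl; rewrite hxa => /(_ hxy).
  have hyi b : b < size u -> y = nth x0 u b -> i < b.
    move=> hb E; move: hy; rewrite E in_take ?mem_nth // index_uniq // -ltnNge.
    by [].
  have [a0|a0] := posnP a; first by rewrite -hxa a0 eqxx.
  case=> [E|E].
    have := hyi _ _ E; rewrite ltn_mod h0 => /(_ isT) hlt.
    have : a.+1 %% size u <= a.+1 by apply: leq_mod.
    move=> hle; have : i < a.+1 by apply: leq_trans hle.
    rewrite ltnS => hia; have ai : a = i by apply/eqP; rewrite eqn_leq hai.
    by rewrite -hxa ai eqxx orbT.
  have := hyi _ _ E; rewrite ltn_mod h0 => /(_ isT).
  have -> : (a + (size u).-1) = a.-1 + size u by lia.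
  rewrite modnDr modn_small; last by lia.
  by lia.
suff H i : i < size u -> dec G 2 3 (T i.+1).
  have -> : r @^-1: [set x in u] = T (size u).-1.+1.
    by rewrite prednK // /T take_size.
  by apply: H; rewrite prednK.
elim: i => [|i IH] hi.
  have -> : T 1 = r @^-1: [set r (nth x0 u 0)].
    rewrite (rl _ (mem_nth _ _)) //; apply/setP => x; rewrite !inE.
    by case: (u) h0 => //= a u' _; rewrite take0 inE.
  exact: h3.
have hui : nth x0 u i.+1 \in u by rewrite mem_nth.
have E : T i.+2 = T i.+1 :|: r @^-1: [set r (nth x0 u i.+1)].
  apply/setP => x; rewrite !inE (take_nth x0) // mem_rcons inE orbC.
  by rewrite (rl _ hui).
rewrite E; apply: DecUnion => //.
- exact: IH (ltnW hi).
- rewrite -setI_eq0; apply/eqP/setP => x; rewrite !inE (rl _ hui).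
  apply/negP => /andP [h /eqP E'].
  by rewrite E' in_take // index_uniq // ltnn in h.
(* The two ends of the arc and the representative of the new block: this is the origin of the bound
   3. *)
- apply: leq_trans (subset_leq_card (setUSS (bT i (ltnW hi)) (block_boundary _ hr))) _.
  apply: leq_trans (leq_card_setU _ _) _; rewrite cards1 addn1 ltnS cards2.
  by case: (_ == _).
- rewrite -E; apply: leq_trans (subset_leq_card (bT _ hi)) _; rewrite cards2.
  by case: (_ == _).
Qed.

Section LongestPath.
Variables (L : {set V}) (x0 : V).
Hypothesis no_bad : forall u, ~ bad_path u.
Hypothesis mindeg : forall x y, x \in L -> y \in L ->
  exists z, [/\ z \in L, adj G x z & z != y].

Definition lpath u := [&& uniq u, all (mem L) u & sorted (adj G) u].

(** All neighbours in [L] of an end of a longest path lie on the path, and by [mindeg] each end has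
    one besides the next vertex, hence a chord. Two different chords at the two ends would make a
    bad path, so both are the edge joining the ends. *)
Lemma longest_path_ends u : lpath u -> 0 < size u ->
  (forall u', lpath u' -> size u' <= size u) ->
  [/\ 2 < size u, adj G (nth x0 u 0) (nth x0 u (size u).-1) &
    forall y, y \in L -> adj G (nth x0 u 0) y ->
      y = nth x0 u 1 \/ y = nth x0 u (size u).-1].
Proof.
move=> hp h0 hmax; have /and3P [hu hL hs] := hp.
have inL i : i < size u -> nth x0 u i \in L by move=> hi; apply: (allP hL); rewrite mem_nth.
have h0u y : y \in L -> adj G (nth x0 u 0) y -> y \in u.
  move=> hy hadj; apply/negPn/negP => hyu.
  have := hmax (y :: u); rewrite /lpath /= hyu hu hy hL ltnn /=.
  have -> : path (adj G) y u = true; last by move=> /(_ isT).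
  by case: (u) h0 hs hadj => //= a u' _ -> ; rewrite adj_sym => ->.
have hlast y : y \in L -> adj G (nth x0 u (size u).-1) y -> y \in u.
  move=> hy hadj; apply/negPn/negP => hyu.
  have := hmax (rcons u y); rewrite /lpath rcons_uniq hyu hu all_rcons /= hy hL size_rcons ltnn /=.
  have -> : sorted (adj G) (rcons u y) = true; last by move=> /(_ isT).
  rewrite nth_last in hadj.
  by case: (u) h0 hs hadj => //= a u' _ h1 h2; rewrite rcons_path h1.
have first y : y \in L -> adj G (nth x0 u 0) y -> y != nth x0 u 1 ->
    exists i, [/\ 2 <= i < size u, y = nth x0 u i & adj G (nth x0 u 0) (nth x0 u i)].
  move=> hy hadj hn; have hyu := h0u _ hy hadj; exists (index y u).
  rewrite index_mem hyu andbT nth_index //; split => //.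
  have E := nth_index x0 hyu; case: (index y u) E => [|[|i]] // E.
    by have := adj_neq hadj; rewrite E eqxx.
  by rewrite E eqxx in hn.
have [i [hi _ hai]] : exists i, [/\ 2 <= i < size u, true & adj G (nth x0 u 0) (nth x0 u i)].
  have [z [hz h1 h2]] : exists z, [/\ z \in L, adj G (nth x0 u 0) z & z != nth x0 u 1].
    have [hk|hk] := ltnP 1 (size u); first exact: mindeg (inL _ h0) (inL _ hk).
    have [z [hz h1 h2]] := mindeg (inL _ h0) (inL _ h0).
    have := h0u _ hz h1; case: (u) h0 hk h2 => [|a [|b u']] //= _ _ h2.
    by rewrite inE (negbTE h2).
  by have [i [h3 h4 h5]] := first _ hz h1 h2; exists i.
have hk : 2 < size u by case/andP: hi; apply: leq_ltn_trans.
have lastj : exists j, j.+2 < size u /\ adj G (nth x0 u j) (nth x0 u (size u).-1).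
  have hk1 : (size u).-1 < size u by rewrite prednK.
  have hk2 : (size u).-2 < size u by lia.
  have [z [hz h1 h2]] := mindeg (inL _ hk1) (inL _ hk2).
  have hzu := hlast _ hz h1; exists (index z u).
  rewrite nth_index // adj_sym; split => //.
  have E := nth_index x0 hzu; have hlt : index z u < size u by rewrite index_mem.
  have n1 : index z u != (size u).-1.
    by apply: contraTneq (adj_neq h1) => E'; rewrite -E' E eqxx.
  have n2 : index z u != (size u).-2.
    by apply: contraTneq h2 => E'; rewrite -E' E eqxx.
  by move: n1 n2 hlt hk; lia.
have [j [hj haj]] := lastj.
have key i' : 2 <= i' < size u -> adj G (nth x0 u 0) (nth x0 u i') ->
    i' = (size u).-1 /\ j = 0.
  move=> hi' hadj; have [[-> ->] //|hne] := eqVneq (i', j) ((size u).-1, 0).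
  case: (no_bad (u := u)); split => //; exists x0; split; first exact/sortedP.
  by exists i', j; split.
have [Ei Ej] := key i hi hai.
split => //; first by rewrite -Ei.
move=> y hy hadj; have [->|hn] := eqVneq y (nth x0 u 1); first by left.
have [i' [h1 -> h2]] := first _ hy hadj hn.
by right; have [-> _] := key _ h1 h2.
Qed.

(** The ends being adjacent, every rotation of the path is again a longest path; the preceding lemma
    applied to the rotation starting at position [i] gives the neighbours of that vertex. *)
Lemma longest_path_cycle u i y : lpath u -> 0 < size u ->
  (forall u', lpath u' -> size u' <= size u) ->
  i < size u -> y \in L -> adj G (nth x0 u i) y ->
  y = nth x0 u (i.+1 %% size u) \/ y = nth x0 u ((i + (size u).-1) %% size u).
Proof.
move=> hp h0 hmax hi hy hadj.
have [hk h2 _] := longest_path_ends hp h0 hmax.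
have /and3P [hu hL hs] := hp.
have hc : cycle (adj G) u.
  case: (u) h0 hs h2 => //= a u' _ h1 h2; rewrite rcons_path h1 adj_sym.
  by rewrite (last_nth x0).
have hp' : lpath (rot i u).
  rewrite /lpath rot_uniq hu; apply/andP; split => //; apply/andP; split.
    by apply/allP => x; rewrite mem_rot; apply/allP.
  have : cycle (adj G) (rot i u) by rewrite rot_cycle.
  by case: (rot i u) => //= a u'; rewrite rcons_path => /andP [].
have nth_rot m : m < size u -> nth x0 (rot i u) m = nth x0 u ((i + m) %% size u).
  move=> hm; rewrite /rot nth_cat size_drop nth_drop.
  case: (ltnP m (size u - i)) => h; first by rewrite modn_small //; lia.
  have hm' : m - (size u - i) < i by rewrite ltn_subLR // subnK // ltnW.
  rewrite nth_take //; have -> : i + m = (m - (size u - i)) + size u.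
    rewrite -[in LHS](subnK h) addnC -addnA subnK //; exact: ltnW.
  by rewrite modnDr modn_small //; apply: ltn_trans hi.
have [_ _] := longest_path_ends hp' (etrans (congr1 _ (size_rot i u)) h0)
  (fun u' h => leq_trans (hmax u' h) (eq_leq (esym (size_rot i u)))).
rewrite size_rot !nth_rot; [|lia..].
rewrite addn0 addn1 (modn_small hi) => /(_ y hy hadj) [-> | ->]; [by left|by right].
Qed.

End LongestPath.

(** Induction on the number of live vertices. If none of them can be contracted into another one,
    the live graph has minimum degree at least 2, and a longest path closes to a cycle without live
    neighbours outside. This cycle becomes one block, represented by an arbitrary vertex of it. *)
Lemma blocks_dec r (x0 : V) : (forall u, ~ bad_path u) -> blocks r -> dec G 2 3 setT.
Proof.
move=> no_bad; have [n] := ubnP #|live r|; elim: n r => // n IH r hn hr.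
pose L := live r; have hL0 : r x0 \in L by apply: mem_live.
have [h1 h2 h3] := hr.
have [hL1|hL1] := leqP #|L| 1.
  have -> : setT = r @^-1: [set r x0]; last exact: h3.
  apply/setP => x; rewrite !inE; apply/esym/eqP.
  by apply: (card_le1_eqP hL1); apply: mem_live.
have [[u [v [hu hv huv hadj]]]|hno] := pselect (exists u v,
  [/\ u \in L, v \in L, u != v & forall y, y \in L -> adj G u y -> y = v]).
  apply: (IH (merge r [set u; v] v)); last exact: merge2_blocks.
  apply: leq_trans (card_live_merge hr _ _ _) _; rewrite ?set22 ?cards2 ?huv //.
  by apply/subsetP => x /set2P [] ->.
have mind x y : x \in L -> y \in L -> exists z, [/\ z \in L, adj G x z & z != y].
  move=> hx hy; apply/not_existsP => h.
  have [y' hy' hxy'] : exists2 y', y' \in L & x != y'.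
    have [E|hne] := eqVneq x y; last by exists y.
    move: hL1; rewrite (cardsD1 x) hx ltnS card_gt0 => /set0Pn [w].
    by rewrite in_setD1 eq_sym => /andP [? ?]; exists w.
  have [E|hne] := eqVneq x y; last first.
    apply: hno; exists x, y; split => // z hz hxz.
    by apply/eqP/negPn/negP => hzy; apply: (h z).
  apply: hno; exists x, y'; split => // z hz hxz.
  case: (h z); split => //; rewrite -E eq_sym; exact: adj_neq hxz.
pose P k := [exists t : k.-tuple V, lpath L t].
have P1 : P 1.
  by apply/existsP; exists [tuple r x0]; rewrite /lpath /= hL0.
have Pb k : P k -> k <= #|V|.
  move=> /existsP [t /and3P [hu _ _]]; rewrite -(size_tuple t) -(card_uniqP hu).
  exact: max_card.
have [k /existsP [t ht] hk] := ex_maxnP (ex_intro P 1 P1) Pb.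
have hmax u' : lpath L u' -> size u' <= size t.
  move=> hu'; rewrite size_tuple; apply: hk; apply/existsP.
  by exists (in_tuple u').
have h0 : 0 < size t by rewrite size_tuple; apply: hk.
have hcyc := longest_path_cycle (x0 := x0) no_bad mind ht h0 hmax.
have [ht2 _ _] := longest_path_ends x0 no_bad mind ht h0 hmax.
have /and3P [hu htL _] := ht.
have tL : {subset t <= live r} by move=> x hx; apply: (allP htL).
have hd := cycle_dec hr hu tL h0 hcyc.
have sL : [set x in t] \subset live r by apply/subsetP => x; rewrite inE => /tL.
have v0 : nth x0 t 0 \in [set x in t] by rewrite inE mem_nth.
have hb := merge_blocks hr sL v0 _ hd; apply: IH (hb _).
  apply: leq_trans (card_live_merge hr sL v0 _) _ => //.
  by rewrite cardsE (card_uniqP hu); apply: ltnW.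
move=> x y; rewrite !inE => hx hy hyt hadj; case/negP: hyt.
have := hcyc (index x t) y; rewrite index_mem nth_index // inE => /(_ hx hy hadj).
by case=> ->; rewrite mem_nth // ltn_mod.
Qed.

Lemma no_bad_path_dec : 0 < #|V| -> (forall u, ~ bad_path u) -> dec G 2 3 setT.
Proof.
move=> /card_gt0P [x0 _] hb; apply: (@blocks_dec id x0) => //; split => //.
  move=> x; suff -> : id @^-1: [set id x] = [set x] by apply: DecSingle.
  by apply/setP => y; rewrite !inE.
Qed.

End OneCycle.

(** * The edges of a bad path *)

Section BadPaths.
Variables (V : finType) (x0 : V).

(** Edges are recorded by positions, so that a candidate for a bad path on [k] vertices is a
    sequence with two indices: at most n^k * k^2 candidates among [n] vertices. *)
Definition path_pairs k (i j : nat) : seq (nat * nat) :=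
  [seq (a, a.+1) | a <- iota 0 k.-1] ++ [:: (0, i); (j, k.-1)].

Definition pair_edges (u : seq V) (s : seq (nat * nat)) : {set {set V}} :=
  [set e in [seq [set nth x0 u q.1; nth x0 u q.2] | q <- s]].

Lemma card_pair_edges u s : uniq u -> uniq s ->
  all (fun q => q.1 < q.2 < size u) s -> #|pair_edges u s| = size s.
Proof.
move=> hu hs /allP ha; rewrite /pair_edges cardsE.
suff h : uniq [seq [set nth x0 u q.1; nth x0 u q.2] | q <- s].
  by rewrite (card_uniqP h) size_map.
rewrite map_inj_in_uniq // => -[a b] [a' b'] /ha /= /andP [h1 h2] /ha /= /andP [h3 h4].
have ha1 := ltn_trans h1 h2; have ha3 := ltn_trans h3 h4.
have inj i j : (i < size u) -> (j < size u) -> nth x0 u i = nth x0 u j -> i = j.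
  by move=> hi hj /eqP; rewrite nth_uniq // => /eqP.
move=> /set2_inj [[/inj -> // /inj -> //]|[/inj E1 /inj E2]].
by move: h1 h3; rewrite E1 // E2 // => h; rewrite ltnNge (ltnW h).
Qed.

Lemma pair_edges_card2 u s e : uniq u ->
  all (fun q => q.1 < q.2 < size u) s -> e \in pair_edges u s -> #|e| == 2.
Proof.
move=> hu /allP ha; rewrite inE => /mapP [[a b] /ha /= /andP [h1 h2] ->].
by rewrite cards2 nth_uniq ?(ltn_trans h1) // (ltn_eqF h1).
Qed.

Definition bad_indices (u : seq V) i j :=
  [&& uniq u, 2 <= i < size u, j.+2 < size u & (i, j) != ((size u).-1, 0)].

Lemma path_pairs_ltn u i j : bad_indices u i j ->
  all (fun q => q.1 < q.2 < size u) (path_pairs (size u) i j).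
Proof.
move=> /and4P [_ /andP [hi1 hi2] hj _]; rewrite all_cat /= hi2 (ltn_trans _ hi1) //=.
rewrite andbT; apply/andP; split; last by move: hi1 hi2 hj; clear; lia.
apply/allP => q /mapP [a]; rewrite mem_iota add0n => /andP [_ ha] -> /=.
by move: ha; clear; lia.
Qed.

(** The bounds on [i] and [j] keep the chords off the path, and the excluded pair is the one for
    which the two chords coincide. *)
Lemma path_pairs_uniq u i j : bad_indices u i j -> uniq (path_pairs (size u) i j).
Proof.
move=> /and4P [_ /andP [hi1 hi2] hj hne]; rewrite cat_uniq.
rewrite map_inj_uniq ?iota_uniq /=; last by move=> a b [].
rewrite !negb_or !andbT; apply/andP; split; [apply/andP; split|].
- by apply/mapP => -[a _ [<- E]]; move: hi1; rewrite E.
- by apply/mapP => -[a _ [<- E]]; move: hj E; clear; lia.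
- by apply: contraNneq hne => -[<- ->].
Qed.

Lemma size_path_pairs u i j : bad_indices u i j ->
  size (path_pairs (size u) i j) = (size u).+1.
Proof.
move=> /and4P [_ /andP [hi1 hi2] _ _]; rewrite size_cat size_map size_iota /=.
by move: hi1 hi2; clear; lia.
Qed.

Lemma bad_path_edges (G : sgraph V) u : bad_path G u -> exists i j,
  bad_indices u i j /\ pair_edges u (path_pairs (size u) i j) \subset edges G.
Proof.
move=> [hu [y0 [hp [i [j [hi hj hne h1 h2]]]]]]; exists i, j.
have hb : bad_indices u i j by rewrite /bad_indices hu hi hj hne.
split => //; apply/subsetP => e; rewrite inE => /mapP [[a b] hab ->] /=.
have /allP/(_ _ hab) /= /andP [hlt hb'] := path_pairs_ltn hb.
rewrite -/(adj G _ _) !(set_nth_default y0) ?(ltn_trans hlt) //.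
move: hab; rewrite mem_cat => /orP [/mapP [k]|].
  by rewrite mem_iota => /andP [_ hk] [-> ->]; apply: hp; move: hk hi; clear; lia.
by rewrite !inE => /orP [] /eqP [-> ->].
Qed.

End BadPaths.

(** * Balanced separators from small width *)

Section Separation.
Variables (V : finType) (G : sgraph V).
Implicit Types (W X Z B : {set V}).

Definition separated W z := exists X Z : {set V},
  [/\ #|Z| <= z, [disjoint X & Z],
      forall x y, x \in X -> y \notin X -> y \notin Z -> ~~ adj G x y,
      #|W| <= 4 * #|W :&: X| & #|W| <= 4 * #|W :\: (X :|: Z)|].

Definition neighbours B := [set y | (y \notin B) && [exists x, (x \in B) && adj G x y]].

Definition thin d d' := forall B, #|B| <= d -> #|neighbours B| <= d'.

(** Every vertex outside [X] with a neighbour in [X] is a neighbour of [B]; deleting these vertices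
    separates [X] from the rest. The loss is at most a twelfth of [W], and 1/3 - 1/12 = 1/4. *)
Lemma dominated_separated W X B d d' : B \subset X -> #|B| <= d -> thin d d' ->
  (forall x y, x \in X -> y \notin X -> adj G x y -> exists2 b, b \in B & adj G b y) ->
  #|W| <= 3 * #|W :&: X| -> #|W| <= 3 * #|W :\: X| -> 12 * d' <= #|W| ->
  separated W d'.
Proof.
move=> hBX hB ht hdom h1 h2 hd; pose Z := neighbours B :\: X.
have hZ : #|Z| <= d' by apply: leq_trans (subset_leq_card (subsetDl _ _)) (ht _ hB).
exists X, Z; split => //.
- by rewrite -setI_eq0; apply/eqP/setP => x; rewrite !inE; case: (x \in X).
- move=> x y hx hy hyZ; apply/negP => hxy; case/negP: hyZ.
  have [b hb hby] := hdom _ _ hx hy hxy.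
  rewrite !inE hy (contra (subsetP hBX y) hy) /=.
  by apply/existsP; exists b; rewrite hb.
- by move: h1; lia.
- have : #|W :\: X| <= #|W :\: (X :|: Z)| + #|Z|.
    apply: leq_trans (subset_leq_card _) (leq_card_setU _ _).
    by apply/subsetP => x; rewrite !inE; case: (x \in W); case: (x \in X) => //=;
      case: (x \in B) => //=; case: [exists _, _].
  by move: h2; lia.
Qed.

Lemma small_image_transversal (T : finType) k (h : T -> 'I_k) :
  exists R : {set T}, #|R| <= k /\ forall a, exists2 b, b \in R & h b = h a.
Proof.
have [a0 _|h0] := pickP T; last first.
  by exists set0; split=> [|a]; [rewrite cards0|have := h0 a].
pose rep i := odflt a0 [pick a | h a == i].
exists [set rep i | i : 'I_k]; split.
  by apply: leq_trans (leq_imset_card _ _) _; rewrite card_ord.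
move=> a; exists (rep (h a)); first exact: imset_f.
by rewrite /rep; case: pickP => [b /eqP //|/(_ a)]; rewrite eqxx.
Qed.

(** The common consequence of small rank-width and small clique-width; small tree-width gives a
    separator directly. *)
Definition balanced_dominated W k := exists X B, [/\ B \subset X, #|B| <= k,
  forall x y, x \in X -> y \notin X -> adj G x y -> exists2 b, b \in B & adj G b y,
  #|W| <= 3 * #|W :&: X| & #|W| <= 3 * #|W :\: X|].

(* [Lam] records the edges that will be added by the joins applied outside [t]. *)
Lemma cw_balanced W k (t : cw_expression k) (f : lg_vertex (cw_eval t) -> V)
    (Lam : rel 'I_k) : injective f ->
  (forall a b, adj G (f a) (f b) = lg_adj a b || Lam (lg_label a) (lg_label b)) ->
  (forall a b y, lg_label a = lg_label b -> y \notin codom f ->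
     adj G (f a) y = adj G (f b) y) ->
  3 < #|W| -> #|W| <= 3 * #|W :&: [set x in codom f]| -> balanced_dominated W k.
Proof.
elim: t f Lam => [i|t1 IH1 t2 IH2|i j hij t IH|i j t IH] /= f Lam hf hL hy hW hm.
- have : #|W :&: [set x in codom f]| <= #|codom f|.
    by rewrite -(cardsE (mem (codom f))); apply: subset_leq_card; apply: subsetIr.
  have : #|codom f| <= 1.
    by apply: leq_trans (card_size _) _; rewrite size_map -cardE card_unit.
  move=> h1 h2; have := leq_trans h2 h1; move: hm; set q := #|W :&: _|.
  by move: hW; lia.
- pose f1 a := f (inl a); pose f2 a := f (inr a).
  have cf x : (x \in codom f) = (x \in codom f1) || (x \in codom f2).
    apply/idP/orP => [/codomP [[a|a] ->]|[] /codomP [a ->]].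
    + by left; apply: (codom_f f1 a).
    + by right; apply: (codom_f f2 a).
    + exact: (codom_f f (inl a)).
    + exact: (codom_f f (inr a)).
  (* Descend into a part with at least a third of [W]. If neither part has that much, the union has
     at most two thirds of [W] and is balanced. *)
  have [h1|h1] := leqP #|W| (3 * #|W :&: [set x in codom f1]|).
    apply: (IH1 f1 Lam) => //.
    + by move=> a b /hf [].
    + by move=> a b; rewrite /f1 hL.
    + move=> a b y hab hyf; have [/codomP [[c|c] E]|hyc] := boolP (y \in codom f).
      * by rewrite E codom_f in hyf.
      * by rewrite E !hL /= hab.
      * exact: hy.
  have [h2|h2] := leqP #|W| (3 * #|W :&: [set x in codom f2]|).
    apply: (IH2 f2 Lam) => //.
    + by move=> a b /hf [].
    + by move=> a b; rewrite /f2 hL.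
    + move=> a b y hab hyf; have [/codomP [[c|c] E]|hyc] := boolP (y \in codom f).
      * by rewrite E !hL /= hab.
      * by rewrite E codom_f in hyf.
      * exact: hy.
  (* Vertices with equal labels have the same neighbours outside, so one vertex for each label
     dominates. *)
  have [R [hR hR']] := small_image_transversal (@lg_label k (cw_eval (CWUnion t1 t2))).
  exists [set x in codom f], [set f a | a in R]; split => //.
  + by apply/subsetP => _ /imsetP [a _ ->]; rewrite inE codom_f.
  + exact: leq_trans (leq_imset_card _ _) hR.
  + move=> x y; rewrite !inE => /codomP [a ->] hyf hay.
    have [b hb hba] := hR' a; exists (f b); first exact: imset_f.
    by rewrite (hy _ _ _ hba).
  + have : #|W :&: [set x in codom f]| <= #|W :&: [set x in codom f1]| + #|W :&: [set x in codom f2]|.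
      apply: leq_trans (subset_leq_card _) (leq_card_setU _ _).
      by apply/subsetP => x; rewrite !inE cf; case: (x \in W).
    by have := cardsID [set x in codom f] W; lia.
- apply: (IH f (fun l l' => [|| (l == i) && (l' == j), (l == j) && (l' == i) | Lam l l'])) => //.
  by move=> a b; rewrite hL /= -!orbA.
- pose rho l := if l == i then j else l.
  apply: (IH f (fun l l' => Lam (rho l) (rho l'))) => //.
  by move=> a b y hab; apply: hy => /=; rewrite hab.
Qed.

Lemma cw_constructs_balanced W k (t : cw_expression k) : cw_constructs t G ->
  3 < #|W| -> balanced_dominated W k.
Proof.
move=> [g [[f hgf hfg] hadj]] hW; apply: (@cw_balanced W k t f (fun _ _ => false)) => //.
- exact: can_inj hfg.
- by move=> a b; rewrite orbF hadj !hfg.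
- by move=> a b y _; rewrite -[y]hgf codom_f.
- suff -> : W :&: [set x in codom f] = W by lia.
  by apply/setP => x; rewrite !inE -[x]hgf codom_f andbT.
Qed.

(** [B] indexes a basis of the row space: a column that vanishes on these rows vanishes on all rows,
    so a vertex outside [X] with a neighbour in [X] has one in [B]. *)
Lemma cutrank_dominated X k : cutrank G X (~: X) <= k ->
  exists B, [/\ B \subset X, #|B| <= k &
    forall x y, x \in X -> y \notin X -> adj G x y -> exists2 b, b \in B & adj G b y].
Proof.
rewrite /cutrank; set M := (X in \rank X) => hk.
exists [set enum_val (maxrankfun M i) | i : 'I_(\rank M)]; split.
- by apply/subsetP => _ /imsetP [i _ ->]; apply: enum_valP.
- by apply: leq_trans (leq_imset_card _ _) _; rewrite card_ord.
move=> x y hx hy hxy; have hy' : y \in ~: X by rewrite inE.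
have [/existsP [i hi]|hn] := boolP [exists i, adj G (enum_val (maxrankfun M i)) y].
  by exists (enum_val (maxrankfun M i)) => //; apply: imset_f.
have /submxP [D hD] : (M <= rowsub (maxrankfun M) M)%MS by rewrite eq_maxrowsub.
have := congr1 (fun A : 'M_(_, _) => A (enum_rank_in hx x) (enum_rank_in hy' y)) hD.
rewrite !mxE big1 => [|i _].
  rewrite !enum_rankK_in // hxy => /eqP.
  by rewrite oner_eq0.
rewrite !mxE enum_rankK_in //; case: (boolP (adj _ _ _)) => h; last by rewrite mulr0.
by case/negP: hn; apply/existsP; exists i.
Qed.

End Separation.

(** * Branches of a tree at an edge *)

Section Trees.
Variables (N : finType) (T : sgraph N).
Hypothesis hT : is_tree T.

Definition branch (u v : N) := [set x | connect (delete_edge T u v) u x].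

Lemma branch_id u v : u \in branch u v.
Proof. by rewrite inE connect0. Qed.

Lemma delete_edgeC (u v : N) : delete_edge T u v =2 delete_edge T v u.
Proof. by move=> x y; rewrite /delete_edge (setUC [set u]). Qed.

Lemma delete_edge_sym (u v : N) : connect_sym (delete_edge T u v).
Proof.
apply: sym_connect_sym => x y; rewrite /delete_edge adj_sym.
by rewrite (setUC [set x]).
Qed.

Lemma branch_step u v x y : x \in branch u v -> adj T x y ->
  [set x; y] != [set u; v] -> y \in branch u v.
Proof.
rewrite !inE => h hxy hne; apply: connect_trans h _.
by apply: connect1; rewrite /delete_edge hxy.
Qed.

Lemma branchF u v : adj T u v -> v \notin branch u v.
Proof.
move=> huv; rewrite inE; apply/negP => /connectP [p hp hl].
case: (shortenP hp) hl => p' hp' hu _ hl.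
have [_ _ hc] := hT.
have hpa : path (adj T) u p'.
  by apply: sub_path hp' => x y /andP [].
have /hc : ucycle (adj T) (u :: p').
  by apply/andP; split => //=; rewrite rcons_path hpa -hl adj_sym.
case: p' hp' hl {hpa hu} => [_ /= E|y [|z p']] //=.
  by move: huv; rewrite E => /adj_neq; rewrite eqxx.
by rewrite /delete_edge => /andP [/andP [_ hne] _] E; rewrite -E eqxx in hne.
Qed.

Lemma branch_cover u v x : adj T u v -> x \in branch u v \/ x \in branch v u.
Proof.
move=> huv; have [_ hc _] := hT; have /connectP [p hp ->] := hc u x.
suff H q y : path (adj T) y q -> y \in branch u v \/ y \in branch v u ->
    last y q \in branch u v \/ last y q \in branch v u.
  by apply: (H p u) => //; left; apply: branch_id.
elim: q y => //= z q IH y /andP [hyz hq] hy; apply: IH hq _.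
have [E|hne] := eqVneq [set y; z] [set u; v].
  have : z \in [set u; v] by rewrite -E set22.
  by move=> /set2P [] ->; [left|right]; apply: branch_id.
case: hy => hy; [left|right]; apply: (branch_step hy hyz) => //.
by rewrite (setUC [set v]).
Qed.

Lemma branch_disjoint u v x : adj T u v -> x \in branch u v -> x \notin branch v u.
Proof.
move=> huv hx; apply/negP => hx'; move/negP: (branchF huv); apply.
move: hx hx'; rewrite !inE => hx.
rewrite (eq_connect (delete_edgeC v u)) delete_edge_sym => hx'.
exact: connect_trans hx hx'.
Qed.

Lemma branch_sub u v a : adj T u v -> adj T a u -> a != v ->
  branch a u \subset branch u v.
Proof.
move=> huv hau hav; apply/subsetP => x hx.
suff : (x \in branch u v) && (x \in branch a u) by case/andP.
have hu := branchF hau; have hv := branchF huv.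
move: (hx); rewrite {1}inE; apply: (@delete_edge_closed _ _ _ _ _ _
  (fun x => (x \in branch u v) && (x \in branch a u))) => /=.
  rewrite branch_id andbT; apply: (branch_step (branch_id u v)).
    by rewrite adj_sym.
  apply/negP => /eqP /set2_inj [[_ E]|[E _]].
    by rewrite E eqxx in hav.
  by have := adj_neq huv; rewrite -E eqxx.
move=> y z /andP [h1 h2] hyz hne; rewrite (branch_step h2 hyz hne) andbT.
apply: (branch_step h1 hyz); apply/negP => /eqP /set2_inj [[E _]|[E _]].
  by move: h2 hu; rewrite E => ->.
by move: h1 hv; rewrite E => ->.
Qed.

Lemma branch_card u v a : adj T u v -> adj T a u -> a != v ->
  #|branch a u| < #|branch u v|.
Proof.
move=> huv hau hav; apply: proper_card; apply/properP; split.
  exact: branch_sub.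
by exists u; [apply: branch_id|apply: branchF].
Qed.

Lemma branch_split u v x : x \in branch u v ->
  x = u \/ exists a, [/\ adj T a u, a != v & x \in branch a u].
Proof.
move=> hx; have [->|hxu] := eqVneq x u; first by left.
right; apply/existsPP; first by move=> a; apply: and3P.
suff : (x == u) || [exists a, [&& adj T a u, a != v & x \in branch a u]].
  by rewrite (negbTE hxu).
move: hx; rewrite inE; apply: (@delete_edge_closed _ _ _ _ _ _
  (fun x => (x == u) || [exists a, [&& adj T a u, a != v & x \in branch a u]])).
  by rewrite eqxx.
move=> y z /orP [/eqP ->|/existsP [a /and3P [h1 h2 h3]]] hyz hne.
  apply/orP; right; apply/existsP; exists z.
  rewrite adj_sym hyz branch_id andbT /=; apply: contraNneq hne => ->.
  by rewrite eqxx.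
have [->|hzu] := eqVneq z u; first by [].
apply/existsP; exists a; rewrite h1 h2 /=; apply: (branch_step h3 hyz).
apply/negP => /eqP /set2_inj [[_ E]|[E _]]; first by rewrite E eqxx in hzu.
by have := branchF h1; move: h3; rewrite E => ->.
Qed.

Lemma branches_disjoint t a b x : adj T a t -> adj T b t -> a != b ->
  x \in branch a t -> x \notin branch b t.
Proof.
move=> ha hb hab hx; rewrite adj_sym in hb.
apply: (branch_disjoint hb); apply: subsetP hx.
exact: branch_sub.
Qed.

Lemma branch_exists t x : x != t -> exists2 a, adj T a t & x \in branch a t.
Proof.
move=> hx; have [_ hc _] := hT; have /connectP [p hp hl] := hc x t.
case: (shortenP hp) hl => p' hp' hu _; case/lastP: p' hp' hu => [|p' z].
  by move=> _ _ E; rewrite E eqxx in hx.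
rewrite last_rcons rcons_path => /andP [hp1 hlz] hu E; rewrite -E in hlz hu *.
exists (last x p') => //; rewrite inE delete_edge_sym; apply/connectP; exists p' => //.
move: hu; rewrite -rcons_cons rcons_uniq => /andP [htx _].
have hnt y : y \in x :: p' -> y != t by move=> hy; apply: contraNneq htx => <-.
suff H w q y : path (adj T) y q -> (forall y', y' \in y :: q -> y' != t) ->
    path (delete_edge T w t) y q by exact: H.
elim: q y => //= z' q IH y /andP [h1 h2] hq.
rewrite /delete_edge h1 IH //=; last first.
  by move=> y' hy'; apply: hq; rewrite inE hy' orbT.
rewrite andbT; apply/negP => /eqP h; have : t \in [set y; z'] by rewrite h set22.
rewrite !inE; have := hq y; have := hq z'; rewrite !inE !eqxx orbT /=.
by rewrite ![t == _]eq_sym => /(_ isT) /negbTE -> /(_ isT) /negbTE ->.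
Qed.

End Trees.

Section WidthSeparators.
Variables (V : finType) (G : sgraph V).
Implicit Types (W X Z : {set V}).

(** Take an oriented edge [uv] with at least a third of [W] on the side of [u] and with the smallest
    branch. The node [u] is not a leaf, as [W] has more than 3 elements. The two other branches at
    [u] are smaller, hence carry less than a third each, so that at least a third of [W] is on the
    side of [v]. *)
Lemma rank_decomposition_balanced W (D : rank_decomposition V) k :
  rd_width G D <= k -> 3 < #|W| -> balanced_dominated G W k.
Proof.
move=> hk hW; set T := rd_tree D; have hT : is_tree T := rd_treeP D.
have sideE u v x : (x \in rd_side u v) = (rd_leaf D x \in branch T u v).
  by rewrite !inE.
have sideC u v : adj T u v -> rd_side v u = ~: rd_side u v.
  move=> huv; apply/setP => x; rewrite in_setC !sideE.
  have [h|h] := branch_cover hT (rd_leaf D x) huv.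
    by rewrite h (negbTE (branch_disjoint hT huv h)).
  by rewrite h (branch_disjoint hT _ h) // adj_sym.
have cardC u v : adj T u v -> #|W :&: rd_side u v| + #|W :&: rd_side v u| = #|W|.
  by move=> huv; rewrite (sideC u v huv) -setDE cardsID.
pose Q (uv : rd_node D * rd_node D) :=
  adj T uv.1 uv.2 && (#|W| <= 3 * #|W :&: rd_side uv.1 uv.2|).
have [uv0 Q0] : exists uv, Q uv.
  have [x hx] : exists x, x \in W by apply/set0Pn; rewrite -card_gt0; apply: leq_trans hW.
  pose t := rd_leaf D x.
  have [s hs] : exists s, adj T t s.
    have : 0 < degree T t by case: (rd_subcubic t) => h; rewrite /T h.
    by move=> /card_gt0P [s hs]; exists s.
  have := cardC _ _ hs; have [h|h] := leqP #|W| (3 * #|W :&: rd_side t s|).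
    by exists (t, s); rewrite /Q /= hs h.
  move=> hc; exists (s, t); rewrite /Q /= adj_sym hs /=.
  by move: hc h; set a := #|_ :&: _|; set b := #|_ :&: _|; lia.
have [[u v] /andP [/= huv huvW] hmin] := arg_minnP (fun uv => #|branch T uv.1 uv.2|) Q0.
have small a : adj T a u -> a != v -> 3 * #|W :&: rd_side a u| < #|W|.
  move=> hau hav; rewrite ltnNge; apply/negP => h.
  have := hmin (a, u); rewrite /Q /= hau h => /(_ isT).
  by rewrite leqNgt (branch_card hT huv hau hav).
have hvW : #|W| <= 3 * #|W :&: rd_side v u|.
  suff h : 3 * #|W :&: rd_side u v| <= 2 * #|W|.
    by have := cardC _ _ huv; move: h; set a := #|_ :&: _|; set b := #|_ :&: _|; lia.
  have [hd|hd] := rd_subcubic u.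
    have hsub : rd_side u v \subset [set x | rd_leaf D x == u].
      apply/subsetP => x; rewrite sideE inE => /(branch_split hT) [-> //|[a [h1 h2 _]]].
      have : 1 < degree T u.
        rewrite /degree (cardD1 v) (cardD1 a) !inE huv h2 adj_sym h1 /=.
        by [].
      by rewrite /T hd.
    have hc1 : #|[set x | rd_leaf D x == u]| <= 1.
      apply/card_le1_eqP => x y; rewrite !inE => /eqP <- /eqP h.
      by move: h => /rd_leaf_inj ->.
    have h1 : #|W :&: rd_side u v| <= 1.
      exact: leq_trans (subset_leq_card (subset_trans (subsetIr _ _) hsub)) hc1.
    by move: huvW; move: h1 hW; set a := #|_ :&: _|; lia.
  have hc2 : #|[set a | adj T u a] :\ v| = 2.
    have := cardsD1 v [set a | adj T u a]; rewrite inE huv /=.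
    have -> : #|[set a | adj T u a]| = 3 by rewrite cardsE; exact: hd.
    by rewrite add1n => -[].
  have /cards2P [a [b [hab E]]] : #|[set a | adj T u a] :\ v| == 2 by rewrite hc2.
  have nb c : (c == a) || (c == b) = adj T c u && (c != v).
    have : (c \in [set a | adj T u a] :\ v) = (c \in [set a; b]) by rewrite E.
    by rewrite !inE adj_sym andbC => ->.
  have /andP [ha1 ha2] : adj T a u && (a != v) by rewrite -nb eqxx.
  have /andP [hb1 hb2] : adj T b u && (b != v) by rewrite -nb eqxx orbT.
  have := small _ ha1 ha2; have := small _ hb1 hb2.
  suff : #|W :&: rd_side u v| <= #|W :&: rd_side a u| + #|W :&: rd_side b u|.
    by set p := #|_|; set q := #|_|; set s := #|_|; lia.
  apply: leq_trans (subset_leq_card _) (leq_card_setU _ _); rewrite -setIUr.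
  apply: setIS; apply/subsetP => x; rewrite in_setU !sideE => /(branch_split hT) [h|].
    have : degree T u = 1 by apply/rd_leaf_codom; exists x.
    by rewrite /T hd.
  move=> [c [h1 h2 h3]]; have : (c == a) || (c == b) by rewrite nb h1.
  by move=> /orP [] /eqP <-; rewrite h3 ?orbT.
have [B [h1 h2 h3]] : exists B : {set V}, [/\ B \subset rd_side u v, #|B| <= k &
    forall x y, x \in rd_side u v -> y \notin rd_side u v -> adj G x y ->
    exists2 b, b \in B & adj G b y].
  apply: cutrank_dominated; rewrite -(sideC u v huv); apply: leq_trans hk.
  exact: (@leq_bigmax_cond _ _ (fun uv => cutrank G (rd_side uv.1 uv.2) (rd_side uv.2 uv.1)) (u, v)).
exists (rd_side u v), B; split => //.
by rewrite setDE -(sideC u v huv).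
Qed.

(** Nodes have unbounded degree here, so the extremal choice is made among unions of branches: a
    node [t] and a set [J] of its neighbours, with at least a third of [W] in these branches outside
    the bag of [t], and with as few nodes as possible. If [J] has two elements, split off one of
    them: both parts are below a third. If it has one, move to that neighbour: all but one bag is
    below a third. *)
Lemma tree_decomposition_separated W (D : tree_decomposition G) b :
  (forall t : td_node D, #|td_bag t| <= b) -> 0 < #|W| -> 12 * b <= #|W| -> separated G W b.
Proof.
move=> hb hW hbW.
have ar1 m p q : m <= p + q -> 12 * q <= m -> m <= 3 * p by clear; lia.
have ar2 m p q : 3 * p <= m + 3 * b \/ 3 * p <= 2 * m -> m <= p + b + q ->
    12 * b <= m -> m <= 4 * q by clear; lia.
have ar3 m p q : p <= q + b -> 3 * q < m -> 3 * p <= m + 3 * b by clear; lia.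
have ar4 m p q r : p <= q + r -> 3 * q < m -> 3 * r < m -> 3 * p <= 2 * m.
  by clear; lia.
have ar5 m p : m <= 3 * p -> m <= 4 * p by clear; lia.
set T := td_tree D; have hT : is_tree T := td_treeP D.
pose N t (J : {set td_node D}) := \bigcup_(a in J) branch T a t.
pose X t (J : {set td_node D}) :=
  [set x | [exists s in N t J, x \in td_bag s]] :\: td_bag t.
have XP t (J : {set td_node D}) x : reflect (x \notin td_bag t /\ exists a s,
    [/\ a \in J, s \in branch T a t & x \in td_bag s]) (x \in X t J).
  rewrite !inE; apply: (iffP andP) => [[h1 /existsP [s /andP [/bigcupP [a h2 h3] h4]]]|].
    by split => //; exists a, s.
  move=> [h1 [a [s [h2 h3 h4]]]]; split => //; apply/existsP; exists s.
  by rewrite h4 andbT; apply/bigcupP; exists a.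
have XU t J1 J2 : X t (J1 :|: J2) \subset X t J1 :|: X t J2.
  apply/subsetP => x /XP [h1 [a [s [h2 h3 h4]]]]; rewrite in_setU.
  case/setUP: h2 => h2; apply/orP; [left|right]; apply/XP; split => //; by exists a, s.
pose nbs t := [set a | adj T a t].
have bagW (t : td_node D) : 12 * #|W :&: td_bag t| <= #|W|.
  apply: leq_trans hbW; rewrite leq_mul2l /=.
  exact: leq_trans (subset_leq_card (subsetIr _ _)) (hb t).
have inX (t s : td_node D) x : x \in td_bag s -> x \notin td_bag t -> x \in X t (nbs t).
  move=> hx hxt; apply/XP; split => //.
  have hst : s != t by apply: contraNneq hxt => <-.
  have [a h1 h2] := branch_exists hT hst; exists a, s; split => //; by rewrite inE.
pose Q (tJ : td_node D * {set td_node D}) :=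
  (tJ.2 \subset nbs tJ.1) && (#|W| <= 3 * #|W :&: X tJ.1 tJ.2|).
have [tJ0 Q0] : exists tJ, Q tJ.
  have /card_gt0P [t _] : 0 < #|td_node D| by case: hT.
  exists (t, nbs t); rewrite /Q /= subxx /=.
  apply: (ar1 _ _ #|W :&: td_bag t|); last exact: bagW.
  apply: leq_trans (subset_leq_card _) (leq_card_setU _ _); rewrite -setIUr.
  rewrite subsetIidl; apply/subsetP => x _; rewrite in_setU orbC.
  case: (boolP (x \in td_bag t)) => //= hxt; have [s hs] := td_vertex D x.
  exact: inX hs hxt.
have [[t J] /andP [/= hJ hJW] hmin] := arg_minnP (fun tJ => #|N tJ.1 tJ.2|) Q0.
have small t' (J' : {set td_node D}) : J' \subset nbs t' -> #|N t' J'| < #|N t J| ->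
    3 * #|W :&: X t' J'| < #|W|.
  move=> h1 h2; rewrite ltnNge; apply/negP => h.
  by have := hmin (t', J'); rewrite /Q /= h1 h leqNgt h2 => /(_ isT).
have adjJ a : a \in J -> adj T a t by move=> /(subsetP hJ); rewrite inE.
have key : #|W| <= 4 * #|W :\: (X t J :|: td_bag t)|.
  have hcard : #|W| <= #|W :&: X t J| + b + #|W :\: (X t J :|: td_bag t)|.
    rewrite -(cardsID (X t J :|: td_bag t) W) leq_add2r.
    rewrite setIUr; apply: leq_trans (leq_card_setU _ _) _; rewrite leq_add2l.
    exact: leq_trans (subset_leq_card (subsetIr _ _)) (hb t).
  apply: ar2 _ hcard hbW.
  have [J0|/set0Pn [a ha]] := eqVneq J set0.
    left; have -> : X t J = set0; last by rewrite setI0 cards0.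
    by apply/setP => x; rewrite in_set0; apply/negP => /XP [_ [a [s [h _ _]]]]; rewrite J0 inE in h.
  have hat := adjJ _ ha; have [Ja|/set0Pn [c hc]] := eqVneq (J :\ a) set0.
    (* At [a], all branches except the one towards [t]; the node [a] itself is no longer counted. *)
    have EJ : J = [set a] by rewrite -(setD1K ha) Ja setU0.
    left; pose J' := nbs a :\ t.
    have hlt : #|N a J'| < #|N t J|.
      apply: proper_card; apply/properP; split; last first.
        exists a; first by apply/bigcupP; exists a; rewrite ?branch_id.
        apply/negP => /bigcupP [e]; rewrite !inE => /andP [_ he] hae.
        by have := branchF hT he; rewrite inE hae.
      apply/bigcupsP => e; rewrite !inE => /andP [het he].
      by rewrite EJ /N big_set1; apply: branch_sub.
    apply: ar3 (small a J' (subsetDl _ _) hlt).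
      apply: leq_trans (leq_add (leqnn _) (hb a)).
      apply: leq_trans (subset_leq_card _) (leq_card_setU _ _).
      apply/subsetP => x /setIP [hxW /XP [h1 [a' [s [h2 h3 h4]]]]].
      rewrite in_setU in_setI hxW /=; case: (boolP (x \in td_bag a)) => hxa.
        by rewrite orbT.
      rewrite orbF; apply/XP; split => //.
      move: h2; rewrite EJ inE => /eqP Ea; rewrite Ea in h3.
      have [Es|[e [he1 he2 he3]]] := branch_split hT h3.
        by rewrite -Es h4 in hxa.
      by exists e, s; split => //; rewrite !inE he1 he2.
  right; have /setD1P [hca hcJ] := hc; have hct := adjJ _ hcJ.
  have hN (e : td_node D) (J1 : {set td_node D}) : e \in J -> J1 \subset J -> e \notin J1 ->
      #|N t J1| < #|N t J|.
    move=> he h1 h2; apply: proper_card; apply/properP; split.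
      apply/subsetP => y /bigcupP [g hg hy]; apply/bigcupP; exists g => //.
      exact: (subsetP h1).
    exists e; first by apply/bigcupP; exists e; rewrite ?branch_id.
    apply/negP => /bigcupP [g hg]; apply/negP.
    apply: (branches_disjoint hT (adjJ _ he) (adjJ _ (subsetP h1 _ hg))).
      by apply: contraNneq h2 => ->.
    exact: branch_id.
  have h1 : [set a] \subset J by rewrite sub1set.
  have h2 : J :\ a \subset J by apply: subsetDl.
  have s1 := small t _ (subset_trans h1 hJ) (hN c _ hcJ h1 _).
  have s2 := small t _ (subset_trans h2 hJ) (hN a _ ha h2 _).
  move: s1 s2; rewrite inE hca setD11 => /(_ isT) s1 /(_ isT) s2.
  apply: ar4 s1 s2.
    apply: leq_trans (subset_leq_card _) (leq_card_setU _ _); rewrite -setIUr.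
    by apply: setIS; rewrite -[in X in X \subset _](setD1K ha); apply: XU.
exists (X t J), (td_bag t); split => //.
- by rewrite -setI_eq0; apply/eqP/setP => x; rewrite !inE; case: (x \in td_bag t); rewrite ?andbF.
- move=> x y /XP [hxt [a [s [h1 h2 h3]]]] hyX hyt; apply/negP => hxy.
  have [s' /andP [hxs' hys']] := td_edge D hxy.
  case/negP: hyX; apply/XP; split => //; exists a, s'; split => //.
  have /connectP [p hp ->] := td_connected h3 hxs'.
  elim: p s h2 {h3} hp => //= s1 p IH s0 h2 /andP [/and3P [hss hx0 hx1] hp].
  apply: IH hp; apply: (branch_step h2 hss); apply/negP => /eqP E.
  have : t \in [set s0; s1] by rewrite E set22.
  by move=> /set2P [] Et; rewrite Et ?hx0 ?hx1 in hxt.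
- exact: ar5.

Qed.

Definition narrow k :=
  [|| rank_width G < k, clique_width G < k | tree_width G < k].

Lemma narrow_separated W k d z : thin G d z -> k <= d -> k <= z -> narrow k ->
  3 < #|W| -> 12 * z <= #|W| -> separated G W z.
Proof.
move=> ht hkd hkz hn hW hz.
have sep j : balanced_dominated G W j -> j < k -> separated G W z.
  move=> [X [B [h1 h2 h3 h4 h5]]] hj.
  apply: (dominated_separated h1 (leq_trans h2 (leq_trans (ltnW hj) hkd)) ht) => //.
have V0 : 0 < #|V| by apply: leq_trans (max_card (mem W)); apply: leq_trans hW.
have VT : [set: V] != set0 by rewrite -card_gt0 cardsT.
have hdec := dec_trivial G VT.
case/or3P: hn => hn.
- have V1 : (#|V| <= 1) = false.
    apply/negbTE; rewrite -ltnNge; apply: leq_trans (max_card (mem W)).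
    by apply: leq_trans hW.
  move: hn; rewrite /rank_width V1.
  have [F hF] := dec_laminar V0 hdec.
  have hT1 : 1 < #|[set: V]| by rewrite cardsT ltnNge V1.
  have [T1 [T2 [[h1 h2] h3 h4 _ h6]]] := lam_split hF (lam_top hF) hT1.
  have [D hD] := cubic_rank_decomposition hF h1 h2 h3 h4 h6.
  have [[D' <-] _] := minimumP (S := fun k => exists D, rd_width G D = k)
    (ex_intro _ D erefl).
  by move=> hlt; apply: sep hlt; apply: rank_decomposition_balanced hW.
- have : exists k' (e : cw_expression k'), cw_constructs e G.
    move: hdec V0; case: #|V| => // w hd _.
    have hl : {in boundary G setT &, injective (fun _ : V => @ord0 w)}.
      by move=> x y /boundaryP [_ [u]]; rewrite in_setT.
    have [t ht'] := constructible_setT (dec_constructible hd hl).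
    by exists w.+2, t.
  move=> [k' hk']; have [[e he] _] := minimumP (S := fun k =>
    exists e : cw_expression k, cw_constructs e G) hk'.
  exact: sep (cw_constructs_balanced he hW) hn.
- have [F hF] := dec_laminar V0 hdec.
  have [D hD] := lam_tree_decomposition hF V0.
  have [[D' E] _] := minimumP (S := fun k => exists D : tree_decomposition G, td_width D = k)
    (ex_intro _ D erefl).
  move: hn; rewrite /tree_width -E => hn.
  apply: (tree_decomposition_separated (D := D')) => //; last exact: leq_trans hW.
  move=> t; apply: leq_trans hkz; apply: leq_trans hn.
  by apply: leq_trans (leqSpred _); apply: leq_bigmax.
Qed.

End WidthSeparators.

(** * Random graphs *)

Local Open Scope ring_scope.

Section EdgeSums.
Variables (V : finType) (R : comNzRingType).
Implicit Types (G H : sgraph V) (e : {set V}) (A B : {set {set V}}).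

Lemma edges_card G e : e \in edges G -> #|e| == 2%N.
Proof. by move=> he; have /forallP/(_ e)/implyP/(_ he) := valP G. Qed.

Lemma edges_eq G H :
  (forall e, #|e| == 2%N -> (e \in edges G) = (e \in edges H)) -> G = H.
Proof.
move=> h; apply: val_inj; apply/setP => e.
have [he|he] := boolP (#|e| == 2%N); first exact: h.
by apply/idP/idP => /edges_card; rewrite (negbTE he).
Qed.

(** The distributive law for a product over the pairs of vertices. It is the independence of the
    edges, from which the exact formulas for G(n,p) follow. *)
Lemma sum_sgraph (a b : {set V} -> R) :
  \sum_(G : sgraph V) \prod_(e : {set V} | #|e| == 2%N) (if e \in edges G then a e else b e) =
  \prod_(e : {set V} | #|e| == 2%N) (a e + b e).
Proof.
(* With weight 0 when chosen and 1 otherwise, the sets that are not pairs remove exactly the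
   families that are not graphs. *)
pose a' e := if #|e| == 2%N then a e else 0.
pose b' e := if #|e| == 2%N then b e else 1.
have -> : \prod_(e : {set V} | #|e| == 2%N) (a e + b e) = \prod_e (a' e + b' e).
  rewrite big_mkcond /=; apply: eq_bigr => e _; rewrite /a' /b'.
  by case: ifP => // _; rewrite add0r.
rewrite bigA_distr (bigID (fun J : {set {set V}} => [forall e in J, #|e| == 2%N])) /=.
rewrite [X in _ = _ + X]big1 ?addr0 => [|J]; last first.
  rewrite negb_forall => /existsP [e]; rewrite negb_imply => /andP [heJ he].
  by rewrite (bigD1 e) //= heJ /a' (negbTE he) mul0r.
rewrite [RHS](reindex_omap (val : sgraph V -> _) insub) => [|J hJ]; last first.
  by rewrite insubT.
apply: eq_big => [G|G _].
  by rewrite valK eqxx andbT; apply/esym; exact: (valP G).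
rewrite big_mkcond /=; apply: eq_bigr => e _; rewrite /a' /b'.
case: ifP => [//|he]; rewrite ifN //; apply/negP => /edges_card.
by rewrite he.
Qed.

Lemma prod_bool (I : finType) (P : pred I) (f : pred I) :
  \prod_(i | P i) (f i)%:R = [forall (i | P i), f i]%:R :> R.
Proof.
have [/forallP h|] := boolP [forall (i | P i), f i].
  by rewrite big1 // => i hi; have := h i; rewrite hi /= => ->.
rewrite negb_forall => /existsP [i]; rewrite negb_imply => /andP [hi hf].
by rewrite (bigD1 i) //= (negbTE hf) mul0r.
Qed.

Definition gunion G H : sgraph V := rel_graph (fun x y => adj G x y || adj H x y).

Lemma adj_gunion G H x y : adj (gunion G H) x y = adj G x y || adj H x y.
Proof.
rewrite adj_rel_graph ![adj _ y x]adj_sym orbb.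
by case: (boolP (x != y)) => //= /negPn/eqP ->; apply/esym/negP => /orP [] /adj_neq;
  rewrite eqxx.
Qed.

Lemma edges_gunion G H : edges (gunion G H) = edges G :|: edges H.
Proof.
apply/setP => e; rewrite in_setU.
have [/cards2P [x [y [_ ->]]]|he] := boolP (#|e| == 2%N); first exact: adj_gunion.
by apply/idP/orP => [|[]] /edges_card; rewrite (negbTE he).
Qed.

Lemma gunion_eq G1 G2 H : (gunion G1 G2 == H)%:R =
  \prod_(e : {set V} | #|e| == 2%N)
    (((e \in edges G1) || (e \in edges G2)) == (e \in edges H))%:R :> R.
Proof.
rewrite prod_bool; congr (_%:R); congr nat_of_bool; apply/eqP/forallP => [<- e|h].
  by rewrite edges_gunion in_setU eqxx implybT.
by apply: edges_eq => e he; rewrite edges_gunion in_setU; apply/eqP; have := h e; rewrite he.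
Qed.

End EdgeSums.

Section Gnp.
Variables (R : realType) (n : nat).
Implicit Types (p : R) (G H : sgraph 'I_n) (A B : {set {set 'I_n}}).
Implicit Types (P Q : sgraph 'I_n -> Prop).

Lemma gnp_mass_ge0 p G : 0 <= p <= 1 -> 0 <= gnp_mass p G.
Proof.
move=> /andP [h0 h1]; apply: prodr_ge0 => e _.
by case: ifP => // _; rewrite subr_ge0.
Qed.

Lemma sum_gnp_mass p : \sum_(G : sgraph 'I_n) gnp_mass p G = 1.
Proof.
rewrite /gnp_mass (sum_sgraph (fun _ => p) (fun _ => 1 - p)).
by rewrite big1 // => e _; rewrite addrC subrK.
Qed.

Lemma gnp_probE p P : gnp_prob p P = \sum_G gnp_mass p G * `[< P G >]%:R.
Proof.
rewrite /gnp_prob big_mkcond; apply: eq_bigr => G _.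
by case: ifP => _; rewrite ?mulr1 ?mulr0.
Qed.

Lemma gnp_prob_le p P Q : 0 <= p <= 1 -> (forall G, P G -> Q G) ->
  gnp_prob p P <= gnp_prob p Q.
Proof.
move=> hp hPQ; rewrite !gnp_probE; apply: ler_sum => G _.
apply: ler_wpM2l; first exact: gnp_mass_ge0.
by rewrite ler_nat; case: asboolP => // /hPQ hQ; case: asboolP.
Qed.

Lemma gnp_prob_le1 p P : 0 <= p <= 1 -> gnp_prob p P <= 1.
Proof.
move=> hp; rewrite -(sum_gnp_mass p) gnp_probE; apply: ler_sum => G _.
rewrite -[leRHS]mulr1; apply: ler_wpM2l; first exact: gnp_mass_ge0.
by case: asboolP.
Qed.

Lemma gnp_prob_not p P : gnp_prob p P = 1 - gnp_prob p (fun G => ~ P G).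
Proof.
rewrite -(sum_gnp_mass p) !gnp_probE -sumrB; apply: eq_bigr => G _.
by rewrite asbool_neg; case: asboolP => _; rewrite /= ?mulr1 ?mulr0 ?subr0 ?subrr.
Qed.

Lemma gnp_prob_union (I : finType) (D : pred I) p P (Q : I -> sgraph 'I_n -> Prop) :
  0 <= p <= 1 -> (forall G, P G -> exists2 i, D i & Q i G) ->
  gnp_prob p P <= \sum_(i | D i) gnp_prob p (Q i).
Proof.
move=> hp h; under eq_bigr do rewrite gnp_probE.
rewrite gnp_probE exchange_big /=; apply: ler_sum => G _; rewrite -mulr_sumr.
apply: ler_wpM2l; first exact: gnp_mass_ge0.
case: asboolP => [/h [i hi hQ]|_]; last by apply: sumr_ge0.
by rewrite (bigD1 i) //= (asboolT hQ) lerDl sumr_ge0.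
Qed.

Lemma gnp_prob_union2 p P Q S : 0 <= p <= 1 -> (forall G, P G -> Q G \/ S G) ->
  gnp_prob p P <= gnp_prob p Q + gnp_prob p S.
Proof.
move=> hp h; rewrite !gnp_probE -big_split /=; apply: ler_sum => G _.
rewrite -mulrDr; apply: ler_wpM2l; first exact: gnp_mass_ge0.
case: asboolP => [/h [hQ|hS]|_]; last by rewrite addr_ge0.
  by rewrite (asboolT hQ) lerDl.
by rewrite (asboolT hS) lerDr.
Qed.

(** Giving weight 0 to absence on [A] and to presence on [B] makes the probability an instance of
    [sum_sgraph]. *)
Lemma gnp_prob_edges p A B : (forall e, e \in A -> #|e| == 2%N) ->
  (forall e, e \in B -> #|e| == 2%N) -> [disjoint A & B] ->
  gnp_prob p (fun G => A \subset edges G /\ [disjoint B & edges G]) =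
  p ^+ #|A| * (1 - p) ^+ #|B|.
Proof.
move=> hA hB hAB; pose a (e : {set 'I_n}) := if e \in B then 0 else p.
pose b (e : {set 'I_n}) := if e \in A then 0 else 1 - p.
have -> : gnp_prob p (fun G => A \subset edges G /\ [disjoint B & edges G]) =
    \sum_(G : sgraph 'I_n) \prod_(e : {set 'I_n} | #|e| == 2%N) (if e \in edges G then a e else b e).
  rewrite gnp_probE; apply: eq_bigr => G _; case: asboolP => [[h1 h2]|hn].
    rewrite mulr1; apply: eq_bigr => e _; rewrite /a /b.
    case: ifP => he; first by rewrite (disjointFl h2 he).
    by rewrite ifN //; apply/negP => /(subsetP h1); rewrite he.
  rewrite mulr0; apply/esym; have [h1|h1] := boolP (A \subset edges G); last first.
    have /subsetPn [e he heG] := h1.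
    by rewrite (bigD1 e) /= ?hA // (negbTE heG) /b he mul0r.
  have h2 : ~~ [disjoint B & edges G] by apply/negP => h2; apply: hn.
  have /pred0Pn [e /= /andP [he heG]] := h2.
  by rewrite (bigD1 e) /= ?hB // heG /a he mul0r.
rewrite sum_sgraph (bigID (fun e => e \in A)) /=; congr (_ * _).
  rewrite -prodr_const; apply: eq_big => [e|e /andP [_ he]].
    by apply: andb_idl; apply: hA.
  by rewrite /a /b he (disjointFr hAB he) addr0.
rewrite (bigID (fun e => e \in B)) /= [X in _ * X]big1 => [|e]; last first.
  by move=> /andP [/andP [_ h1] h2]; rewrite /a /b (negbTE h1) (negbTE h2) addrC subrK.
rewrite mulr1 -prodr_const; apply: eq_big => [e|e /andP [/andP [_ h1] h2]].
  apply/idP/idP => [/andP [] //|he]; rewrite he hB //= andbT.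
  by rewrite (disjointFl hAB he).
by rewrite /a /b h2 (negbTE h1) add0r.
Qed.

(** The union of independent copies of G(n,p) and G(n,q) is distributed as G(n, p + q - p q). For a
    fixed union [K], the event [gunion G H == K] is a product over pairs, so both sums factor and
    one identity per pair remains. *)
Lemma gnp_sprinkling p q (F : sgraph 'I_n -> R) :
  \sum_G gnp_mass p G * (\sum_H gnp_mass q H * F (gunion G H)) =
  \sum_G gnp_mass (p + q - p * q) G * F G.
Proof.
transitivity (\sum_K (\sum_G gnp_mass p G *
    (\sum_H gnp_mass q H * (gunion G H == K)%:R)) * F K).
  under [RHS]eq_bigr => K _ do rewrite mulr_suml.
  rewrite exchange_big /=; apply: eq_bigr => G _.
  under [RHS]eq_bigr => K _ do rewrite -mulrA mulr_suml.
  rewrite -mulr_sumr exchange_big /=; congr (_ * _); apply: eq_bigr => H _.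
  rewrite (bigD1 (gunion G H)) //= eqxx mulr1 big1 ?addr0 // => K hK.
  by rewrite eq_sym (negbTE hK) mulr0 mul0r.
apply: eq_bigr => K _; congr (_ * _).
pose g (e : {set 'I_n}) : R := (e \in edges K)%:R.
pose c (x : bool) (e : {set 'I_n}) : R := (x == (e \in edges K))%:R.
have inner G : \sum_H gnp_mass q H * (gunion G H == K)%:R =
    \prod_(e : {set 'I_n} | #|e| == 2%N) (q * g e + (1 - q) * c (e \in edges G) e).
  rewrite -sum_sgraph; apply: eq_bigr => H _; rewrite gunion_eq /gnp_mass -big_split /=.
  apply: eq_bigr => e _; rewrite /g /c; case: (e \in edges H); last by rewrite orbF.
  by rewrite orbT; case: (e \in edges K).
under eq_bigr => G _ do rewrite inner /gnp_mass -big_split /=.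
transitivity (\sum_(G : sgraph 'I_n) \prod_(e : {set 'I_n} | #|e| == 2%N)
    (if e \in edges G then p * (q * g e + (1 - q) * c true e)
     else (1 - p) * (q * g e + (1 - q) * c false e))).
  by apply: eq_bigr => G _; apply: eq_bigr => e _; case: (e \in edges G).
rewrite sum_sgraph; apply: eq_bigr => e _; rewrite /g /c.
by case: (e \in edges K) => /=; ring.
Qed.

End Gnp.

Lemma gnp_aas_bound (R : realType) (c C : R) (P : forall n, sgraph 'I_n -> Prop) N :
  0 <= c -> (forall n : nat, (N <= n)%N -> 0 < n%:R :> R -> c <= n%:R ->
    gnp_prob (c / n%:R) (fun G => ~ @P n G) <= C / n%:R) -> gnp_aas c P.
Proof.
move=> hc h; rewrite /gnp_aas; apply/cvgrPdist_le => e he.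
exists (maxn (maxn N 1) (maxn (Num.bound c) (Num.bound (`|C| / e)))) => // n /=.
rewrite !geq_max => /andP [/andP [hN hn1] /andP [hnc hnC]].
have n0 : 0 < n%:R :> R by rewrite ltr0n.
have cn : c <= n%:R.
  by apply: ltW; apply: lt_le_trans (archi_boundP hc) _; rewrite ler_nat.
have hp : 0 <= c / n%:R <= 1.
  by rewrite divr_ge0 ?(ltW n0) //= ler_pdivrMr // mul1r.
rewrite ger0_norm ?subr_ge0 ?gnp_prob_le1 // gnp_prob_not opprB addrC subrK.
apply: le_trans (h n hN n0 cn) _; rewrite ler_pdivrMr //.
apply: le_trans (ler_norm _) _; rewrite -ler_pdivrMl // mulrC.
apply: ltW; apply: lt_le_trans (archi_boundP _) _; last by rewrite ler_nat.
by rewrite divr_ge0 // ltW.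
Qed.

(** * The subcritical case *)

Lemma sum_square_geometric (R : realType) (c : R) : 0 <= c < 1 ->
  exists M : R, 0 <= M /\ forall N, \sum_(k < N) (k%:R ^+ 2 * c ^+ k) <= M.
Proof.
move=> /andP [h0 h1]; have hd : 0 < 1 - c by rewrite subr_gt0.
pose t := (1 - c)^-1; have ht : 0 < t by rewrite invr_gt0.
have tE : t * (1 - c) = 1 by rewrite mulVf // gt_eqF.
have pow N : 0 <= c ^+ N by rewrite exprn_ge0.
exists (2 * t * (6 * t) ^+ 2); split; first by rewrite mulr_ge0 ?sqr_ge0 ?mulr_ge0 ?ltW.
(* Telescoping: at each step the subtracted term decreases by at least [N%:R ^+ 2 * c ^+ N]. The
   shift [6 * t] is large enough for this from [N = 0] on. *)
move=> N; suff : \sum_(k < N) (k%:R ^+ 2 * c ^+ k) <=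
    2 * t * (6 * t) ^+ 2 - 2 * t * (N%:R + 6 * t) ^+ 2 * c ^+ N.
  move=> h; apply: le_trans h _; rewrite gerBl mulr_ge0 ?pow // mulr_ge0 ?sqr_ge0 //.
  by rewrite mulr_ge0 ?ltW.
elim: N => [|N IH]; first by rewrite big_ord0 expr0 mulr1 add0r subrr.
rewrite big_ord_recr /=; apply: le_trans (lerD IH (lexx _)) _.
rewrite -subr_ge0 [c ^+ N.+1]exprS -[N.+1%:R]natr1; set m : R := N%:R.
have hm : 0 <= m by rewrite ler0n.
have -> : 2 * t * (6 * t) ^+ 2 - 2 * t * (m + 1 + 6 * t) ^+ 2 * (c * c ^+ N) -
    (2 * t * (6 * t) ^+ 2 - 2 * t * (m + 6 * t) ^+ 2 * c ^+ N + m ^+ 2 * c ^+ N) =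
    c ^+ N * (2 * (t * (1 - c)) * (m + 6 * t + 1) ^+ 2 - 2 * t * (2 * (m + 6 * t) + 1) - m ^+ 2).
  by ring.
rewrite tE; apply: mulr_ge0 => //; nra.
Qed.

(** There are at most n^k * k^2 candidates on [k] vertices, each requiring k + 1 distinct edges, and
    n^k * k^2 * (c / n)^(k + 1) = (c / n) * k^2 * c^k: the surplus edge gives the factor 1/n. *)
Lemma gnp_bad_path (R : realType) (c : R) n : 0 <= c -> 0 < n%:R :> R -> c <= n%:R ->
  gnp_prob (c / n%:R) (fun G : sgraph 'I_n => exists u, bad_path G u) <=
  c / n%:R * \sum_(k < n.+1) (k%:R ^+ 2 * c ^+ k).
Proof.
move=> hc n0 hcn; set p := c / n%:R.
have hp : 0 <= p <= 1.
  by rewrite divr_ge0 ?(ltW n0) //= ler_pdivrMr // mul1r.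
have hn : (0 < n)%N by rewrite -(ltr0n R).
pose x0 : 'I_n := Ordinal hn.
pose Q (k : 'I_n.+1) (q : k.-tuple 'I_n * ('I_k * 'I_k)) (G : sgraph 'I_n) :=
  pair_edges x0 q.1 (path_pairs k q.2.1 q.2.2) \subset edges G.
have h1 : gnp_prob p (fun G : sgraph 'I_n => exists u, bad_path G u) <=
    \sum_(k < n.+1 | true) gnp_prob p (fun G => exists2 q, bad_indices (q : k.-tuple 'I_n * ('I_k * 'I_k)).1 q.2.1 q.2.2 & Q k q G).
  apply: gnp_prob_union => // G [u /(bad_path_edges x0) [i [j [hb hs]]]].
  have hu : (size u < n.+1)%N.
    case/and4P: hb => hu _ _ _; rewrite ltnS -(card_uniqP hu).
    by apply: leq_trans (max_card _) _; rewrite card_ord.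
  have hi : (i < size u)%N by case/and4P: hb => _ /andP [].
  have hj : (j < size u)%N by case/and4P: hb => _ _ hj _; exact: leq_trans (leqW (leqW (leqnn _))) hj.
  by exists (Ordinal hu) => //; exists (in_tuple u, (Ordinal hi, Ordinal hj)).
apply: le_trans h1 _; rewrite mulr_sumr; apply: ler_sum => k _.
have h2 : gnp_prob p (fun G => exists2 q, bad_indices (q : k.-tuple 'I_n * ('I_k * 'I_k)).1 q.2.1 q.2.2 & Q k q G) <=
    \sum_(q | bad_indices (q : k.-tuple 'I_n * ('I_k * 'I_k)).1 q.2.1 q.2.2) gnp_prob p (Q k q).
  exact: gnp_prob_union.
apply: le_trans h2 _.
have h3 q : bad_indices (q : k.-tuple 'I_n * ('I_k * 'I_k)).1 q.2.1 q.2.2 ->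
    gnp_prob p (Q k q) <= p ^+ k.+1.
  case: q => u [i j] /= hb; rewrite /Q /=.
  have sz : size u = k by rewrite size_tuple.
  have hlt := path_pairs_ltn hb; have hun := path_pairs_uniq hb.
  have hsz := size_path_pairs hb; rewrite sz in hlt hun hsz.
  have hu : uniq u by case/and4P: hb.
  set A := pair_edges _ _ _.
  have hA : #|A| = k.+1 by rewrite card_pair_edges ?sz.
  apply: le_trans (_ : gnp_prob p (fun G => A \subset edges G /\ [disjoint set0 & edges G]) <= _).
    by apply: gnp_prob_le => // G h; split => //; rewrite -setI_eq0 set0I.
  rewrite gnp_prob_edges ?cards0 ?expr0 ?mulr1 ?hA //.
  - by move=> e; apply: pair_edges_card2 => //; rewrite sz.
  - by move=> e; rewrite inE.
  - by rewrite -setI_eq0 setI0.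
apply: le_trans (ler_sum _ h3) _.
apply: le_trans (_ : \sum_(q : k.-tuple 'I_n * ('I_k * 'I_k)) p ^+ k.+1 <= _).
  by rewrite big_mkcond; apply: ler_sum => q _; case: ifP => // _; rewrite exprn_ge0 //; case/andP: hp.
have -> : \sum_(q : k.-tuple 'I_n * ('I_k * 'I_k)) p ^+ k.+1 =
    (n ^ k * (k * k))%:R * p ^+ k.+1.
  by rewrite sumr_const mulr_natl !card_prod card_tuple !card_ord.
rewrite !natrM natrX /p.
rewrite [(c / n%:R) ^+ k.+1]exprS exprMn.
have hnk : n%:R ^+ k * n%:R^-1 ^+ k = 1 :> R.
  by rewrite -exprMn divff ?expr1n // gt_eqF.
rewrite expr2 le_eqVlt; apply/orP; left; apply/eqP.
transitivity ((n%:R ^+ k * n%:R^-1 ^+ k) * (c / n%:R * (k%:R * k%:R * c ^+ k)) : R).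
  by ring.
by rewrite hnk mul1r.
Qed.

Lemma gnp_subcritical (R : realType) (c : R) : 0 <= c -> c < 1 ->
  gnp_aas c (fun n (G : sgraph 'I_n) =>
    [/\ (rank_width G <= 2)%N, (tree_width G <= 2)%N & (clique_width G <= 5)%N]).
Proof.
move=> h0 h1; have [M [M0 hM]] : exists M : R, 0 <= M /\
    forall N, \sum_(k < N) (k%:R ^+ 2 * c ^+ k) <= M.
  by apply: sum_square_geometric; rewrite h0.
apply: (@gnp_aas_bound R c (c * M) _ 0) => // n _ n0 hcn.
have hp : 0 <= c / n%:R <= 1.
  by rewrite divr_ge0 ?(ltW n0) //= ler_pdivrMr // mul1r.
have hn : (0 < n)%N by rewrite -(ltr0n R).
apply: le_trans (_ : gnp_prob (c / n%:R) (fun G : sgraph 'I_n => exists u, bad_path G u) <= _).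
  apply: gnp_prob_le => // G hG; apply/not_existsP => hb; apply: hG.
  have hd : dec G 2 3 setT by apply: no_bad_path_dec; rewrite ?card_ord.
  split.
  - exact: dec_rank_width hd.
  - exact: (dec_tree_width _ _ hd).
  (* Only 4 labels are used: three for boundary vertices and one for finished ones. *)
  - by apply: leq_trans (dec_clique_width _ hd) _.
apply: le_trans (gnp_bad_path h0 n0 hcn) _.
rewrite mulrAC; apply: ler_wpM2r; first by rewrite invr_ge0 ltW.
by apply: ler_wpM2l.
Qed.

(** * Exponential estimates *)

Section ExpBounds.
Variable R : realType.
Implicit Types x a : R.

Lemma expr_fact_le_expR x k : 0 <= x -> x ^+ k / k`!%:R <= expR x.
Proof.
move=> hx; case: k => [|k]; last first.
  by apply: le_trans (expR_ge1Dxn k hx); rewrite lerDr.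
by rewrite expr0 divr1; apply: le_trans (expR_ge1Dx x); rewrite lerDl.
Qed.

Lemma natX2_le_expR k : (2 ^ k)%:R <= expR (k%:R) :> R.
Proof.
rewrite -[k%:R]mulr1 expRM_natl natrX; apply: lerXn2r; rewrite ?nnegrE ?expR_ge0 //.
exact: (expR_ge1Dx 1).
Qed.

Lemma expR_decay a (n : nat) : 0 < a -> (0 < n)%N ->
  n%:R * expR (- (a * n%:R)) <= 2 / a ^+ 2 / n%:R.
Proof.
move=> ha hn; have n0 : 0 < n%:R :> R by rewrite ltr0n.
have h : 1 + (a * n%:R) ^+ 2 / 2 <= expR (a * n%:R).
  by apply: (expR_ge1Dxn 1); rewrite mulr_ge0 ?ltW.
rewrite expRN ler_pdivrMr ?expR_gt0 //; apply: le_trans (_ : 2 / a ^+ 2 / n%:R * ((a * n%:R) ^+ 2 / 2) <= _).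
  rewrite le_eqVlt; apply/orP; left; apply/eqP; field.
  by rewrite !gt_eqF.
apply: ler_wpM2l; first by rewrite !divr_ge0 ?sqr_ge0 ?ltW.
by apply: le_trans h; rewrite lerDr.
Qed.

Lemma one_sub_expR x k : x <= 1 -> (1 - x) ^+ k <= expR (- (x * k%:R)).
Proof.
move=> hx; rewrite -mulNr expRM_natr; apply: lerXn2r; rewrite ?nnegrE ?expR_ge0 //.
  by rewrite subr_ge0.
by have := expR_ge1Dx (- x).
Qed.

End ExpBounds.

Lemma card_sets_ge (R : realType) (T : finType) (x : R) (P : pred {set T}) :
  0 <= x -> \sum_(Z : {set T} | P Z) x ^+ #|Z| <= (x + 1) ^+ #|T|.
Proof.
move=> hx; have -> : (x + 1) ^+ #|T| = \sum_(Z : {set T}) x ^+ #|Z|.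
  rewrite -prodr_const bigA_distr; apply: eq_bigr => Z _.
  by rewrite -big_mkcond /= prodr_const.
rewrite [leRHS](bigID P) /= lerDl; apply: sumr_ge0 => Z _.
by rewrite exprn_ge0.
Qed.

(** Exponential weighting: each set counted has exp(y * z) * exp(- y * #|Z|) >= 1, and the sum of
    exp(- y * #|Z|) over all sets is (1 + exp(- y))^N with [N = #|T|]. A large [y] with a small [z]
    makes the number of sets exp(small * N). *)
Lemma card_small_sets (R : realType) (T : finType) (z : nat) (y : R) : 0 <= y ->
  #|[set Z : {set T} | #|Z| <= z]%N|%:R <= expR (y * z%:R + expR (- y) * #|T|%:R).
Proof.
move=> hy; rewrite -sum1_card natr_sum expRD.
apply: le_trans (_ : expR (y * z%:R) * \sum_(Z : {set T} | (#|Z| <= z)%N) expR (- y) ^+ #|Z| <= _).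
  rewrite mulr_sumr big_set /=; apply: ler_sum => Z hZ.
  rewrite -expRM_natr -expRD mulNr -mulrBr.
  apply: le_trans (expR_ge1Dx _); rewrite lerDl mulr_ge0 // subr_ge0 ler_nat //.
apply: ler_wpM2l; first exact: expR_ge0.
apply: le_trans (card_sets_ge _ (expR_ge0 _)) _; rewrite expRM_natr.
apply: lerXn2r; rewrite ?nnegrE ?addr_ge0 ?expR_ge0 //.
by rewrite addrC expR_ge1Dx.
Qed.

(** * First moment bounds for neighbourhoods and forests *)

Section RandomGraph.
Variables (R : realType) (n : nat).
Implicit Types (p : R) (G H : sgraph 'I_n) (A B S W X Y Z : {set 'I_n}).

Lemma mem_pffun_on (x0 : 'I_n) A B (g : 'I_n -> 'I_n) :
  (forall y, y \in A -> g y \in B) ->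
  [ffun y => if y \in A then g y else x0] \in pffun_on x0 (mem A) (mem B).
Proof.
move=> h; apply/pffun_onP; split.
  by apply/subsetP => y; rewrite !inE ffunE; case: ifP => //; rewrite eqxx.
move=> _ /imageP [y hy ->]; rewrite ffunE; have hy' : y \in A by [].
by rewrite hy'; apply: h.
Qed.

(** Union bound over the maps choosing a neighbour in [B] for each vertex of [A]; the sets being
    disjoint, the chosen edges are distinct. *)
Lemma gnp_neighbours p A B : 0 <= p <= 1 -> [disjoint A & B] ->
  gnp_prob p (fun G => forall y, y \in A -> exists2 x, x \in B & adj G x y) <=
  (#|B|%:R * p) ^+ #|A|.
Proof.
move=> hp hAB; have [->|/set0Pn [x0 hx0]] := eqVneq A set0.
  by rewrite cards0 expr0 gnp_prob_le1.
pose E (g : {ffun 'I_n -> 'I_n}) := [set [set y; g y] | y in A].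
apply: le_trans (_ : \sum_(g in pffun_on x0 (mem A) (mem B)) p ^+ #|A| <= _); last first.
  have -> : \sum_(g in pffun_on x0 (mem A) (mem B)) p ^+ #|A| =
      (#|B| ^ #|A|)%:R * p ^+ #|A| by rewrite sumr_const card_pffun_on mulr_natl.
  by rewrite natrX exprMn.
apply: le_trans (_ : \sum_(g in pffun_on x0 (mem A) (mem B))
  gnp_prob p (fun G => E g \subset edges G /\ [disjoint set0 & edges G]) <= _).
  apply: gnp_prob_union => // G hG.
  pose g y := odflt x0 [pick x | (x \in B) && adj G x y].
  have gP y : y \in A -> (g y \in B) && adj G (g y) y.
    move=> /hG [x hx hxy]; rewrite /g; case: pickP => //= /(_ x).
    by rewrite hx hxy.
  exists [ffun y => if y \in A then g y else x0].
    by apply: mem_pffun_on => y /gP /andP [].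
  split; last by rewrite -setI_eq0 set0I.
  apply/subsetP => _ /imsetP [y hy ->]; rewrite ffunE hy setUC.
  by have /andP [] := gP y hy.
apply: ler_sum => g /pffun_onP [_ hg].
have gB y : y \in A -> g y \in B.
  by move=> hy; apply: hg; apply/imageP; exists y.
have gA y : y \in A -> g y \notin A.
  by move=> /gB h; rewrite (disjointFl hAB h).
rewrite gnp_prob_edges ?cards0 ?mulr1.
- rewrite card_in_imset // => y y' hy hy' /set2_inj [[]//|[E1 E2]].
  by have := gA _ hy'; rewrite -E1 hy.
- move=> _ /imsetP [y hy ->]; rewrite cards2.
  by case: (eqVneq y (g y)) => // E1; have := gA _ hy; rewrite -E1 hy.
- by move=> e; rewrite inE.
- by rewrite -setI_eq0 setI0.
Qed.

(** A set and [b.+1] or more neighbours of it: each such pair has probability at most exp(- 3 /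
    delta)^(delta * n) = exp(- 3 * n), and there are at most 4^n <= exp(2 * n) pairs. *)
Lemma gnp_not_thin (c delta : R) (a b : nat) : 0 <= c -> 0 < delta -> (0 < n)%N ->
  c <= n%:R -> a%:R <= expR (- (3 / delta)) / (c + 1) * n%:R ->
  delta * n%:R <= b.+1%:R ->
  gnp_prob (c / n%:R) (fun G => ~ thin G a b) <= expR (- n%:R).
Proof.
move=> hc hd hn hcn ha hb; have n0 : 0 < n%:R :> R by rewrite ltr0n.
set p := c / n%:R; have hp : 0 <= p <= 1.
  by rewrite divr_ge0 ?(ltW n0) //= ler_pdivrMr // mul1r.
have hp0 : 0 <= p by case/andP: hp.
have c1 : 0 < c + 1 by rewrite ltr_wpDl.
pose good (q : {set 'I_n} * {set 'I_n}) :=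
  [&& #|q.1| <= a, b < #|q.2| & [disjoint q.2 & q.1]]%N.
apply: le_trans (_ : \sum_(q | good q) gnp_prob p
  (fun G => forall y, y \in q.2 -> exists2 x, x \in q.1 & adj G x y) <= _).
  apply: gnp_prob_union => // G hG.
  have [B [hB hN]] : exists B, (#|B| <= a)%N /\ (b < #|neighbours G B|)%N.
    apply: contrapT => h; apply: hG => B hB; rewrite leqNgt; apply/negP => hN.
    by apply: h; exists B.
  exists (B, neighbours G B); rewrite /good /= ?hB ?hN /=.
    rewrite -setI_eq0; apply/eqP/setP => x; rewrite !inE.
    by case: (x \in B); rewrite ?andbF.
  by move=> y; rewrite inE => /andP [_ /existsP [x /andP [? ?]]]; exists x.
apply: le_trans (_ : \sum_(q : {set 'I_n} * {set 'I_n}) expR (- (3 * n%:R)) <= _).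
  rewrite [leLHS]big_mkcond; apply: ler_sum => -[B A] _; rewrite /good /=.
  case: ifP => [/and3P [h1 h2 h3]|_]; last exact: expR_ge0.
  apply: le_trans (gnp_neighbours hp h3) _.
  have hBp : #|B|%:R * p <= expR (- (3 / delta)).
    apply: le_trans (_ : a%:R * p <= _).
      by apply: ler_wpM2r => //; rewrite ler_nat.
    apply: le_trans (_ : expR (- (3 / delta)) / (c + 1) * n%:R * p <= _).
      exact: ler_wpM2r.
    rewrite /p -mulrA [n%:R * _]mulrC divfK ?gt_eqF // mulrAC -mulrA.
    rewrite -[leRHS]mulr1; apply: ler_wpM2l; first exact: expR_ge0.
    by rewrite ler_pdivrMr // mul1r lerDl.
  apply: le_trans (_ : expR (- (3 / delta)) ^+ #|A| <= _).
    apply: lerXn2r => //; rewrite nnegrE; last exact: expR_ge0.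
    exact: mulr_ge0 (ler0n _ _) hp0.
  rewrite -expRM_natr ler_expR mulNr lerN2.
  have hA : delta * n%:R <= #|A|%:R by apply: le_trans hb _; rewrite ler_nat.
  apply: le_trans (_ : 3 / delta * (delta * n%:R) <= _).
    by rewrite mulrA divfK // gt_eqF.
  by apply: ler_wpM2l hA; rewrite divr_ge0 // ltW.
have card_sets : #|{set 'I_n}| = (2 ^ n)%N.
  by rewrite -cardsT -powersetT card_powerset cardsT card_ord.
have -> : \sum_(q : {set 'I_n} * {set 'I_n}) expR (- (3 * n%:R)) =
    (2 ^ n * 2 ^ n)%:R * expR (- (3 * n%:R)) :> R.
  by rewrite sumr_const card_prod card_sets [RHS]mulr_natl.
rewrite natrM; apply: le_trans (_ : expR n%:R * expR n%:R * expR (- (3 * n%:R)) <= _).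
  apply: ler_wpM2r; first exact: expR_ge0.
  by apply: ler_pM; rewrite ?ler0n ?natX2_le_expR.
by rewrite -!expRD ler_expR le_eqVlt; apply/orP; left; apply/eqP; ring.
Qed.

(** A spanning forest of [S] with roots [A], given by its parent map; the strictly decreasing [d]
    excludes cycles. *)
Definition forest G A S (f : 'I_n -> 'I_n) (d : 'I_n -> nat) : Prop :=
  A \subset S /\ forall x, x \in S -> x \notin A ->
    [/\ f x \in S, adj G x (f x) & (d (f x) < d x)%N].

(** In a largest [S] carrying a forest, an edge leaving [S] would allow its outer end to be added,
    with a larger value of [d]. *)
Lemma closed_forest G A : exists S f d, forest G A S f d /\
  forall x y, x \in S -> y \notin S -> ~~ adj G x y.
Proof.
pose Q S := `[< exists f d, forest G A S f d >].
have QA : Q A.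
  by apply/asboolP; exists id, (fun _ => 0%N); split => // x ->.
have [S /asboolP [f [d [hA hf]]] hmax] := arg_maxnP (fun S => #|S|) QA.
exists S, f, d; split => // x y hx hy; apply/negP => hxy.
have := hmax (y |: S); rewrite cardsU1 hy /= ltnn => H; suff /H : Q (y |: S) by [].
pose m := (\max_(z : 'I_n) d z)%N.
apply/asboolP; exists (fun z => if z == y then x else f z), (fun z => if z == y then m.+1 else d z).
have xy : x == y = false by apply: contraNF hy => /eqP <-.
split; first by apply: subset_trans hA (subsetUr _ _).
move=> z; rewrite in_setU1; have [-> _ _|_ /= hz hzA] := eqVneq z y.
  by rewrite in_setU1 hx orbT adj_sym hxy xy ltnS; split => //; apply: leq_bigmax.
have [h1 h2 h3] := hf _ hz hzA; rewrite in_setU1 h1 orbT h2; split => //.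
by rewrite ifN //; apply: contraNneq hy => <-.
Qed.

Definition cut_edges X Y : {set {set 'I_n}} := [set [set q.1; q.2] | q in setX X Y].

Lemma card_cut_edges X Y : [disjoint X & Y] -> #|cut_edges X Y| = (#|X| * #|Y|)%N.
Proof.
move=> hXY; rewrite card_in_imset; first by rewrite cardsX.
move=> [x y] [x' y'] /setXP [/= h1 h2] /setXP [/= h3 h4].
move=> /set2_inj [[-> -> //]|[E1 _]].
by have := disjointFr hXY h1; rewrite E1 h4.
Qed.

Lemma cut_edges_card2 X Y e : [disjoint X & Y] -> e \in cut_edges X Y -> #|e| == 2%N.
Proof.
move=> hXY /imsetP [[x y] /setXP [/= hx hy] ->]; rewrite cards2.
by case: (eqVneq x y) => // E1; have := disjointFr hXY hx; rewrite E1 hy.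
Qed.

Lemma cut_edges_disjoint G X Y :
  (forall x y, x \in X -> y \in Y -> ~~ adj G x y) -> [disjoint cut_edges X Y & edges G].
Proof.
move=> h; rewrite -setI_eq0; apply/eqP/setP => e; rewrite in_set0 in_setI; apply/negP.
by move=> /andP [/imsetP [[x y] /setXP [/= hx hy] ->]]; apply/negP; apply: h.
Qed.

(** Union bound over the parent maps from [S :\: A] to [S]. Each requires one edge per vertex of
    [S :\: A], distinct because [d] decreases, and the absence of all the edges leaving [S]. *)
Lemma gnp_forest_closed p A S : 0 <= p <= 1 -> A \subset S ->
  gnp_prob p (fun G => exists f d, forest G A S f d /\
    forall x y, x \in S -> y \notin S -> ~~ adj G x y) <=
  (#|S|%:R * p) ^+ (#|S| - #|A|) * expR (- (p * (#|S| * (n - #|S|))%:R)).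
Proof.
move=> hp hAS; have [hp0 hp1] := andP hp; have [S0|/set0Pn [x0 hx0]] := eqVneq S set0.
  by rewrite S0 cards0 sub0n expr0 mul0n mulr0 oppr0 expR0 mulr1 gnp_prob_le1.
set k := (#|S| - #|A|)%N; pose T := S :\: A.
have hT : #|T| = k by rewrite cardsD (setIidPr hAS).
pose E (g : {ffun 'I_n -> 'I_n}) := [set [set x; g x] | x in T].
pose B := cut_edges S (~: S).
have hSC : [disjoint S & ~: S] by rewrite -setI_eq0 setICr.
have hB : #|B| = (#|S| * (n - #|S|))%N.
  by rewrite card_cut_edges // [#|~: S|]cardsCs setCK card_ord.
pose good (g : {ffun 'I_n -> 'I_n}) :=
  [&& g \in pffun_on x0 (mem T) (mem S), #|E g| == k & [forall e in E g, #|e| == 2%N]].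
apply: le_trans (_ : \sum_(g | good g)
  gnp_prob p (fun G => E g \subset edges G /\ [disjoint B & edges G]) <= _).
  apply: gnp_prob_union => // G [f [d [[_ hf] hc]]].
  have fT x : x \in T -> [/\ f x \in S, adj G x (f x) & (d (f x) < d x)%N].
    by rewrite inE => /andP [h1 h2]; apply: hf.
  have imE : E [ffun x => if x \in T then f x else x0] = [set [set x; f x] | x in T].
    by apply: eq_in_imset => x hx; rewrite ffunE hx.
  exists [ffun x => if x \in T then f x else x0]; last first.
    rewrite imE; split.
      by apply/subsetP => _ /imsetP [x /fT [_ h _] ->].
    by apply: cut_edges_disjoint => x y hx; rewrite inE => hy; apply: hc.
  rewrite /good mem_pffun_on /=; last by move=> y /fT [].
  rewrite imE -hT; apply/andP; split.
    rewrite card_in_imset // => x y hx hy /set2_inj [[]//|[E1 E2]].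
    have [_ _ h1] := fT _ hx; have [_ _ h2] := fT _ hy.
    by rewrite -E1 in h2; rewrite E2 in h1; have := ltn_trans h1 h2; rewrite ltnn.
  apply/forallP => e; apply/implyP => /imsetP [x /fT [_ h _] ->].
  by rewrite cards2 (adj_neq h).
apply: le_trans (_ : \sum_(g in pffun_on x0 (mem T) (mem S)) p ^+ k *
  expR (- (p * (#|S| * (n - #|S|))%:R)) <= _); last first.
  have -> : \sum_(g in pffun_on x0 (mem T) (mem S)) p ^+ k *
      expR (- (p * (#|S| * (n - #|S|))%:R)) =
      (#|S| ^ #|T|)%:R * (p ^+ k * expR (- (p * (#|S| * (n - #|S|))%:R))).
    by rewrite sumr_const card_pffun_on mulr_natl.
  by rewrite hT natrX exprMn mulrA.
rewrite [leRHS](bigID (fun g => (#|E g| == k) && [forall e in E g, #|e| == 2%N])) /=.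
apply: le_trans (_ : _ <= \sum_(g | good g) p ^+ k *
    expR (- (p * (#|S| * (n - #|S|))%:R))) _; last first.
  rewrite lerDl; apply: sumr_ge0 => g _.
  by apply: mulr_ge0; rewrite ?expR_ge0 // exprn_ge0.
apply: ler_sum => g /and3P [/pffun_onP [_ hg] /eqP hk /forallP he].
rewrite gnp_prob_edges.
- by rewrite hk hB ler_wpM2l ?exprn_ge0 // one_sub_expR.
- by move=> e /(implyP (he e)).
- by move=> e; apply: cut_edges_card2.
- rewrite -setI_eq0; apply/eqP/setP => e; rewrite in_set0 in_setI; apply/negP.
  move=> /andP [/imsetP [x hx ->] /imsetP [[y z]]].
  rewrite !inE /= => /andP [hy hz] /set2_inj E1.
  have hxS : x \in S by move: hx; rewrite inE => /andP [].
  have hgS : g x \in S by apply: hg; apply/imageP; exists x.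
  by case: E1 => [[_ E1]|[E1 _]]; rewrite -E1 ?hgS ?hxS in hz.
Qed.

Lemma card_supersets A s : (#|A| <= s)%N ->
  #|[set S : {set 'I_n} | (A \subset S) && (#|S| == s)]|%:R <= n%:R ^+ (s - #|A|) / (s - #|A|)`!%:R :> R.
Proof.
move=> hs; set k := (s - #|A|)%N; have k0 : 0 < k`!%:R :> R by rewrite ltr0n fact_gt0.
rewrite ler_pdivlMr // -natrM -natrX ler_nat.
have h : (#|[set S : {set 'I_n} | (A \subset S) && (#|S| == s)]| <= 'C(#|~: A|, k))%N.
  rewrite -cards_draws -(card_in_imset (f := fun S => S :\: A)).
    apply: subset_leq_card; apply/subsetP => Y /imsetP [S].
    rewrite inE => /andP [h1 /eqP h2] ->; rewrite inE cardsD (setIidPr h1) h2 eqxx andbT.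
    by rewrite setDE subsetIr.
  move=> S S'; rewrite !inE => /andP [h1 _] /andP [h2 _] E1.
  by rewrite -(setID S A) -(setID S' A) E1 (setIidPr h1) (setIidPr h2).
apply: leq_trans (leq_mul h (leqnn _)) _; rewrite bin_ffact.
have ff m j : (m ^_ j <= m ^ j)%N.
  by elim: j => // j IH; rewrite ffactnSr expnSr; apply: leq_mul => //; apply: leq_subr.
apply: leq_trans (ff _ _) _; have [->|k1] := posnP k; first by rewrite !expn0.
rewrite leq_exp2r //; by apply: leq_trans (max_card _) _; rewrite card_ord.
Qed.

(** Let s = #|S| and k = s - #|A|. There are at most n^k / k! such sets, each with probability at
    most (s * c / n)^k * exp(- c * s * (1 - s / n)). As s^k / k! <= exp(s) and [1 <= c], the total
    is at most (c * exp(1 - c * (1 - sigma)))^s <= exp(- eta * s), where s >= #|A|. The factor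
    [n.+1] counts the sizes s. *)
Lemma gnp_small_forest (c sigma eta : R) A : 1 <= c -> (0 < n)%N -> c <= n%:R ->
  0 <= eta -> c <= expR (c - 1 - c * sigma - eta) ->
  gnp_prob (c / n%:R) (fun G => exists S f d, [/\ forest G A S f d,
    forall x y, x \in S -> y \notin S -> ~~ adj G x y & #|S|%:R <= sigma * n%:R]) <=
  n.+1%:R * expR (- (eta * #|A|%:R)).
Proof.
move=> hc hn hcn heta hq; have n0 : 0 < n%:R :> R by rewrite ltr0n.
have c0 : 0 <= c by apply: le_trans hc.
set p := c / n%:R; have hp : 0 <= p <= 1.
  by rewrite divr_ge0 ?(ltW n0) //= ler_pdivrMr // mul1r.
have hp0 : 0 <= p by case/andP: hp.
pose good S := (A \subset S) && (#|S|%:R <= sigma * n%:R).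
apply: le_trans (_ : \sum_(S | good S) gnp_prob p (fun G => exists f d, forest G A S f d /\
    forall x y, x \in S -> y \notin S -> ~~ adj G x y) <= _).
  apply: gnp_prob_union => // G [S [f [d [h1 h2 h3]]]]; exists S; last by exists f, d.
  by rewrite /good h3 andbT; case: h1.
rewrite (partition_big (fun S => inord #|S| : 'I_n.+1) xpredT) //=.
apply: le_trans (_ : \sum_(s < n.+1) expR (- (eta * #|A|%:R)) <= _); last first.
  by rewrite sumr_const card_ord mulr_natl.
apply: ler_sum => s _.
have sz S : (inord #|S| == s) = (#|S| == s :> nat).
  rewrite -val_eqE /= inordK // ltnS; apply: leq_trans (max_card _) _.
  by rewrite card_ord.
have [hs|hs] := boolP ((#|A| <= s)%N && (s%:R <= sigma * n%:R)); last first.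
  rewrite big1 ?expR_ge0 // => S /andP [/andP [h1 h2]]; rewrite sz => /eqP E1.
  by case/negP: hs; rewrite -E1 subset_leq_card.
have {hs} [hAs hss] := andP hs.
set k := (s - #|A|)%N; set X := (s%:R * p) ^+ k * expR (- (p * (s * (n - s))%:R)).
have X0 : 0 <= X by rewrite mulr_ge0 ?expR_ge0 // exprn_ge0 // mulr_ge0.
apply: le_trans (_ : \sum_(S in [set S : {set 'I_n} | (A \subset S) && (#|S| == s)]) X <= _).
  rewrite [leLHS]big_mkcond [leRHS]big_mkcond; apply: ler_sum => S _.
  rewrite !inE sz /good; case: (boolP (A \subset S)) => hAS //=.
  case: (eqVneq #|S| s) => [E1|]; last by rewrite andbF.
  rewrite andbT; case: ifP => // _.
  by apply: le_trans (gnp_forest_closed hp hAS) _; rewrite E1.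
set F := [set S : {set 'I_n} | (A \subset S) && (#|S| == s)].
have -> : \sum_(S in F) X = #|F|%:R * X by rewrite sumr_const [RHS]mulr_natl.
apply: le_trans (ler_wpM2r X0 (card_supersets hAs)) _.
have sn : (s <= n)%N by rewrite -ltnS.
rewrite /X -/k; apply: le_trans (_ : c ^+ s * expR s%:R * expR (- (c * s%:R * (1 - sigma))) <= _).
  rewrite mulrA; apply: ler_pM; rewrite ?expR_ge0 //.
    apply: mulr_ge0; first by apply: divr_ge0 => //; apply: exprn_ge0.
      by apply: exprn_ge0; apply: mulr_ge0.
    have -> : n%:R ^+ k / k`!%:R * (s%:R * p) ^+ k = c ^+ k * (s%:R ^+ k / k`!%:R).
      rewrite [LHS]mulrAC -exprMn [RHS]mulrA -exprMn; congr (_ / _); congr (_ ^+ _).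
      by rewrite /p; field; rewrite gt_eqF.
    apply: ler_pM; rewrite ?exprn_ge0 ?divr_ge0 ?exprn_ge0 //.
      by apply: ler_weXn2l => //; apply: leq_subr.
    exact: expr_fact_le_expR.
  rewrite ler_expR lerN2 natrM natrB // /p.
  have -> : c / n%:R * (s%:R * (n%:R - s%:R)) = c * s%:R * (1 - s%:R / n%:R).
    by field; rewrite gt_eqF.
  apply: ler_wpM2l; first by rewrite mulr_ge0.
  by rewrite lerD2l lerN2 ler_pdivrMr.
have -> : c ^+ s * expR s%:R * expR (- (c * s%:R * (1 - sigma))) =
    (c * expR (1 - c * (1 - sigma))) ^+ s.
  rewrite exprMn -mulrA -expRD -expRM_natr; congr (_ * expR _); ring.
apply: le_trans (_ : expR (- eta) ^+ s <= _).
  apply: lerXn2r; rewrite ?nnegrE ?mulr_ge0 ?expR_ge0 //.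
  apply: le_trans (ler_wpM2r (expR_ge0 _) hq) _; rewrite -expRD ler_expR le_eqVlt.
  by apply/orP; left; apply/eqP; ring.
rewrite -expRM_natr ler_expR mulNr lerN2.
by apply: ler_wpM2l => //; rewrite ler_nat.
Qed.

End RandomGraph.

(** * Sprinkling and the separations of a forest *)

Section Sprinkling.
Variables (R : realType) (n : nat).
Implicit Types (p : R) (G H : sgraph 'I_n) (A B S W X Y Z : {set 'I_n}).

(** Two rounds of exposure: unless the first graph is in [S], it has to be in [Gd], and then the
    second one fails with probability at most [T]. *)
Lemma gnp_sprinkling_bound p q (P S Gd : sgraph 'I_n -> Prop)
    (Q : sgraph 'I_n -> sgraph 'I_n -> Prop) (T : R) :
  0 <= p <= 1 -> 0 <= q <= 1 -> 0 <= T ->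
  (forall G H, P (gunion G H) -> S G \/ (Gd G /\ Q G H)) ->
  (forall G, Gd G -> gnp_prob q (Q G) <= T) ->
  gnp_prob (p + q - p * q) P <= gnp_prob p S + T.
Proof.
move=> hp hq hT hP hQ; rewrite gnp_probE -gnp_sprinkling.
apply: le_trans (_ : \sum_G gnp_mass p G * (`[< S G >]%:R + T) <= _); last first.
  under eq_bigr do rewrite mulrDr.
  by rewrite big_split /= -mulr_suml sum_gnp_mass mul1r gnp_probE.
apply: ler_sum => G _; apply: ler_wpM2l; first exact: gnp_mass_ge0.
case: (asboolP (S G)) => [hS|hS].
  apply: le_trans (_ : 1 <= _); last by rewrite lerDl.
  apply: le_trans (_ : \sum_(H : sgraph 'I_n) gnp_mass q H <= _); last first.
    by rewrite sum_gnp_mass.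
  apply: ler_sum => H _; rewrite -[leRHS]mulr1.
  by apply: ler_wpM2l; [apply: gnp_mass_ge0|case: asboolP].
rewrite add0r; have [hG|hG] := pselect (Gd G).
  apply: le_trans (hQ G hG); rewrite gnp_probE; apply: ler_sum => H _.
  apply: ler_wpM2l; first exact: gnp_mass_ge0.
  by case: asboolP => [/hP [//|[_ hQGH]]|_]; rewrite ?ler0n // (asboolT hQGH).
rewrite big1 // => H _; case: asboolP => [/hP [//|[//]]|_].
by rewrite mulr0.
Qed.

(* After deleting [Z], a colouring [Y] of the forest that is constant on its trees is
   determined by the old roots and by the new ones, which are neighbours of [Z]. *)
Definition colouring (f : 'I_n -> 'I_n) A W Z Y :=
  (Y \subset W :\: Z) &&
  [forall w in W :\: (Z :|: A), (f w \notin Z) ==> ((w \in Y) == (f w \in Y))].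

Lemma card_colourings G A W Z f d b : forest G A W f d ->
  (#|neighbours G Z| <= b)%N ->
  (#|[set Y | colouring f A W Z Y]| <= 2 ^ (#|A| + b))%N.
Proof.
move=> [_ hf] hb; pose M := A :|: neighbours G Z.
apply: leq_trans (_ : 2 ^ #|M| <= _)%N; last first.
  rewrite leq_exp2l //; apply: leq_trans (leq_card_setU _ _) _.
  by rewrite leq_add2l.
rewrite -card_powerset -(card_in_imset (f := fun Y => Y :&: M)).
  apply: subset_leq_card; apply/subsetP => X /imsetP [Y _ ->].
  by rewrite powersetE subsetIr.
move=> Y1 Y2; rewrite !inE => /andP [s1 /forallP c1] /andP [s2 /forallP c2] E.
apply/setP => w; have [k] := ubnP (d w); elim: k w => // k IH w hk.
have [hw|hw] := boolP (w \in W :\: Z); last first.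
  have nY Y : Y \subset W :\: Z -> (w \in Y) = false.
    by move=> s; apply: contraNF hw; apply: (subsetP s).
  by rewrite !nY.
have [hM|hM] := boolP (w \in M).
  by have /setP/(_ w) := E; rewrite !in_setI hM !andbT.
move: hw; rewrite inE => /andP [hwZ hwW].
move: hM; rewrite in_setU negb_or => /andP [hwA hwN].
have [fW fadj fd] := hf _ hwW hwA.
have fZ : f w \notin Z.
  apply: contra hwN => h; rewrite inE hwZ; apply/existsP; exists (f w).
  by rewrite h adj_sym.
have := c1 w; have := c2 w; rewrite !inE hwW (negbTE hwZ) (negbTE hwA) fZ /=.
move=> /eqP -> /eqP ->; apply: IH; exact: leq_trans fd _.
Qed.

(** The forest edges of [G] survive in the union, so the trace [Y] on [W] of a separation is a
    colouring. For given [Z] and [Y], the graph [H] misses all the pairs between two disjoint sets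
    with at least a quarter of [W] each. *)
Lemma gnp_separated G A W f d (z b : nat) (q y : R) :
  0 <= q <= 1 -> 0 <= y -> forest G A W f d -> thin G z b ->
  gnp_prob q (fun H => separated (gunion G H) W z) <=
  expR (y * z%:R + expR (- y) * n%:R) * (2 ^ (#|A| + b))%:R *
  expR (- (q * (#|W|%:R ^+ 2 / 16))).
Proof.
move=> hq hy hfo hth; have [hq0 hq1] := andP hq; have [hAW hf] := hfo.
pose D Z Y := W :\: (Y :|: Z).
pose P1 Z := (#|Z| <= z)%N.
pose P2 Z Y := [&& colouring f A W Z Y, (#|W| <= 4 * #|Y|)%N & (#|W| <= 4 * #|D Z Y|)%N].
have hD Z Y : [disjoint Y & D Z Y].
  by rewrite -setI_eq0; apply/eqP/setP => x; rewrite !inE; case: (x \in Y).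
apply: le_trans (_ : \sum_(q' | P1 q'.1 && P2 q'.1 q'.2) gnp_prob q
  (fun H => set0 \subset edges H /\ [disjoint cut_edges q'.2 (D q'.1 q'.2) & edges H]) <= _).
  apply: gnp_prob_union => // H [X [Z [h1 h2 h3 h4 h5]]].
  pose Y := W :&: X.
  have EY : W :\: (Y :|: Z) = W :\: (X :|: Z).
    by apply/setP => x; rewrite !inE; case: (x \in W); rewrite ?andbF // !andbT.
  exists (Z, Y); rewrite /P1 /P2 /= ?h1 /D ?EY ?h4 ?h5 /= ?andbT.
    apply/andP; split.
      apply/subsetP => x; rewrite !inE => /andP [-> hx]; rewrite andbT.
      by rewrite (disjointFr h2 hx).
    apply/forallP => w; apply/implyP; rewrite !inE negb_or => /andP [/andP [wZ wA] wW].
    apply/implyP => fZ; have [fW fadj _] := hf _ wW wA; rewrite wW fW /=.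
    have hadj : adj (gunion G H) w (f w) by rewrite adj_gunion fadj.
    case: (boolP (w \in X)) => wX; case: (boolP (f w \in X)) => fX //.
      by have := h3 _ _ wX fX fZ; rewrite hadj.
    by have := h3 _ _ fX wX wZ; rewrite adj_sym hadj.
  split; first exact: sub0set.
  apply: cut_edges_disjoint => u v; rewrite !inE => /andP [uW uX].
  rewrite negb_or => /andP [/andP [vX vZ] _].
  have := h3 _ _ uX vX vZ; rewrite adj_gunion negb_or => /andP [_ ->] //.
set T := expR (- (q * _)).
apply: le_trans (_ : \sum_(q' | P1 q'.1 && P2 q'.1 q'.2) T <= _).
  apply: ler_sum => -[Z Y] /= /andP [_ /and3P [_ h4 h5]].
  rewrite gnp_prob_edges; last first.
  - by rewrite -setI_eq0 set0I.
  - by move=> e; apply: cut_edges_card2.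
  - by move=> e; rewrite inE.
  rewrite cards0 expr0 mul1r card_cut_edges //.
  apply: le_trans (one_sub_expR _ hq1) _; rewrite ler_expR lerN2.
  apply: ler_wpM2l => //; rewrite ler_pdivrMr // -natrX -[16]/(16%:R) -natrM ler_nat.
  rewrite -mulnn; have := leq_mul h4 h5; rewrite mulnACA [(4 * 4)%N]/= mulnC.
  by move=> h; exact: h.
rewrite -(pair_big_dep P1 P2 (fun _ _ => T)) /=.
apply: le_trans (_ : \sum_(Z | P1 Z) (2 ^ (#|A| + b))%:R * T <= _).
  apply: ler_sum => Z hZ; apply: le_trans (_ : \sum_(Y in [set Y | colouring f A W Z Y]) T <= _).
    rewrite [leLHS]big_mkcond [leRHS]big_mkcond; apply: ler_sum => Y _.
    by rewrite /P2 inE; case: (colouring _ _ _ _ _) => //=; case: ifP => // _; apply: expR_ge0.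
  rewrite sumr_const -[_ *+ _]mulr_natl; apply: ler_wpM2r; first exact: expR_ge0.
  by rewrite ler_nat; apply: (card_colourings hfo); apply: hth.
have -> : \sum_(Z | P1 Z) (2 ^ (#|A| + b))%:R * T =
    #|[set Z : {set 'I_n} | #|Z| <= z]%N|%:R * ((2 ^ (#|A| + b))%:R * T).
  by rewrite [RHS]mulr_natl -sumr_const; apply: eq_bigl => Z; rewrite inE.
rewrite -mulrA; apply: ler_wpM2r; first by rewrite mulr_ge0 ?expR_ge0.
by apply: le_trans (card_small_sets _ _ hy) _; rewrite card_ord.
Qed.

Lemma thin_gunionl G H z b : thin (gunion G H) z b -> thin G z b.
Proof.
move=> h B hB; apply: leq_trans (h B hB); apply: subset_leq_card.
apply/subsetP => y; rewrite !inE => /andP [-> /existsP [x /andP [hx hxy]]] /=.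
by apply/existsP; exists x; rewrite hx adj_gunion hxy.
Qed.

End Sprinkling.

(** * The supercritical case *)

Lemma gnp_supercritical (R : realType) (c : R) : 1 < c ->
  exists c' : R, 0 < c' /\
    gnp_aas c (fun n (G : sgraph 'I_n) =>
      [/\ c' * n%:R <= (rank_width G)%:R,
          c' * n%:R <= (clique_width G)%:R &
          c' * n%:R <= (tree_width G)%:R]).
Proof.
move=> hc; have c0 : 0 <= c by apply: le_trans (ltW hc).
pose c1 := (1 + c) / 2; pose eps := (c - 1) / 2.
have hc1 : 1 < c1 by rewrite /c1; lra.
have c1c : c1 <= c by rewrite /c1; lra.
have heps : 0 < eps by rewrite /eps; lra.
have c10 : 0 < c1 by apply: lt_trans hc1.
(* Half of the positive quantity c1 - 1 - ln c1; the other half pays for [c1 * sig], so that [hq] is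
   an equality. *)
pose eta := (c1 - 1 - ln c1) / 2.
have heta : 0 < eta.
  rewrite /eta divr_gt0 // subr_gt0 -ltr_expR lnK ?posrE //.
  have := @expR_gt1Dx R (c1 - 1); rewrite subr_eq0 gt_eqF // => /(_ isT).
  by rewrite addrC subrK.
pose sig := eta / c1; have hsig : 0 < sig by rewrite divr_gt0.
have hq : c1 <= expR (c1 - 1 - c1 * sig - eta).
  have -> : c1 - 1 - c1 * sig - eta = ln c1.
    by rewrite /sig mulrC divfK ?gt_eqF // /eta; field.
  by rewrite lnK ?posrE.
(* The added edges destroy a given splitting except with probability exp(- kap * n). One eighth of
   this exponent is allotted to each of the four counting terms, which leaves [4 * k8]. *)
pose kap := eps * sig ^+ 2 / 16; have hkap : 0 < kap.
  by rewrite divr_gt0 // mulr_gt0 // exprn_gt0.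
pose k8 := kap / 8; have hk8 : 0 < k8 by rewrite divr_gt0.
pose tau : R := Num.min k8 1.
have htau : 0 < tau by rewrite lt_min hk8 ltr01.
have cp1 : 0 < c + 1 by rewrite ltr_wpDl.
pose thn (delta : R) := expR (- (3 / delta)) / (c + 1).
have hthn delta : 0 < thn delta by rewrite divr_gt0 // expR_gt0.
(* The three bounds serve, in this order, to count the sets [Z], to bound their neighbourhoods by
   [b], and to have 12 z <= #|W|. Likewise [mu] ensures that sets of size [k] have at most [z]
   neighbours and that k <= z. *)
pose zeta := Num.min (Num.min (k8 ^+ 2) (thn k8)) (sig / 12).
have hzeta : 0 < zeta by rewrite !lt_min exprn_gt0 // hthn divr_gt0.
pose mu := Num.min (thn zeta) zeta.
have hmu : 0 < mu by rewrite lt_min hthn hzeta.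
exists (mu / 2); split; first by rewrite divr_gt0.
pose C := 2 * expR eta * (2 / (eta * tau) ^+ 2) + 2 + 2 + 2 / (4 * k8) ^+ 2.
(* Makes [sig * n] at least 4, for #|W| > 3, and [mu * n] at least 2, so that truncation costs at
   most half of [mu * n]. *)
pose N := (Num.bound (4 / sig) + Num.bound (2 / mu) + 1)%N.
apply: (@gnp_aas_bound R c C _ N) => // n hN n0 hcn.
have hn : (0 < n)%N by rewrite -(ltr0n R).
have sign : 4 <= sig * n%:R.
  rewrite mulrC -ler_pdivrMr //; apply/ltW.
  apply: lt_le_trans (archi_boundP _) _; first by rewrite divr_ge0 // ltW.
  by rewrite ler_nat; apply: leq_trans hN; rewrite /N -addnA leq_addr.
have mun : 2 <= mu * n%:R.
  rewrite mulrC -ler_pdivrMr //; apply/ltW.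
  apply: lt_le_trans (archi_boundP _) _; first by rewrite divr_ge0 // ltW.
  by rewrite ler_nat; apply: leq_trans hN; rewrite /N addnAC leq_addl.
have trP (x : R) : 0 <= x -> (Num.truncn (x * n%:R))%:R <= x * n%:R < (Num.truncn (x * n%:R)).+1%:R.
  by move=> hx; apply: Num.Theory.truncn_itv; rewrite mulr_ge0.
pose z := Num.truncn (zeta * n%:R); have /andP [hz1 hz2] := trP zeta (ltW hzeta).
pose b := Num.truncn (k8 * n%:R); have /andP [hb1 hb2] := trP k8 (ltW hk8).
pose k := Num.truncn (mu * n%:R); have /andP [hk1 hk2] := trP mu (ltW hmu).
pose r := Num.truncn (tau * n%:R); have /andP [hr1 hr2] := trP tau (ltW htau).
rewrite -/z -/b -/k -/r in hz1 hz2 hb1 hb2 hk1 hk2 hr1 hr2.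
have rn : (r <= n)%N.
  rewrite -(ler_nat R); apply: le_trans hr1 _; rewrite -[leRHS]mul1r.
  by apply: ler_wpM2r => //; rewrite ge_min lexx orbT.
have kz : (k <= z)%N.
  rewrite -ltnS -(ltr_nat R); apply: le_lt_trans hk1 _; apply: le_lt_trans hz2.
  by apply: ler_wpM2r => //; rewrite ge_min lexx orbT.
pose A := [set i : 'I_n | (i < r)%N].
have hA : #|A| = r.
  have -> : A = [set widen_ord rn i | i : 'I_r].
    apply/setP => i; rewrite inE; apply/idP/imsetP => [hi|[j _ ->]]; last exact: ltn_ord j.
    by exists (Ordinal hi) => //; apply: val_inj.
  rewrite card_imset ?card_ord // => i j /(congr1 val) /=.
  exact: val_inj.
(* [q] solves p = p1 + q - p1 * q. *)
set p := c / n%:R; pose p1 := c1 / n%:R; pose q := (p - p1) / (1 - p1).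
have hp : 0 <= p <= 1.
  by rewrite divr_ge0 ?(ltW n0) //= ler_pdivrMr // mul1r.
have c1n : c1 < n%:R by apply: lt_le_trans hcn; rewrite /c1; lra.
have p1lt : 0 < 1 - p1 by rewrite subr_gt0 ltr_pdivrMr // mul1r.
have hp1 : 0 <= p1 <= 1.
  by rewrite divr_ge0 ?(ltW n0) ?(ltW c10) //= -subr_ge0 ltW.
have pp1 : 0 <= p - p1 by rewrite subr_ge0 ler_wpM2r // invr_ge0 ltW.
have hqq : 0 <= q <= 1.
  by rewrite divr_ge0 ?(ltW p1lt) //= ler_pdivrMr // mul1r lerD2r; case/andP: hp.
have pE : p = p1 + q - p1 * q.
  by rewrite /q; field; rewrite gt_eqF.
have qge : eps / n%:R <= q.
  apply: le_trans (_ : p - p1 <= _).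
    by rewrite -mulrBl ler_wpM2r ?invr_ge0 ?(ltW n0) // /eps /c1; lra.
  rewrite /q ler_pdivlMr // -[leRHS]mulr1; apply: ler_wpM2l => //.
  by rewrite gerBl; case/andP: hp1.
set Bad := fun G : sgraph 'I_n => ~ _.
have narrowB G : Bad G -> narrow G k.
  move=> hB; apply/negPn/negP; rewrite /narrow !negb_or -!leqNgt => /and3P [h1 h2 h3].
  have hk : mu / 2 * n%:R <= k%:R.
    by move: hk2 mun; rewrite -natr1 mulrAC; lra.
  by apply: hB; split; apply: le_trans hk _; rewrite ler_nat.
(* [W] is a function of the first graph alone, hence fixed before the edges of the second one are
   exposed. *)
have [W hW] := choice (fun G => closed_forest G A).
pose S (G : sgraph 'I_n) := exists S f d, [/\ forest G A S f d,
    forall x y, x \in S -> y \notin S -> ~~ adj G x y & #|S|%:R <= sig * n%:R].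
pose Gd G := thin G z b /\ sig * n%:R < #|W G|%:R.
pose P G := [/\ Bad G, thin G z b & thin G k z].
have hzs : zeta <= sig / 12 by rewrite ge_min lexx orbT.
have hz8 : zeta <= k8 ^+ 2 by rewrite !ge_min lexx.
have hzt : zeta <= thn k8 by rewrite !ge_min lexx orbT.
have hP G H : P (gunion G H) -> S G \/ (Gd G /\ separated (gunion G H) (W G) z).
  move=> [hB t1 t2]; have [f [d [hf hcl]]] := hW G.
  have [hWs|hWs] := leP #|W G|%:R (sig * n%:R).
    by left; exists (W G), f, d.
  right; split; first by split => //; apply: thin_gunionl t1.
  apply: (narrow_separated t2 (leqnn k) kz (narrowB _ hB)).
    by rewrite -(ltr_nat R); apply: lt_trans hWs; apply: lt_le_trans sign; rewrite ltr_nat.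
  rewrite -(ler_nat R); apply: ltW; apply: le_lt_trans hWs.
  rewrite natrM; have : zeta * n%:R <= sig / 12 * n%:R by apply: ler_wpM2r.
  by move: hz1; rewrite mulrAC; lra.
have hQ G : Gd G -> gnp_prob q (fun H => separated (gunion G H) (W G) z) <=
    expR (- (4 * k8 * n%:R)).
  move=> [t1 hWs]; have [f [d [hf _]]] := hW G.
  have y0 : 0 <= k8^-1 by rewrite invr_ge0 ltW.
  apply: le_trans (gnp_separated hqq y0 hf t1) _; rewrite hA.
  apply: le_trans (_ : expR (k8^-1 * z%:R + expR (- k8^-1) * n%:R) * expR (r + b)%:R *
      expR (- (q * (#|W G|%:R ^+ 2 / 16))) <= _).
    apply: ler_wpM2r; first exact: expR_ge0.
    by apply: ler_wpM2l; [exact: expR_ge0|exact: natX2_le_expR].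
  rewrite -!expRD ler_expR natrD.
  (* The four terms are the two of [card_small_sets] for y = 1 / k8, the roots and the neighbours of
     [Z]. *)
  have b1 : k8^-1 * z%:R <= k8 * n%:R.
    rewrite ler_pdivrMl //; apply: le_trans hz1 _; rewrite mulrA -expr2.
    exact: ler_wpM2r.
  have b2 : expR (- k8^-1) * n%:R <= k8 * n%:R.
    apply: ler_wpM2r => //; rewrite expRN -[leRHS]invrK lef_pV2 ?posrE ?expR_gt0 ?invr_gt0 //.
    by apply: le_trans (expR_ge1Dx _); rewrite lerDr.
  have b3 : r%:R <= k8 * n%:R.
    apply: le_trans hr1 _; apply: ler_wpM2r => //; by rewrite ge_min lexx.
  have b4 : 8 * (k8 * n%:R) <= q * (#|W G|%:R ^+ 2 / 16).
    apply: le_trans (_ : eps / n%:R * ((sig * n%:R) ^+ 2 / 16) <= _).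
      rewrite le_eqVlt; apply/orP; left; apply/eqP; rewrite /k8 /kap; field.
      by rewrite gt_eqF.
    apply: ler_pM => //; first by rewrite divr_ge0 // ltW.
      by rewrite divr_ge0 // sqr_ge0.
    apply: ler_wpM2r; first by rewrite invr_ge0.
    apply: lerXn2r; last exact: ltW.
      by rewrite nnegrE; apply: mulr_ge0 (ltW hsig) _.
    by rewrite nnegrE.
  by move: b1 b2 b3 b4 hb1; lra.
have main : gnp_prob p Bad <= gnp_prob p (fun G : sgraph 'I_n => ~ thin G z b) +
    (gnp_prob p (fun G : sgraph 'I_n => ~ thin G k z) + gnp_prob p P).
  apply: le_trans (gnp_prob_union2 (Q := fun G : sgraph 'I_n => ~ thin G z b) (S := fun G : sgraph 'I_n => ~ thin G k z \/ P G) hp _) _; last first.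
    by rewrite lerD2l; apply: gnp_prob_union2.
  move=> G hB; have [t1|] := pselect (thin G z b); last by left.
  by right; have [t2|] := pselect (thin G k z); [right|left].
apply: le_trans main _.
have e1 : expR (- n%:R) <= 2 / n%:R :> R.
  have := expR_decay (@ltr01 R) hn; rewrite mul1r expr1n divr1; apply: le_trans.
  by rewrite -[leLHS]mul1r ler_wpM2r ?expR_ge0 // ler1n.
have T2 : gnp_prob p (fun G : sgraph 'I_n => ~ thin G z b) <= 2 / n%:R.
  apply: le_trans e1; apply: (gnp_not_thin c0 hk8 hn hcn); last exact: ltW.
  by apply: le_trans hz1 _; apply: ler_wpM2r.
have T3 : gnp_prob p (fun G : sgraph 'I_n => ~ thin G k z) <= 2 / n%:R.
  apply: le_trans e1; apply: (gnp_not_thin c0 hzeta hn hcn); last exact: ltW.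
  by apply: le_trans hk1 _; apply: ler_wpM2r => //; rewrite ge_min lexx.
have T4 : gnp_prob p P <= gnp_prob p1 S + expR (- (4 * k8 * n%:R)).
  rewrite pE; apply: gnp_sprinkling_bound hP hQ => //; exact: expR_ge0.
have T5 : expR (- (4 * k8 * n%:R)) <= 2 / (4 * k8) ^+ 2 / n%:R.
  apply: le_trans (expR_decay _ hn); last by rewrite mulr_gt0.
  by rewrite -[leLHS]mul1r ler_wpM2r ?expR_ge0 // ler1n.
have T6 : gnp_prob p1 S <= 2 * expR eta * (2 / (eta * tau) ^+ 2) / n%:R.
  apply: le_trans (gnp_small_forest _ (ltW hc1) hn (ltW c1n) (ltW heta) hq) _.
  rewrite hA; apply: le_trans (_ : 2 * n%:R * (expR eta * expR (- (eta * tau * n%:R))) <= _).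
    apply: ler_pM; rewrite ?expR_ge0 //.
      by rewrite -natrM ler_nat mul2n -addnn -addn1 leq_add2l.
    rewrite -expRD ler_expR; have : eta * (tau * n%:R) <= eta * r.+1%:R.
      by apply: ler_wpM2l; rewrite ltW.
    by rewrite -natr1; lra.
  have -> : 2 * n%:R * (expR eta * expR (- (eta * tau * n%:R))) =
      2 * expR eta * (n%:R * expR (- (eta * tau * n%:R))) by ring.
  rewrite -[leRHS]mulrA; apply: ler_wpM2l; first by rewrite mulr_ge0 ?expR_ge0.
  by apply: expR_decay => //; apply: mulr_gt0.
have -> : C / n%:R = 2 / n%:R + (2 / n%:R +
    (2 * expR eta * (2 / (eta * tau) ^+ 2) / n%:R + 2 / (4 * k8) ^+ 2 / n%:R)).
  by rewrite /C !mulrDl; ring.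
apply: lerD => //; apply: lerD => //; apply: le_trans T4 _.
exact: lerD.
Qed.

Theorem corollary1p2 (R : realType) (c : R) (hc : 0 <= c) :
  (1 < c ->
     exists c' : R, 0 < c' /\
       gnp_aas c (fun n (G : sgraph 'I_n) =>
         [/\ c' * n%:R <= (rank_width G)%:R,
             c' * n%:R <= (clique_width G)%:R &
             c' * n%:R <= (tree_width G)%:R])) /\
  (c < 1 ->
     gnp_aas c (fun n (G : sgraph 'I_n) =>
       [/\ (rank_width G <= 2)%N, (tree_width G <= 2)%N &
           (clique_width G <= 5)%N])).
Proof.
split; [exact: gnp_supercritical|exact: gnp_subcritical].
Qed.
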